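(* Let $m\ge3$ be an integer. For $\Re(\tau)>0$, the function $G_m(e^{-\tau})$ satisfies the identity $$G_m(e^{-\tau}) = g_m\sqrt{\tau}\,\exp\Bigl(\frac{\varpi_m}{\tau}+\phi_m\tau\Bigr)K_m\bigl(e^{-4\pi^2/\tau}\bigr)L_m\bigl(e^{-4\pi^2/\tau}\bigr),$$ where the constants depending on $m$ are $$g_m:=(2\pi)^{-(m^2-3m+4)/4}\prod_{1\le k<j<m}\Gamma\Bigl(\frac{k+j}{2m}\Bigr),\qquad \varpi_m:=\frac{\pi^2}{24}\Bigl(m+1+\frac2m\Bigr),\qquad \phi_m:=\frac{m^3-7m+2}{96},$$ and the two functions $K_m$ and $L_m$ are $$K_m(z):=\sqrt{\frac{P(z^{1/m})}{P(z^{1/2})}}\;P(z)^{(m+2)/4},$$ $$L_m(z):=\exp\Biggl(-\frac1{2m}\sum_{1\le\ell<m}\frac{\cos\bigl(\frac{(2\ell-1)\pi}{m}\bigr)}{1-\cos\bigl(\frac{(2\ell-1)\pi}{m}\bigr)}\sum_{j\ge0}\frac{z^{j+\frac{2\ell-1}{2m}}}{\bigl(j+\frac{2\ell-1}{2m}\bigr)\bigl(1-z^{j+\frac{2\ell-1}{2m}}\bigr)}\Biggr).$$ Both $K_m(z)$ and $L_m(z)$ are analytic in $|z|<1$, $z\notin[-1,0]$.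
   Context: For $|z|<1$, $$G_m(z)=P(z)Q_m(z),\quad P(z)=\prod_{k\ge1}\frac1{1-z^k},\quad Q_m(z)=\prod_{k\ge0}\ \prod_{1\le h<j<m}\frac1{1-z^{2mk+h+j}}$$ (the generating function of banded plane partitions of width $m$). $\sqrt\tau$ is the principal branch. Non-integer powers of $P$ (and the square root) are defined through $\log P(z)=\sum_{j\ge1}\frac{z^j}{j(1-z^j)}$. Fractional powers $z^a$ are principal powers on $|z|<1$, $z\notin[-1,0]$; when $K_m,L_m$ are evaluated at $z=e^{-4\pi^2/\tau}$, the power $z^a$ is understood as $e^{-4\pi^2a/\tau}$.
   Formalization: In L_m the outer sum is taken over 1 ≤ ℓ ≤ m instead of the printed 1 ≤ ℓ < m; the ℓ = m term is nonzero for real τ > 0 and m ≥ 3, so the identity fails with the printed range. *)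

(* Defs.v *)
From Stdlib Require Export Reals List.
From Coquelicot Require Export Coquelicot.
Export ListNotations.
Open Scope C_scope.

Definition Cexp (z : C) : C :=
  ((exp (Re z) * cos (Im z))%R, (exp (Re z) * sin (Im z))%R).

(* Principal argument, in ]-PI, PI] for z <> 0. *)
Definition Carg (z : C) : R :=
  if Rle_dec 0 (Im z) then acos (Re z / Cmod z) else (- acos (Re z / Cmod z))%R.

Definition Clog (z : C) : C := (ln (Cmod z), Carg z).

(* Principal power z^a; [Cpow] is Coquelicot's power by a natural number. *)
Definition Cppow (z : C) (a : R) : C := Cexp (RtoC a * Clog z).

Definition Csqrt (z : C) : C := Cppow z (1 / 2).

Definition Csum (l : list C) : C := fold_right Cplus (RtoC 0) l.
Definition Cprod (l : list C) : C := fold_right Cmult (RtoC 1) l.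
Definition Rprod (l : list R) : R := fold_right Rmult 1%R l.

(* Total, like [Lim_seq]: meaningful for sequences that converge in C. *)
Definition Clim_seq (u : nat -> C) : C :=
  (real (Lim_seq (fun n => Re (u n))), real (Lim_seq (fun n => Im (u n)))).

Definition CSeries (u : nat -> C) : C :=
  Clim_seq (fun n => Csum (map u (seq 0 n))).

Definition Cinf_prod (u : nat -> C) : C :=
  Clim_seq (fun n => Cprod (map u (seq 0 n))).

(* Differentiable over C in a neighbourhood of every point of D. *)
Definition analytic_on (D : C -> Prop) (f : C -> C) : Prop :=
  forall z : C, D z ->
    locally z (fun w => @ex_derive C_AbsRing C_NormedModule f w).

(* Euler's integral; meaningful for x > 0. *)
Definition Gamma (x : R) : R :=
  RInt_gen (fun t => (Rpower t (x - 1) * exp (- t))%R)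
           (at_right 0%R) (Rbar_locally p_infty).

(* The pairs (h, j) with 1 <= h < j < m, each occurring once. *)
Definition index_pairs (m : nat) : list (nat * nat) :=
  flat_map (fun j => map (fun h => (h, j)) (seq 1 (j - 1))) (seq 1 (m - 1)).

Definition P (z : C) : C :=
  Cinf_prod (fun k => 1 / (1 - z ^ (k + 1))).

Definition Q (m : nat) (z : C) : C :=
  Cinf_prod (fun k =>
    Cprod (map (fun hj => 1 / (1 - z ^ (2 * m * k + fst hj + snd hj)))
               (index_pairs m))).

Definition G (m : nat) (z : C) : C := P z * Q m z.

(* log P(z) = sum_{j >= 1} z^j / (j (1 - z^j)), indexed from j = 0; real powers
   of P are exponentials of multiples of this logarithm. *)
Definition logP (z : C) : C :=
  CSeries (fun j => z ^ (j + 1) / (RtoC (INR (j + 1)) * (1 - z ^ (j + 1)))).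

Definition Ppow (z : C) (a : R) : C := Cexp (RtoC a * logP z).

Definition sqrt_Pquot (u v : C) : C :=
  Cexp (RtoC (1 / 2) * (logP u - logP v)).

Definition g_const (m : nat) : R :=
  (Rpower (2 * PI) (- ((INR m ^ 2 - 3 * INR m + 4) / 4))
   * Rprod (map (fun kj => Gamma (INR (fst kj + snd kj) / (2 * INR m)))
                (index_pairs m)))%R.

Definition varpi_const (m : nat) : R :=
  (PI ^ 2 / 24 * (INR m + 1 + 2 / INR m))%R.

Definition phi_const (m : nat) : R :=
  ((INR m ^ 3 - 7 * INR m + 2) / 96)%R.

(* In K and L, [pw a] is the value given to the fractional power z^a: the
   principal one for K and L as functions on the slit disc, and the one coming
   from a chosen logarithm of z in the transformation formula. *)
Definition K (m : nat) (pw : R -> C) (z : C) : C :=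
  sqrt_Pquot (pw (1 / INR m)%R) (pw (1 / 2)%R) * Ppow z ((INR m + 2) / 4).

Definition L_coef (m l : nat) : R :=
  (cos ((2 * INR l - 1) * PI / INR m)
   / (1 - cos ((2 * INR l - 1) * PI / INR m)))%R.

Definition L_expo (m l j : nat) : R :=
  (INR j + (2 * INR l - 1) / (2 * INR m))%R.

(* l ranges over 1 <= l <= m, so that the fractional parts (2 l - 1) / (2 m) of
   the exponents are symmetric under a <-> 1 - a. The last term l = m, which is
   exponentially small as tau -> 0, cannot be dropped from the transformation
   formula: for m = 3 and tau = 10 one has G_3(e^(-tau)) = 1.0000454..., while
   summing over 1 <= l < m only would give 1.00788... on the other side. *)
Definition L (m : nat) (pw : R -> C) : C :=
  Cexp (- RtoC (1 / (2 * INR m)) *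
    Csum (map (fun l =>
      RtoC (L_coef m l) *
      CSeries (fun j =>
        pw (L_expo m l j) /
        (RtoC (L_expo m l j) * (1 - pw (L_expo m l j)))))
      (seq 1 m))).

(* |z| < 1, z not in [-1, 0] *)
Definition slit_disc (z : C) : Prop :=
  (Cmod z < 1)%R /\ ~ (Im z = 0%R /\ (-1 <= Re z <= 0)%R).

(* Main.v *)
Require Import Defs.
From Stdlib Require Import Lra Lia Psatz Classical Factorial.

(** A logarithm turns the products into Lambert series and the identity into a modular
    transformation. Put [q = e^{-tau}] and [w = - 4 pi^2 / tau]. The factors of [Q_m] are
    indexed by the sums [s = h + j], and the multiset of these sums is invariant under
    [s -> 2m - s]. Hence [log Q_m] is half the sum, over the pairs, of the logarithms of the
    generalized eta products [prod_k 1 / ((1 - q^{2mk+s}) (1 - q^{2mk+2m-s}))]. With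
    [t = 2 m tau], [a = s / (2m)] and [q' = e^{- 4 pi^2 / t}], each of them obeys ([theta_log])

      sum_n (e^{-nat} + e^{-n(1-a)t}) / (n (1 - e^{-nt}))
        = pi^2 / (3t) - log (2 sin (pi a)) - (t/2) (a^2 - a + 1/6)
          + 2 sum_k (cos (2 pi k a) / k) q'^k / (1 - q'^k).

    For the proof, the n-th term on the left is expanded by the Fourier series of
    [cosh (c (1/2 - a)) / sinh (c/2)] at [c = n t] ([cosh_fourier]). This gives the double
    series of [4 t cos (2 pi k a) / (n^2 t^2 + 4 pi^2 k^2)], and the sum over [n] with [k]
    fixed is the same Fourier series at [a = 0] and [c = 4 pi^2 k / t], a hyperbolic
    cotangent. The double series is not absolutely convergent, but for [0 < a < 1] summation
    by parts in [k] makes its tails O(1/(n^2 + k^2)), which is enough to exchange the sums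
    ([Cser_exchange]). The Fourier series themselves come from the Dirichlet kernel: their
    partial sums satisfy the right differential equation up to an oscillating term that
    disappears in the limit ([riemann_lebesgue]).

    As [a -> 0] the formula becomes the square of the transformation formula of [P]; the
    sign of the square root is constant on the half-plane and is read off at [tau = 1]
    ([eta_transformation]).

    Summed over the pairs, the dual series has the coefficients
    [sum_(h<j) cos (pi (h + j) n / m)]. They depend only on [n] modulo [2m]
    ([pairsum_root]): they are 1 for even [n] and [- cos / (1 - cos)] at the angle
    [pi n / m] for odd [n], with corrections when [n] is 0 or [m] modulo [2m]. Collecting
    residues, the even [n] produce [P(z^{1/m})^{1/2}], the corrections produce
    [P(z^{1/2})^{-1/2}] and powers of [P(z)], and the odd [n] produce [L]
    ([dual_series_by_residues]). The factors [2 sin (pi a)] become Gamma values by the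
    reflection formula ([Gamma_reflection]), which follows from the functional equation,
    Wendel's inequality and the sine product, the latter being the Fourier series above at
    an imaginary value of [c].

    The functions [K] and [L] are exponentials of Lambert series in [log z], which are
    differentiable term by term because the quadratic remainders of the terms are summable
    ([cdiff_lambert]). *)

(** * Convergence of complex sequences and series *)

Definition psum (u : nat -> C) (n : nat) : C := Csum (map u (seq 0 n)).
(** Convergence is phrased with the modulus so that all limits reduce to squeezes of
    real sequences; [Ccv_components] relates it to the real and imaginary parts. *)
Definition Ccv (u : nat -> C) (l : C) : Prop :=
  is_lim_seq (fun n => Cmod (u n - l)) 0%R.
Definition Cser (u : nat -> C) (s : C) : Prop := Ccv (psum u) s.

Lemma Csum_app (l1 l2 : list C) : Csum (l1 ++ l2) = Csum l1 + Csum l2.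
Proof.
  induction l1 as [|a l IH]; simpl; [ring | rewrite IH; ring].
Qed.

Lemma psum_0 u : psum u 0 = 0.
Proof. reflexivity. Qed.

Lemma psum_S u n : psum u (S n) = psum u n + u n.
Proof.
  unfold psum. rewrite seq_S, map_app, Csum_app. simpl. ring.
Qed.

Lemma psum_ext u v n : (forall k, (k < n)%nat -> u k = v k) -> psum u n = psum v n.
Proof.
  induction n as [|n IH]; intros H; [reflexivity|].
  rewrite !psum_S, H, IH by (try (intros; apply H); lia). reflexivity.
Qed.

Lemma psum_plus u v n : psum (fun k => u k + v k) n = psum u n + psum v n.
Proof.
  induction n as [|n IH]; [rewrite !psum_0; ring|]. rewrite !psum_S, IH. ring.
Qed.

Lemma psum_scal c u n : psum (fun k => c * u k) n = c * psum u n.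
Proof.
  induction n as [|n IH]; [rewrite !psum_0; ring|]. rewrite !psum_S, IH. ring.
Qed.

Lemma psum_add u n k : psum u (n + k) = psum u n + psum (fun i => u (n + i)%nat) k.
Proof.
  induction k as [|k IH].
  - rewrite Nat.add_0_r, psum_0. ring.
  - rewrite Nat.add_succ_r, !psum_S, IH. ring.
Qed.

Lemma is_lim_seq_0_le (u v : nat -> R) :
  (forall n, 0 <= u n <= v n)%R -> is_lim_seq v 0%R -> is_lim_seq u 0%R.
Proof.
  intros H Hv. apply (is_lim_seq_le_le (fun _ => 0%R) u v); auto.
  apply is_lim_seq_const.
Qed.

Lemma is_lim_seq_scal_0 (K : R) (u : nat -> R) :
  is_lim_seq u 0%R -> is_lim_seq (fun n => K * u n)%R 0%R.
Proof.
  intros H. replace (Finite 0) with (Rbar_mult K 0%R) by (simpl; f_equal; ring).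
  now apply is_lim_seq_scal_l.
Qed.

Lemma Ccv_bound u l e :
  (forall n, Cmod (u n - l) <= e n)%R -> is_lim_seq e 0%R -> Ccv u l.
Proof.
  intros H He. apply (is_lim_seq_0_le _ e); auto.
  intros n; split; [apply Cmod_ge_0 | apply H].
Qed.

Lemma Ccv_ext u v l : (forall n, u n = v n) -> Ccv u l -> Ccv v l.
Proof.
  intros H. apply is_lim_seq_ext. intros n. now rewrite H.
Qed.

Lemma Ccv_const c : Ccv (fun _ => c) c.
Proof.
  apply Ccv_bound with (fun _ => 0%R); [|apply is_lim_seq_const].
  intros _. replace (c - c) with (RtoC 0) by ring. rewrite Cmod_0. lra.
Qed.

Lemma Ccv_plus u v a b : Ccv u a -> Ccv v b -> Ccv (fun n => u n + v n) (a + b).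
Proof.
  intros Hu Hv.
  apply Ccv_bound with (fun n => Cmod (u n - a) + Cmod (v n - b))%R.
  - intros n. replace (u n + v n - (a + b)) with ((u n - a) + (v n - b)) by ring.
    apply Cmod_triangle.
  - replace (Finite 0) with (Finite (0 + 0)) by (f_equal; ring).
    now apply is_lim_seq_plus'.
Qed.

Lemma Ccv_scal c u a : Ccv u a -> Ccv (fun n => c * u n) (c * a).
Proof.
  intros Hu. apply Ccv_bound with (fun n => Cmod c * Cmod (u n - a))%R.
  - intros n. rewrite <- Cmod_mult. right. f_equal. ring.
  - now apply is_lim_seq_scal_0.
Qed.

Lemma Ccv_minus u v a b : Ccv u a -> Ccv v b -> Ccv (fun n => u n - v n) (a - b).
Proof.
  intros Hu Hv. replace (a - b) with (a + (- (1)) * b) by ring.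
  apply Ccv_ext with (fun n => u n + (- (1)) * v n); [intros; ring|].
  apply Ccv_plus; auto. now apply Ccv_scal.
Qed.

Lemma Ccv_subseq u l (f : nat -> nat) :
  (forall n, (n <= f n)%nat) -> Ccv u l -> Ccv (fun n => u (f n)) l.
Proof.
  intros Hf Hu. unfold Ccv.
  apply (is_lim_seq_subseq (fun n => Cmod (u n - l)) _ f); auto.
  intros P [N HN]. exists N. intros n Hn. apply HN. specialize (Hf n). lia.
Qed.

Lemma Ccv_le u l M : (forall n, Cmod (u n) <= M)%R -> Ccv u l -> (Cmod l <= M)%R.
Proof.
  intros HM Hu.
  assert (is_lim_seq (fun n => M + Cmod (u n - l))%R (M + 0)%R).
  { apply is_lim_seq_plus'; [apply is_lim_seq_const | exact Hu]. }
  replace M with (M + 0)%R by ring.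
  apply (is_lim_seq_le (fun _ => Cmod l) (fun n => M + Cmod (u n - l))%R (Cmod l) (M + 0)%R); auto.
  - intros n. replace l with (u n + - (u n - l)) at 1 by ring.
    eapply Rle_trans; [apply Cmod_triangle|]. rewrite Cmod_opp. specialize (HM n). lra.
  - apply is_lim_seq_const.
Qed.

Lemma Ccv_unique u a b : Ccv u a -> Ccv u b -> a = b.
Proof.
  intros Ha Hb. apply Ceq_minus, Cmod_eq_0. apply Rle_antisym; [|apply Cmod_ge_0].
  apply (Ccv_le (fun n => u n - u n)).
  - intros n. replace (u n - u n) with (RtoC 0) by ring. rewrite Cmod_0. lra.
  - now apply Ccv_minus.
Qed.

Lemma Im_le_Cmod (z : C) : (Rabs (Im z) <= Cmod z)%R.
Proof.
  eapply Rle_trans; [|apply Rmax_Cmod]. apply Rmax_r.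
Qed.

Lemma Cmod_le_ReIm (z : C) : (Cmod z <= Rabs (Re z) + Rabs (Im z))%R.
Proof.
  replace z with (RtoC (Re z) + Ci * RtoC (Im z)) at 1.
  - eapply Rle_trans; [apply Cmod_triangle|].
    rewrite Cmod_mult, Cmod_Ci, !Cmod_R. lra.
  - destruct z as [x y]. apply injective_projections; unfold Re, Im; simpl; ring.
Qed.

Lemma Ccv_components u l :
  Ccv u l <-> is_lim_seq (fun n => Re (u n)) (Re l) /\ is_lim_seq (fun n => Im (u n)) (Im l).
Proof.
  split.
  - intros H; split; apply is_lim_seq_spec; apply is_lim_seq_spec in H;
      intros eps; destruct (H eps) as [N HN]; exists N; intros n Hn;
      specialize (HN n Hn); rewrite Rminus_0_r, Rabs_pos_eq in HN by apply Cmod_ge_0;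
      eapply Rle_lt_trans; try exact HN.
    + apply (re_le_Cmod (u n - l)).
    + apply (Im_le_Cmod (u n - l)).
  - intros [H1 H2].
    apply Ccv_bound with (fun n => Rabs (Re (u n) - Re l) + Rabs (Im (u n) - Im l))%R.
    + intros n. apply (Cmod_le_ReIm (u n - l)).
    + replace (Finite 0) with (Finite (0 + 0)) by (f_equal; ring).
      assert (G : forall (v : nat -> R) (a : R), is_lim_seq v a ->
                is_lim_seq (fun n => Rabs (v n - a)) 0%R).
      { intros v a Hv. rewrite <- (Rabs_R0). apply (is_lim_seq_abs _ 0%R).
        replace 0%R with (a - a)%R by ring. apply is_lim_seq_minus'; auto.
        apply is_lim_seq_const. }
      apply is_lim_seq_plus'; now apply G.
Qed.

Lemma Ccv_Clim u l : Ccv u l -> Clim_seq u = l.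
Proof.
  intros H. apply Ccv_components in H. destruct H as [H1 H2].
  unfold Clim_seq. rewrite (is_lim_seq_unique _ _ H1), (is_lim_seq_unique _ _ H2).
  symmetry. apply surjective_pairing.
Qed.

Lemma Cser_CSeries u s : Cser u s -> CSeries u = s.
Proof. apply Ccv_Clim. Qed.

Lemma Cser_unique u a b : Cser u a -> Cser u b -> a = b.
Proof. apply Ccv_unique. Qed.

Lemma Cser_ext u v s : (forall n, u n = v n) -> Cser u s -> Cser v s.
Proof.
  intros H. apply Ccv_ext. intros n. apply psum_ext; auto.
Qed.

Lemma Cser_plus u v a b : Cser u a -> Cser v b -> Cser (fun n => u n + v n) (a + b).
Proof.
  intros Ha Hb. apply Ccv_ext with (fun n => psum u n + psum v n).
  - intros n. now rewrite psum_plus.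
  - now apply Ccv_plus.
Qed.

Lemma Cser_scal c u a : Cser u a -> Cser (fun n => c * u n) (c * a).
Proof.
  intros Ha. apply Ccv_ext with (fun n => c * psum u n).
  - intros n. now rewrite psum_scal.
  - now apply Ccv_scal.
Qed.

Lemma Cser_minus u v a b : Cser u a -> Cser v b -> Cser (fun n => u n - v n) (a - b).
Proof.
  intros Hu Hv. replace (a - b) with (a + (- (1)) * b) by ring.
  apply Cser_ext with (fun n => u n + (- (1)) * v n); [intros; ring|].
  apply Cser_plus; auto. now apply Cser_scal.
Qed.

Lemma Cser_0 : Cser (fun _ => 0) 0.
Proof.
  apply Ccv_ext with (fun _ => 0); [|apply Ccv_const].
  intros n. induction n as [|n IH]; [reflexivity|]. rewrite psum_S, <- IH. ring.
Qed.

Lemma Cser_Csum {A : Type} (l : list A) (u : A -> nat -> C) (s : A -> C) :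
  (forall a, In a l -> Cser (u a) (s a)) ->
  Cser (fun n => Csum (map (fun a => u a n) l)) (Csum (map s l)).
Proof.
  induction l as [|a l IH]; intros H; simpl.
  - apply Cser_0.
  - apply Cser_plus; [apply H; now left | apply IH; intros; apply H; now right].
Qed.

Lemma Cser_tail u s n : Cser u s -> Cser (fun k => u (n + k)%nat) (s - psum u n).
Proof.
  intros H. apply Ccv_ext with (fun k => psum u (n + k)%nat - psum u n).
  - intros k. rewrite psum_add. ring.
  - apply Ccv_minus; [|apply Ccv_const].
    apply Ccv_subseq with (f := fun k => (n + k)%nat) in H; auto. intros; lia.
Qed.

Lemma psum_Cmod_le u (b : nat -> R) n :
  (forall k, Cmod (u k) <= b k)%R -> (Cmod (psum u (S n)) <= sum_n b n)%R.
Proof.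
  intros H. induction n as [|n IH].
  - rewrite psum_S, psum_0, sum_O. replace (0 + u 0%nat) with (u 0%nat) by ring. apply H.
  - rewrite psum_S, sum_Sn. eapply Rle_trans; [apply Cmod_triangle|].
    apply Rplus_le_compat; auto.
Qed.

Lemma Cser_le u s (b : nat -> R) B :
  Cser u s -> (forall k, Cmod (u k) <= b k)%R -> is_series b B -> (Cmod s <= B)%R.
Proof.
  intros Hu H Hb.
  apply (Ccv_le (fun n => psum u (S n))).
  - intros n. eapply Rle_trans; [apply psum_Cmod_le; exact H|].
    assert (Hb' : is_lim_seq (sum_n b) B) by exact Hb.
    apply (is_lim_seq_incr_compare (sum_n b) B Hb').
    intros k. rewrite sum_Sn.
    assert (0 <= b (S k))%R by (eapply Rle_trans; [apply Cmod_ge_0 | apply H]).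
    change (sum_n b k <= sum_n b k + b (S k))%R. lra.
  - apply (Ccv_subseq (psum u) s S); auto.
Qed.

Lemma sum_n_components (u : nat -> C) n :
  Re (psum u (S n)) = sum_n (fun k => Re (u k)) n /\
  Im (psum u (S n)) = sum_n (fun k => Im (u k)) n.
Proof.
  induction n as [|n [IH1 IH2]].
  - rewrite psum_S, psum_0, !sum_O. split; unfold Re, Im; simpl; ring.
  - rewrite psum_S, !sum_Sn, <- IH1, <- IH2. split; reflexivity.
Qed.

Lemma Cser_components u s :
  Cser u s <-> is_series (fun k => Re (u k)) (Re s) /\ is_series (fun k => Im (u k)) (Im s).
Proof.
  unfold Cser. rewrite Ccv_components.
  assert (E : forall (v w : nat -> R) (l : R), (forall n, v (S n) = sum_n w n) ->
     is_lim_seq v l <-> is_series w l).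
  { intros v w l Hvw. rewrite is_lim_seq_incr_1.
    split; [ | intros H; change (is_lim_seq (sum_n w) l) in H; revert H];
      apply is_lim_seq_ext; auto. }
  rewrite (E _ (fun k => Re (u k)) (Re s)) by (intros; apply sum_n_components).
  rewrite (E _ (fun k => Im (u k)) (Im s)) by (intros; apply sum_n_components).
  reflexivity.
Qed.

Lemma Cser_abs u (b : nat -> R) :
  (forall k, Cmod (u k) <= b k)%R -> ex_series b -> exists s, Cser u s.
Proof.
  intros H Hb.
  assert (H1 : ex_series (fun k => Re (u k))).
  { apply (ex_series_le (K := R_AbsRing) (V := R_CompleteNormedModule) _ b); auto.
    intros n. eapply Rle_trans; [apply (re_le_Cmod (u n)) | apply H]. }
  assert (H2 : ex_series (fun k => Im (u k))).
  { apply (ex_series_le (K := R_AbsRing) (V := R_CompleteNormedModule) _ b); auto.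
    intros n. eapply Rle_trans; [apply (Im_le_Cmod (u n)) | apply H]. }
  destruct H1 as [x Hx], H2 as [y Hy]. exists (x, y).
  apply Cser_components. split; assumption.
Qed.

Lemma Cser_abs_CSeries u (b : nat -> R) :
  (forall k, Cmod (u k) <= b k)%R -> ex_series b -> Cser u (CSeries u).
Proof.
  intros H Hb. destruct (Cser_abs u b H Hb) as [s Hs]. now rewrite (Cser_CSeries _ _ Hs).
Qed.

(** * The complex exponential *)

Lemma Cexp_plus a b : Cexp (a + b) = Cexp a * Cexp b.
Proof.
  unfold Cexp, Re, Im. apply injective_projections; simpl; rewrite exp_plus.
  - rewrite cos_plus. ring.
  - rewrite sin_plus. ring.
Qed.

Lemma Cexp_RtoC (x : R) : Cexp x = exp x.
Proof.
  unfold Cexp, Re, Im. simpl. rewrite cos_0, sin_0.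
  apply injective_projections; simpl; ring.
Qed.

Lemma Cexp_0 : Cexp 0 = 1.
Proof. rewrite Cexp_RtoC. now rewrite exp_0. Qed.

Lemma Cmod_Cexp z : Cmod (Cexp z) = exp (Re z).
Proof.
  unfold Cmod, Cexp. simpl.
  replace (exp (Re z) * cos (Im z) * (exp (Re z) * cos (Im z) * 1)
    + exp (Re z) * sin (Im z) * (exp (Re z) * sin (Im z) * 1))%R
    with (exp (Re z) * exp (Re z) * (Rsqr (sin (Im z)) + Rsqr (cos (Im z))))%R
    by (unfold Rsqr; ring).
  rewrite sin2_cos2, Rmult_1_r. apply sqrt_square. left. apply exp_pos.
Qed.

Lemma Cexp_neq_0 z : Cexp z <> 0.
Proof.
  apply Cmod_gt_0. rewrite Cmod_Cexp. apply exp_pos.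
Qed.

Lemma Cexp_opp z : Cexp (- z) = / Cexp z.
Proof.
  assert (H : Cexp (- z) * Cexp z = 1).
  { rewrite <- Cexp_plus. replace (- z + z) with (RtoC 0) by ring. apply Cexp_0. }
  rewrite <- (Cmult_1_l (/ Cexp z)), <- H. field. apply Cexp_neq_0.
Qed.

Lemma Cexp_minus a b : Cexp (a - b) = Cexp a / Cexp b.
Proof. unfold Cminus, Cdiv. now rewrite Cexp_plus, Cexp_opp. Qed.

Lemma Cexp_pow z n : Cexp z ^ n = Cexp (INR n * z).
Proof.
  induction n as [|n IH].
  - simpl. replace (0 * z) with (RtoC 0) by ring. now rewrite Cexp_0.
  - rewrite Cpow_S, IH, <- Cexp_plus, S_INR, RtoC_plus. f_equal. ring.
Qed.

Lemma Cexp_Csum {A : Type} (l : list A) (f : A -> C) :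
  Cexp (Csum (map f l)) = Cprod (map (fun a => Cexp (f a)) l).
Proof.
  induction l as [|a l IH]; simpl; [apply Cexp_0|]. now rewrite Cexp_plus, IH.
Qed.

(** * Real-variable calculus for complex-valued functions *)

(** Componentwise derivative: the product rule and the mean value theorem for real
    functions carry over without any normed-module structure. *)
Definition rderiv (f : R -> C) (x : R) (d : C) : Prop :=
  is_derive (fun s => Re (f s)) x (Re d) /\ is_derive (fun s => Im (f s)) x (Im d).

Lemma rderiv_ext f g x d : (forall s, f s = g s) -> rderiv f x d -> rderiv g x d.
Proof.
  intros H [H1 H2]. split; [revert H1 | revert H2]; apply is_derive_ext;
    intros t; now rewrite H.
Qed.

Lemma rderiv_eq f x d d' : d = d' -> rderiv f x d -> rderiv f x d'.
Proof. now intros ->. Qed.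

Lemma rderiv_const c x : rderiv (fun _ => c) x 0.
Proof.
  split; simpl; apply is_derive_Reals, derivable_pt_lim_const.
Qed.

Lemma rderiv_RtoC (f : R -> R) x (d : R) :
  is_derive f x d -> rderiv (fun s => RtoC (f s)) x (RtoC d).
Proof.
  intros H. split; simpl; [exact H|]. apply is_derive_Reals, derivable_pt_lim_const.
Qed.

Lemma rderiv_plus f g x a b :
  rderiv f x a -> rderiv g x b -> rderiv (fun s => f s + g s) x (a + b).
Proof.
  intros [H1 H2] [H3 H4]. split; simpl.
  - exact (is_derive_plus _ _ _ _ _ H1 H3).
  - exact (is_derive_plus _ _ _ _ _ H2 H4).
Qed.

Lemma is_derive_mult_R (f g : R -> R) x a b :
  is_derive f x a -> is_derive g x b ->
  is_derive (fun s => f s * g s)%R x (a * g x + f x * b)%R.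
Proof.
  intros Hf Hg. apply is_derive_Reals. apply is_derive_Reals in Hf.
  apply is_derive_Reals in Hg. exact (derivable_pt_lim_mult f g x a b Hf Hg).
Qed.

Lemma rderiv_mult f g x a b :
  rderiv f x a -> rderiv g x b -> rderiv (fun s => f s * g s) x (a * g x + f x * b).
Proof.
  intros [H1 H2] [H3 H4]. split.
  - evar (l : R). replace (Re (a * g x + f x * b)) with l.
    + apply (is_derive_minus (fun s => Re (f s) * Re (g s))%R (fun s => Im (f s) * Im (g s))%R);
        unfold l; apply is_derive_mult_R; eassumption.
    + unfold l, minus, plus, opp; simpl. unfold Re, Im. ring.
  - evar (l : R). replace (Im (a * g x + f x * b)) with l.
    + apply (is_derive_plus (fun s => Re (f s) * Im (g s))%R (fun s => Im (f s) * Re (g s))%R);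
        unfold l; apply is_derive_mult_R; eassumption.
    + unfold l, minus, plus, opp; simpl. unfold Re, Im. ring.
Qed.

Lemma rderiv_scal c f x a : rderiv f x a -> rderiv (fun s => c * f s) x (c * a).
Proof.
  intros H. eapply rderiv_eq; [|apply rderiv_mult; [apply rderiv_const | exact H]].
  simpl. ring.
Qed.

Lemma rderiv_exp c x : rderiv (fun s => Cexp (c * RtoC s)) x (c * Cexp (c * RtoC x)).
Proof.
  destruct c as [p q]. split; unfold Cexp, Re, Im; simpl; auto_derive; auto; unfold Rminus; ring.
Qed.

Lemma rderiv_psum (f : nat -> R -> C) (d : nat -> C) x n :
  (forall k, (k < n)%nat -> rderiv (f k) x (d k)) ->
  rderiv (fun s => psum (fun k => f k s) n) x (psum d n).
Proof.
  induction n as [|n IH]; intros H.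
  - exact (rderiv_const (RtoC 0) x).
  - rewrite psum_S. apply rderiv_ext with (fun s => psum (fun k => f k s) n + f n s).
    { intros s. now rewrite psum_S. }
    apply rderiv_plus; [apply IH; intros; apply H; lia | apply H; lia].
Qed.

(** The real mean value theorem, applied to the projection of [f] on the direction of
    the increment [f b - f a]. *)
Lemma rderiv_MVT f d a b M :
  (a <= b)%R ->
  (forall x, (a <= x <= b)%R -> rderiv f x (d x)) ->
  (forall x, (a <= x <= b)%R -> Cmod (d x) <= M)%R ->
  (Cmod (f b - f a) <= M * (b - a))%R.
Proof.
  intros Hab Hd HM.
  set (u := Cconj (f b - f a)).
  assert (Hphi : forall x, (a <= x <= b)%R ->
     is_derive (fun s => Re (u * f s)) x (Re (u * d x))).
  { intros x Hx. assert (H : rderiv (fun s => u * f s) x (u * d x))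
      by now apply rderiv_scal, Hd. apply H. }
  destruct (MVT_gen (fun s => Re (u * f s)) a b (fun x => Re (u * d x))) as [c [Hc E]].
  - intros x Hx. rewrite Rmin_left, Rmax_right in Hx by lra. apply Hphi; lra.
  - intros x Hx. rewrite Rmin_left, Rmax_right in Hx by lra.
    apply derivable_continuous_pt. exists (Re (u * d x)). apply is_derive_Reals. now apply Hphi.
  - rewrite Rmin_left, Rmax_right in Hc by lra.
    assert (E2 : (Re (u * f b) - Re (u * f a))%R = (Cmod (f b - f a) ^ 2)%R).
    { rewrite Cmod2_alt. unfold u, Re, Im. simpl. ring. }
    rewrite E2 in E.
    assert (Hu : (Re (u * d c) <= Cmod (f b - f a) * M)%R).
    { eapply Rle_trans; [apply Rle_abs|]. eapply Rle_trans; [apply re_le_Cmod|].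
      rewrite Cmod_mult. unfold u. rewrite Cmod_conj.
      apply Rmult_le_compat_l; [apply Cmod_ge_0 | now apply HM]. }
    destruct (Rle_lt_or_eq_dec 0 (Cmod (f b - f a)) (Cmod_ge_0 _)) as [Hp|Hp].
    + apply Rmult_le_reg_l with (Cmod (f b - f a)); auto.
      replace (Cmod (f b - f a) * Cmod (f b - f a))%R with (Cmod (f b - f a) ^ 2)%R by ring.
      rewrite E. replace (Cmod (f b - f a) * (M * (b - a)))%R
        with (Cmod (f b - f a) * M * (b - a))%R by ring.
      apply Rmult_le_compat_r; lra.
    + rewrite <- Hp. apply Rmult_le_pos; [|lra].
      eapply Rle_trans; [apply Cmod_ge_0 | apply (HM a); lra].
Qed.

Lemma Cmod_Cexp_le z : (Cmod (Cexp z) <= exp (Cmod z))%R.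
Proof.
  rewrite Cmod_Cexp. destruct (Rle_lt_or_eq_dec _ _ (Rle_trans _ _ _ (Rle_abs _) (re_le_Cmod z)))
    as [H|H].
  - left. now apply exp_increasing.
  - right. now rewrite H.
Qed.

Lemma exp_le (x y : R) : (x <= y)%R -> (exp x <= exp y)%R.
Proof.
  intros [H|H]; [left; now apply exp_increasing | right; now rewrite H].
Qed.

Lemma Cexp_m1_le z : (Cmod (Cexp z - 1) <= Cmod z * exp (Cmod z))%R.
Proof.
  replace (Cexp z - 1) with (Cexp (z * RtoC 1) - Cexp (z * RtoC 0)).
  2:{ replace (z * RtoC 1) with z by ring. replace (z * RtoC 0) with (RtoC 0) by ring.
      now rewrite Cexp_0. }
  eapply Rle_trans.
  - apply (rderiv_MVT (fun s => Cexp (z * RtoC s)) (fun s => z * Cexp (z * RtoC s)) 0 1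
             (Cmod z * exp (Cmod z))%R); [lra | intros; apply rderiv_exp |].
    intros x Hx. rewrite Cmod_mult. apply Rmult_le_compat_l; [apply Cmod_ge_0|].
    eapply Rle_trans; [apply Cmod_Cexp_le|]. apply exp_le.
    rewrite Cmod_mult, Cmod_R, Rabs_pos_eq by lra.
    rewrite <- (Rmult_1_r (Cmod z)) at 2. apply Rmult_le_compat_l; [apply Cmod_ge_0 | lra].
  - lra.
Qed.

(** The derivative of [e^{sz} - sz] in [s] is [z (e^{sz} - 1)], which the preceding
    bound controls. *)
Lemma Cexp_m1_id_le z : (Cmod (Cexp z - 1 - z) <= Cmod z ^ 2 * exp (Cmod z))%R.
Proof.
  replace (Cexp z - 1 - z) with
    ((Cexp (z * RtoC 1) + (- z) * RtoC 1) - (Cexp (z * RtoC 0) + (- z) * RtoC 0)).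
  2:{ replace (z * RtoC 1) with z by ring. replace (z * RtoC 0) with (RtoC 0) by ring.
      rewrite Cexp_0. ring. }
  eapply Rle_trans.
  - apply (rderiv_MVT (fun s => Cexp (z * RtoC s) + (- z) * RtoC s)
             (fun s => z * Cexp (z * RtoC s) + (- z) * RtoC 1) 0 1
             (Cmod z ^ 2 * exp (Cmod z))%R); [lra | |].
    + intros x _. apply rderiv_plus; [apply rderiv_exp|].
      apply rderiv_scal, rderiv_RtoC. apply is_derive_Reals, derivable_pt_lim_id.
    + intros x Hx.
      replace (z * Cexp (z * RtoC x) + (- z) * RtoC 1) with (z * (Cexp (z * RtoC x) - 1)) by ring.
      rewrite Cmod_mult. replace (Cmod z ^ 2 * exp (Cmod z))%R
        with (Cmod z * (Cmod z * exp (Cmod z)))%R by ring.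
      apply Rmult_le_compat_l; [apply Cmod_ge_0|].
      eapply Rle_trans; [apply Cexp_m1_le|].
      assert (Cmod (z * RtoC x) <= Cmod z)%R.
      { rewrite Cmod_mult, Cmod_R, Rabs_pos_eq by lra.
        rewrite <- (Rmult_1_r (Cmod z)) at 2. apply Rmult_le_compat_l; [apply Cmod_ge_0 | lra]. }
      apply Rmult_le_compat; auto; [apply Cmod_ge_0 | left; apply exp_pos | now apply exp_le].
  - lra.
Qed.

Lemma Ccv_Cexp u l : Ccv u l -> Ccv (fun n => Cexp (u n)) (Cexp l).
Proof.
  intros H.
  apply Ccv_bound with (fun n => Cmod (Cexp l) * (Cmod (u n - l) * exp (Cmod (u n - l))))%R.
  - intros n. replace (Cexp (u n) - Cexp l) with (Cexp l * (Cexp (u n - l) - 1)).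
    + rewrite Cmod_mult. apply Rmult_le_compat_l; [apply Cmod_ge_0 | apply Cexp_m1_le].
    + rewrite Cexp_minus. field. apply Cexp_neq_0.
  - replace 0%R with (Cmod (Cexp l) * (0 * exp 0))%R by ring.
    apply is_lim_seq_mult'; [apply is_lim_seq_const|].
    apply is_lim_seq_mult'; auto.
    apply is_lim_seq_continuous; auto.
    apply derivable_continuous_pt, derivable_pt_exp.
Qed.

Lemma rderiv_Cexp f x d :
  rderiv f x d -> rderiv (fun s => Cexp (f s)) x (d * Cexp (f x)).
Proof.
  intros [H1 H2].
  assert (E1 := is_derive_comp exp (fun s => Re (f s)) x _ _ (is_derive_exp _) H1).
  assert (E2 := is_derive_comp cos (fun s => Im (f s)) x _ _ (is_derive_cos _) H2).
  assert (E3 := is_derive_comp sin (fun s => Im (f s)) x _ _ (is_derive_sin _) H2).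
  split.
  - eapply (fun H => eq_rect _ (is_derive _ x) (is_derive_mult_R _ _ x _ _ E1 E2) _ H).
    unfold scal, mult, Cexp, Re, Im; simpl. unfold mult; simpl. ring.
  - eapply (fun H => eq_rect _ (is_derive _ x) (is_derive_mult_R _ _ x _ _ E1 E3) _ H).
    unfold scal, mult, Cexp, Re, Im; simpl. unfold mult; simpl. ring.
Qed.

(** * The logarithm *)

Lemma psum_geom (z : C) n : psum (fun j => z ^ j) n * (1 - z) = 1 - z ^ n.
Proof.
  induction n as [|n IH].
  - rewrite psum_0. simpl. ring.
  - rewrite psum_S, Cpow_S.
    replace ((psum (fun j => z ^ j) n + z ^ n) * (1 - z))
      with (psum (fun j => z ^ j) n * (1 - z) + z ^ n * (1 - z)) by ring.
    rewrite IH. ring.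
Qed.

Lemma RtoC_neq_0 (x : R) : x <> 0%R -> RtoC x <> 0.
Proof. intros H E. apply H. now apply RtoC_inj. Qed.

Lemma INR_S_neq_0 j : RtoC (INR (j + 1)) <> 0.
Proof. apply RtoC_neq_0, not_0_INR. lia. Qed.

Lemma INR_S_ge_1 j : (1 <= INR (j + 1))%R.
Proof. apply (le_INR 1). lia. Qed.

Lemma is_series_geom_scal q c : (0 <= q < 1)%R -> is_series (fun n => c * q ^ n)%R (c / (1 - q))%R.
Proof.
  intros H. apply (is_series_scal (K := R_AbsRing) (V := R_NormedModule) c (fun n => (q ^ n)%R) (/ (1 - q))%R).
  apply is_series_geom. rewrite Rabs_pos_eq; lra.
Qed.

(** The sum of the Mercator series: this is [- log (1 - z)]. *)
Definition mlog (z : C) : C := CSeries (fun j => z ^ (j + 1) / RtoC (INR (j + 1))).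

Lemma mlog_term_le (z : C) j : (Cmod (z ^ (j + 1) / RtoC (INR (j + 1))) <= Cmod z * Cmod z ^ j)%R.
Proof.
  assert (H := INR_S_ge_1 j).
  rewrite Cmod_div by apply INR_S_neq_0. rewrite Cmod_R, Cmod_pow, Rabs_pos_eq by lra.
  rewrite Nat.add_1_r. simpl pow.
  apply Rle_div_l; [rewrite <- Nat.add_1_r; lra|]. rewrite <- Nat.add_1_r.
  assert (0 <= Cmod z * Cmod z ^ j)%R.
  { apply Rmult_le_pos; [|apply pow_le]; apply Cmod_ge_0. }
  nra.
Qed.

Lemma mlog_ser (z : C) : (Cmod z < 1)%R -> Cser (fun j => z ^ (j + 1) / RtoC (INR (j + 1))) (mlog z).
Proof.
  intros Hz. apply Cser_abs_CSeries with (1 := mlog_term_le z).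
  eexists. apply is_series_geom_scal. split; [apply Cmod_ge_0 | exact Hz].
Qed.

Lemma rderiv_pow n x :
  rderiv (fun s => RtoC (s ^ (n + 1))) x (RtoC (INR (n + 1) * x ^ n)).
Proof.
  apply rderiv_RtoC. auto_derive; auto. rewrite Nat.add_1_r. simpl pred. ring.
Qed.

(** The function [(1 - s z) exp (F_n (s z))], with [F_n] the partial sum of the
    series, has a derivative of size [|z|^n] on [0, 1] and equals 1 at 0. Hence its
    value at [s = 1] tends to 1. *)
Lemma mlog_exp (z : C) : (Cmod z < 1)%R -> Cexp (mlog z) = / (1 - z).
Proof.
  intros Hz.
  assert (Hz0 := Cmod_ge_0 z).
  assert (Hne : forall x, (0 <= x <= 1)%R -> 1 - z * RtoC x <> 0).
  { intros x Hx E. assert (K : z * RtoC x = 1).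
    { replace (z * RtoC x) with (1 - (1 - z * RtoC x)) by ring. rewrite E. ring. }
    apply (f_equal Cmod) in K. rewrite Cmod_mult, Cmod_R, Cmod_1, Rabs_pos_eq in K by lra.
    nra. }
  assert (H1 : 1 - z <> 0).
  { specialize (Hne 1%R). replace (z * RtoC 1) with z in Hne by ring. apply Hne. lra. }
  set (c := fun j => z ^ (j + 1) / RtoC (INR (j + 1))).
  set (F := fun n s => psum (fun j => c j * RtoC (s ^ (j + 1))) n).
  set (h := fun n s => (1 - z * RtoC s) * Cexp (F n s)).
  assert (HF : forall n x, (0 <= x <= 1)%R ->
     rderiv (F n) x (z * (1 - (z * RtoC x) ^ n) / (1 - z * RtoC x))).
  { intros n x Hx. eapply rderiv_eq; [|apply rderiv_psum with
      (d := fun j => c j * RtoC (INR (j + 1) * x ^ j));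
      intros k _; apply rderiv_scal, rderiv_pow].
    rewrite <- psum_geom.
    replace (z * (psum (fun j => (z * RtoC x) ^ j) n * (1 - z * RtoC x)) / (1 - z * RtoC x))
      with (z * psum (fun j => (z * RtoC x) ^ j) n) by (field; auto).
    rewrite <- psum_scal. apply psum_ext. intros k _. unfold c.
    rewrite RtoC_mult, RtoC_pow, Cpow_mult_l, Cpow_add_r, Cpow_1_r. field. apply INR_S_neq_0. }
  assert (Hh : forall n x, (0 <= x <= 1)%R ->
     rderiv (h n) x (- z * (z * RtoC x) ^ n * Cexp (F n x))).
  { intros n x Hx. eapply rderiv_eq; [|apply rderiv_mult; [|apply rderiv_Cexp, HF, Hx]].
    2:{ apply rderiv_plus; [apply (rderiv_const 1)|].
        apply rderiv_ext with (fun s => (- z) * RtoC s); [intros; ring|].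
        apply rderiv_scal, rderiv_RtoC. apply is_derive_Reals, derivable_pt_lim_id. }
    cbv beta. field. auto. }
  set (B := exp (Cmod z / (1 - Cmod z))).
  assert (HB : forall n x, (0 <= x <= 1)%R -> (Cmod (Cexp (F n x)) <= B)%R).
  { intros n x Hx. eapply Rle_trans; [apply Cmod_Cexp_le|]. apply exp_le.
    assert (G : (Cmod (F n x) <= Cmod z / (1 - Cmod z))%R).
    { destruct n as [|n]; [unfold F; rewrite psum_0, Cmod_0;
        apply Rdiv_le_0_compat; lra|].
      eapply Rle_trans; [apply (psum_Cmod_le _ (fun j => Cmod z * Cmod z ^ j)%R)|].
      - intros k. rewrite Cmod_mult, Cmod_R, <- RPow_abs, Rabs_pos_eq by lra.
        rewrite <- Rmult_1_r. apply Rmult_le_compat; try apply Cmod_ge_0.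
        + apply pow_le; lra.
        + apply mlog_term_le.
        + rewrite <- (pow1 (k + 1)). apply pow_incr. lra.
      - assert (K := is_series_geom_scal (Cmod z) (Cmod z) (conj Hz0 Hz)).
        apply (is_lim_seq_incr_compare (sum_n (fun j => Cmod z * Cmod z ^ j)%R)).
        + exact K.
        + intros k. rewrite sum_Sn. change plus with Rplus.
          assert (0 <= Cmod z * Cmod z ^ S k)%R by (apply Rmult_le_pos; [|apply pow_le]; lra).
          lra. }
    exact G. }
  assert (Hlim : Ccv (fun n => h n 1%R) 1).
  { apply Ccv_bound with (fun n => B * Cmod z ^ n)%R.
    - intros n. replace (h n 1%R - 1) with (h n 1%R - h n 0%R).
      2:{ f_equal. unfold h, F. f_equal. rewrite (psum_ext _ (fun _ => 0 * 0)).
          - rewrite psum_scal, Cmult_0_l, Cexp_0. ring.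
          - intros k _. rewrite pow_i by lia. ring. }
      eapply Rle_trans; [apply (rderiv_MVT (h n) _ 0 1 (B * Cmod z ^ n)%R ltac:(lra) (Hh n))|].
      + intros x Hx. rewrite !Cmod_mult, Cmod_opp, Cmod_pow, Cmod_mult, Cmod_R, (Rabs_pos_eq x) by lra.
        rewrite Rmult_comm. apply Rmult_le_compat; auto; try apply Cmod_ge_0.
        * apply Rmult_le_pos; auto. apply pow_le. apply Rmult_le_pos; lra.
        * assert ((Cmod z * x) ^ n <= Cmod z ^ n)%R by (apply pow_incr; nra).
          assert (0 <= (Cmod z * x) ^ n)%R by (apply pow_le; nra). nra.
      + lra.
    - replace 0%R with (B * 0)%R by ring. apply is_lim_seq_mult'; [apply is_lim_seq_const|].
      apply is_lim_seq_geom. rewrite Rabs_pos_eq; lra. }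
  assert (Hlim2 : Ccv (fun n => h n 1%R) ((1 - z) * Cexp (mlog z))).
  { apply Ccv_ext with (fun n => (1 - z) * Cexp (psum c n)).
    - intros n. unfold h, F. f_equal; [ring|]. f_equal. apply psum_ext.
      intros k _. rewrite pow1. ring.
    - apply Ccv_scal, Ccv_Cexp. apply mlog_ser, Hz. }
  assert (E := Ccv_unique _ _ _ Hlim Hlim2).
  replace (Cexp (mlog z)) with ((1 - z) * Cexp (mlog z) / (1 - z)) by (field; auto).
  rewrite <- E. field. auto.
Qed.

Lemma mlog_m_id_le (z : C) : (Cmod z < 1)%R -> (Cmod (mlog z - z) <= Cmod z ^ 2 / (1 - Cmod z))%R.
Proof.
  intros Hz. assert (Hz0 := Cmod_ge_0 z).
  assert (H := Cser_tail _ _ 1 (mlog_ser z Hz)).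
  rewrite psum_S, psum_0 in H.
  replace (mlog z - (0 + z ^ (0 + 1) / RtoC (INR (0 + 1)))) with (mlog z - z) in H
    by (simpl; field).
  apply (Cser_le _ _ (fun j => Cmod z ^ 2 * Cmod z ^ j)%R _ H).
  - intros k. eapply Rle_trans; [apply mlog_term_le|]. right. simpl. ring.
  - apply is_series_geom_scal. lra.
Qed.

(** The quotient is a number [e^{id}] equal to 1, and [cos d = 1 - 2 sin^2 (d/2)]
    forces [d = 0] when [|d| < 2 pi]. *)
Lemma Cexp_inj (a b : C) : Cexp a = Cexp b -> (Rabs (Im a - Im b) < 2 * PI)%R -> a = b.
Proof.
  intros H Hab.
  assert (HR : Re a = Re b).
  { apply exp_inv. rewrite <- !Cmod_Cexp. now rewrite H. }
  assert (E := H). apply (f_equal (fun z => z * / Cexp b)) in E.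
  rewrite Cinv_r in E by apply Cexp_neq_0. rewrite <- Cexp_opp, <- Cexp_plus in E.
  assert (Ec : cos (Im a - Im b) = 1%R).
  { apply (f_equal Re) in E. destruct a as [a1 a2], b as [b1 b2]. unfold Cexp, Re, Im in *.
    simpl in *. rewrite HR in E. replace (b1 + - b1)%R with 0%R in E by ring.
    rewrite exp_0, Rmult_1_l in E. exact E. }
  set (d := (Im a - Im b)%R) in *.
  assert (Es : sin (d / 2) = 0%R).
  { replace d with (2 * (d / 2))%R in Ec by field. rewrite cos_2a_sin in Ec. nra. }
  assert (Hd : d = 0%R).
  { apply Rabs_def2 in Hab. destruct (Rtotal_order d 0) as [Hn|[Hn|Hn]]; auto.
    - assert (0 < sin (- (d / 2)))%R by (apply sin_gt_0; lra). rewrite sin_neg in H0. lra.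
    - assert (0 < sin (d / 2))%R by (apply sin_gt_0; lra). lra. }
  apply injective_projections; [exact HR|]. unfold d, Im in Hd. lra.
Qed.

Lemma Carg_range (z : C) : (Re z / Cmod z <= 1 /\ -1 <= Re z / Cmod z)%R.
Proof.
  destruct (Ceq_dec z 0) as [->|Hz].
  - simpl. unfold Rdiv. rewrite Rmult_0_l. lra.
  - apply Cmod_gt_0 in Hz. assert (H := re_le_Cmod z). apply Rabs_le_between in H.
    split; [apply Rle_div_l; lra | apply Rle_div_r; lra].
Qed.

(** The sign chosen in [Carg] is that of the imaginary part, so sine and cosine of the
    argument are the two coordinates divided by the modulus. *)
Lemma Cexp_Clog (z : C) : z <> 0 -> Cexp (Clog z) = z.
Proof.
  intros Hz. assert (Hp := proj1 (Cmod_gt_0 z) Hz). assert (Hr := Carg_range z).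
  assert (Hc : cos (Carg z) = (Re z / Cmod z)%R).
  { unfold Carg. destruct (Rle_dec 0 (Im z)); [|rewrite cos_neg]; apply cos_acos; lra. }
  assert (Hsq : sqrt (1 - Rsqr (Re z / Cmod z)) = (Rabs (Im z) / Cmod z)%R).
  { rewrite <- (sqrt_Rsqr (Rabs (Im z) / Cmod z)).
    - f_equal. assert (E := Cmod2_alt z). unfold Rsqr.
      replace (Rabs (Im z) / Cmod z * (Rabs (Im z) / Cmod z))%R
        with (Rabs (Im z) * Rabs (Im z) / (Cmod z ^ 2))%R by (field; lra).
      rewrite <- Rabs_mult, Rabs_pos_eq by nra.
      replace (Im z * Im z)%R with (Cmod z ^ 2 - Re z ^ 2)%R by (rewrite E; ring). field. lra.
    - apply Rdiv_le_0_compat; [apply Rabs_pos | lra]. }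
  assert (Hs : sin (Carg z) = (Im z / Cmod z)%R).
  { unfold Carg. destruct (Rle_dec 0 (Im z)) as [Hi|Hi].
    - rewrite sin_acos by lra. rewrite Hsq, Rabs_pos_eq; auto.
    - rewrite sin_neg, sin_acos by lra. rewrite Hsq, Rabs_left by lra. field. lra. }
  unfold Cexp, Clog. change (Re (ln (Cmod z), Carg z)) with (ln (Cmod z)).
  change (Im (ln (Cmod z), Carg z)) with (Carg z).
  rewrite exp_ln, Hc, Hs by auto. destruct z as [x y].
  apply injective_projections; unfold Re, Im; simpl; field; unfold Cmod in *; simpl in *; lra.
Qed.

(** C minus the half-line of non-positive reals, where the principal branch is analytic. *)
Definition cut_plane (z : C) : Prop := ~ (Im z = 0%R /\ (Re z <= 0)%R).

Lemma cut_plane_neq_0 (z : C) : cut_plane z -> z <> 0.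
Proof. intros H ->. apply H. simpl. split; [reflexivity | lra]. Qed.

Lemma Carg_bound (z : C) : (- PI <= Carg z <= PI)%R.
Proof.
  unfold Carg. assert (H := acos_bound (Re z / Cmod z)).
  destruct (Rle_dec 0 (Im z)); lra.
Qed.

Lemma Carg_bound_lt (z : C) : cut_plane z -> (- PI < Carg z < PI)%R.
Proof.
  intros Hz. assert (Hp := proj1 (Cmod_gt_0 z) (cut_plane_neq_0 z Hz)).
  assert (Hb := Carg_bound z). assert (HPI := PI_RGT_0).
  assert (G : ~ (sin (Carg z) = 0%R /\ (cos (Carg z) <= 0)%R)).
  { intros [Hs Hc]. apply Hz. assert (E := Cexp_Clog z (cut_plane_neq_0 z Hz)).
    unfold Cexp, Clog, Re, Im in E. simpl in E. rewrite exp_ln in E by auto.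
    rewrite Hs in E. unfold Re, Im. rewrite <- E. simpl. split; [ring|]. nra. }
  split; apply Rnot_le_lt; intros K; apply G.
  - replace (Carg z) with (- PI)%R by lra. rewrite sin_neg, cos_neg, sin_PI, cos_PI. lra.
  - replace (Carg z) with PI by lra. rewrite sin_PI, cos_PI. lra.
Qed.

(** * Complex differentiability with a quadratic remainder *)

(** The quadratic bound on the remainder, rather than o(|w - z|), makes the notion
    stable under summation of series whose bounds are summable. *)
Definition cdiff (f : C -> C) (z d : C) : Prop :=
  exists r M, (0 < r)%R /\ (0 <= M)%R /\
    forall w, (Cmod (w - z) < r)%R -> (Cmod (f w - f z - d * (w - z)) <= M * Cmod (w - z) ^ 2)%R.

Lemma cdiff_ext_loc f g z d r :
  (0 < r)%R -> (forall w, (Cmod (w - z) < r)%R -> f w = g w) -> cdiff f z d -> cdiff g z d.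
Proof.
  intros Hr H (r' & M & Hr' & HM & Hf). exists (Rmin r r'), M.
  split; [now apply Rmin_pos|]. split; auto. intros w Hw.
  assert (H1 := Rmin_l r r'). assert (H2 := Rmin_r r r').
  rewrite <- !H; [apply Hf; lra | | lra].
  replace (z - z) with (RtoC 0) by ring. now rewrite Cmod_0.
Qed.

Lemma cdiff_ext f g z d : (forall w, f w = g w) -> cdiff f z d -> cdiff g z d.
Proof. intros H. apply (cdiff_ext_loc f g z d 1); [lra | auto]. Qed.

Lemma cdiff_affine c b z : cdiff (fun w => c * w + b) z c.
Proof.
  exists 1%R, 0%R. split; [lra|]. split; [lra|]. intros w _.
  replace (c * w + b - (c * z + b) - c * (w - z)) with (RtoC 0) by ring. rewrite Cmod_0. lra.
Qed.

Lemma cdiff_const b z : cdiff (fun _ => b) z 0.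
Proof. apply cdiff_ext with (fun w => 0 * w + b); [intros; ring | apply cdiff_affine]. Qed.

Lemma cdiff_plus f g z d e : cdiff f z d -> cdiff g z e -> cdiff (fun w => f w + g w) z (d + e).
Proof.
  intros (r & M & Hr & HM & Hf) (r' & M' & Hr' & HM' & Hg).
  exists (Rmin r r'), (M + M')%R. split; [now apply Rmin_pos|]. split; [lra|]. intros w Hw.
  assert (H1 := Rmin_l r r'). assert (H2 := Rmin_r r r').
  replace (f w + g w - (f z + g z) - (d + e) * (w - z))
    with ((f w - f z - d * (w - z)) + (g w - g z - e * (w - z))) by ring.
  eapply Rle_trans; [apply Cmod_triangle|]. rewrite Rmult_plus_distr_r.
  apply Rplus_le_compat; [apply Hf | apply Hg]; lra.
Qed.

Lemma cdiff_lip f z d : cdiff f z d ->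
  exists r L, (0 < r)%R /\ (0 <= L)%R /\
    forall w, (Cmod (w - z) < r)%R -> (Cmod (f w - f z) <= L * Cmod (w - z))%R.
Proof.
  intros (r & M & Hr & HM & Hf). exists r, (M * r + Cmod d)%R.
  assert (Hd := Cmod_ge_0 d).
  split; auto. split; [apply Rplus_le_le_0_compat; [apply Rmult_le_pos; lra | exact Hd]|].
  intros w Hw.
  replace (f w - f z) with ((f w - f z - d * (w - z)) + d * (w - z)) by ring.
  eapply Rle_trans; [apply Cmod_triangle|]. rewrite Rmult_plus_distr_r, Cmod_mult.
  apply Rplus_le_compat_r. eapply Rle_trans; [now apply Hf|].
  simpl. rewrite Rmult_1_r, <- Rmult_assoc. apply Rmult_le_compat_r; [apply Cmod_ge_0|].
  apply Rmult_le_compat_l; lra.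
Qed.

Lemma cdiff_comp f g z d e :
  cdiff f z d -> cdiff g (f z) e -> cdiff (fun w => g (f w)) z (e * d).
Proof.
  intros Hf Hg. destruct (cdiff_lip _ _ _ Hf) as (r1 & L & Hr1 & HL & Hlip).
  destruct Hf as (r & M & Hr & HM & Hf), Hg as (r' & M' & Hr' & HM' & Hg).
  set (r3 := (r' / (L + 1))%R).
  assert (Hr3 : (0 < r3)%R) by (apply Rdiv_lt_0_compat; lra).
  exists (Rmin (Rmin r1 r) r3), (M' * L ^ 2 + Cmod e * M)%R.
  assert (He := Cmod_ge_0 e).
  split; [repeat apply Rmin_pos; auto|].
  split; [apply Rplus_le_le_0_compat; apply Rmult_le_pos; auto; apply pow_le; auto|].
  intros w Hw.
  assert (Hw1 : (Cmod (w - z) < r1 /\ Cmod (w - z) < r /\ Cmod (w - z) < r3)%R).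
  { apply Rmin_Rgt_l in Hw. destruct Hw as [Hw H3]. apply Rmin_Rgt_l in Hw. lra. }
  destruct Hw1 as (W1 & W2 & W3).
  assert (Hn := Cmod_ge_0 (w - z)).
  assert (Hfw : (Cmod (f w - f z) < r')%R).
  { eapply Rle_lt_trans; [now apply Hlip|].
    apply Rle_lt_trans with ((L + 1) * Cmod (w - z))%R; [nra|].
    unfold r3 in W3. apply Rlt_div_r in W3; lra. }
  replace (g (f w) - g (f z) - e * d * (w - z))
    with ((g (f w) - g (f z) - e * (f w - f z)) + e * (f w - f z - d * (w - z))) by ring.
  eapply Rle_trans; [apply Cmod_triangle|]. rewrite Rmult_plus_distr_r, Cmod_mult.
  apply Rplus_le_compat.
  - eapply Rle_trans; [now apply Hg|]. rewrite Rmult_assoc. apply Rmult_le_compat_l; auto.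
    rewrite <- Rpow_mult_distr. apply pow_incr. split; [apply Cmod_ge_0 | now apply Hlip].
  - rewrite Rmult_assoc. apply Rmult_le_compat_l; auto.
Qed.

Lemma cdiff_scal c f z d : cdiff f z d -> cdiff (fun w => c * f w) z (c * d).
Proof.
  intros H. apply cdiff_ext with (fun w => c * f w + 0); [intros; ring|].
  apply (cdiff_comp f (fun v => c * v + 0)); auto. apply cdiff_affine.
Qed.

Lemma cdiff_exp (z : C) : cdiff Cexp z (Cexp z).
Proof.
  exists 1%R, (Cmod (Cexp z) * exp 1)%R. split; [lra|].
  assert (He := exp_pos 1). assert (Hz := Cmod_ge_0 (Cexp z)).
  split; [apply Rmult_le_pos; lra|]. intros w Hw.
  replace (Cexp w - Cexp z - Cexp z * (w - z)) with (Cexp z * (Cexp (w - z) - 1 - (w - z))).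
  2:{ rewrite Cexp_minus. field. apply Cexp_neq_0. }
  rewrite Cmod_mult, Rmult_assoc. apply Rmult_le_compat_l; auto.
  eapply Rle_trans; [apply Cexp_m1_id_le|]. rewrite Rmult_comm.
  apply Rmult_le_compat_r; [apply pow_le, Cmod_ge_0 | apply exp_le; lra].
Qed.

Lemma cdiff_Cexp f z d : cdiff f z d -> cdiff (fun w => Cexp (f w)) z (Cexp (f z) * d).
Proof. intros H. apply (cdiff_comp f Cexp); auto. apply cdiff_exp. Qed.

Lemma cdiff_inv (z : C) : z <> 0 -> cdiff Cinv z (- / (z * z)).
Proof.
  intros Hz. assert (Hp := proj1 (Cmod_gt_0 z) Hz).
  exists (Cmod z / 2)%R, (2 / Cmod z ^ 3)%R. split; [lra|].
  split; [left; apply Rdiv_lt_0_compat; [lra | apply pow_lt; auto]|]. intros w Hw.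
  assert (Hwz : (Cmod z / 2 <= Cmod w)%R).
  { assert (H := Cmod_triangle w (- (w - z))). replace (w + - (w - z)) with z in H by ring.
    rewrite Cmod_opp in H. lra. }
  assert (Hw0 : w <> 0) by (apply Cmod_gt_0; lra).
  replace (/ w - / z - - / (z * z) * (w - z)) with ((w - z) ^ 2 / (w * z ^ 2)) by (field; auto).
  rewrite Cmod_div by (apply Cmult_neq_0; [|apply Cpow_nz]; auto).
  rewrite Cmod_mult, !Cmod_pow.
  assert (Hd : (0 <= Cmod (w - z) ^ 2)%R) by apply pow2_ge_0.
  apply Rle_div_l; [apply Rmult_lt_0_compat; [lra | apply pow_lt; auto]|].
  replace (2 / Cmod z ^ 3 * Cmod (w - z) ^ 2 * (Cmod w * Cmod z ^ 2))%R
    with (Cmod (w - z) ^ 2 * (2 * Cmod w / Cmod z))%R by (field; lra).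
  rewrite <- (Rmult_1_r (Cmod (w - z) ^ 2)) at 1. apply Rmult_le_compat_l; auto.
  apply Rle_div_r; lra.
Qed.

(** Near [z], [Clog w = Clog z - mlog (- (w - z) / z)]: both sides have exponential
    [w], and their imaginary parts differ by less than [2 pi] because [Carg z] is not
    [pi]. The remainder is then that of the Mercator series. *)
Lemma cdiff_Clog (z : C) : cut_plane z -> cdiff Clog z (/ z).
Proof.
  intros Hz. assert (Hz0 := cut_plane_neq_0 z Hz). assert (Hp := proj1 (Cmod_gt_0 z) Hz0).
  assert (HPI := PI_RGT_0).
  assert (Ha := Carg_bound_lt z Hz).
  (* [|mlog u| <= 2 e] for [|u| < e], so this choice keeps the difference of arguments
     below [2 pi]. *)
  set (e := Rmin (1 / 2) (Rmin (Carg z + PI) (PI - Carg z) / 4)).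
  assert (He : (0 < e)%R).
  { unfold e. apply Rmin_pos; [lra|]. apply Rdiv_lt_0_compat; [apply Rmin_pos; lra | lra]. }
  assert (He1 : (e <= 1 / 2)%R) by apply Rmin_l.
  assert (He2 : (e <= (Carg z + PI) / 4 /\ e <= (PI - Carg z) / 4)%R).
  { assert (K : (e <= Rmin (Carg z + PI) (PI - Carg z) / 4)%R) by apply Rmin_r.
    assert (K1 := Rmin_l (Carg z + PI) (PI - Carg z)).
    assert (K2 := Rmin_r (Carg z + PI) (PI - Carg z)). lra. }
  exists (Cmod z * e)%R, (2 / Cmod z ^ 2)%R.
  split; [now apply Rmult_lt_0_compat|].
  split; [left; apply Rdiv_lt_0_compat; [lra | now apply pow_lt]|]. intros w Hw.
  set (u := - ((w - z) / z)).
  assert (Hu : Cmod u = (Cmod (w - z) / Cmod z)%R) by (unfold u; now rewrite Cmod_opp, Cmod_div).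
  assert (Hue : (Cmod u < e)%R) by (rewrite Hu; apply Rlt_div_l; lra).
  assert (Hq := mlog_m_id_le u ltac:(lra)).
  assert (Hu0 := Cmod_ge_0 u).
  assert (Hq2 : (Cmod (mlog u - u) <= 2 * Cmod u ^ 2)%R).
  { eapply Rle_trans; [exact Hq|]. apply Rle_div_l; [lra|].
    assert (0 <= Cmod u ^ 2)%R by apply pow2_ge_0. nra. }
  assert (Ew : Cexp (Clog z - mlog u) = w).
  { rewrite Cexp_minus, mlog_exp, Cexp_Clog by (auto; lra). unfold u. field.
    split; auto. intros K.
    assert (w = 0) as ->. { replace w with (z + (w - z)) by ring. rewrite <- K. ring. }
    replace (0 - z) with (- z) in Hw by ring. rewrite Cmod_opp in Hw. nra. }
  assert (Hw0 : w <> 0) by (rewrite <- Ew; apply Cexp_neq_0).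
  assert (EL : Clog w = Clog z - mlog u).
  { apply Cexp_inj; [now rewrite Cexp_Clog, Ew|].
    assert (Hb := Carg_bound w).
    assert (Hi : (Rabs (Im (mlog u)) <= 2 * e)%R).
    { eapply Rle_trans; [apply Im_le_Cmod|].
      replace (mlog u) with (u + (mlog u - u)) by ring.
      eapply Rle_trans; [apply Cmod_triangle|]. simpl in Hq2. nra. }
    apply Rabs_le_between in Hi.
    change (Im (Clog w)) with (Carg w).
    replace (Im (Clog z - mlog u)) with (Carg z - Im (mlog u))%R by (unfold Im; simpl; ring).
    apply Rabs_def1; lra. }
  rewrite EL.
  replace (Clog z - mlog u - Clog z - / z * (w - z)) with (- (mlog u - u)) by (unfold u; field; auto).
  rewrite Cmod_opp. eapply Rle_trans; [exact Hq2|]. rewrite Hu. right. field. lra.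
Qed.

Lemma cdiff_ex_derive f z d :
  cdiff f z d -> @ex_derive C_AbsRing C_NormedModule f z.
Proof.
  intros (r & M & Hr & HM & Hf). exists d. split.
  - apply is_linear_scal_l.
  - intros x Hx.
    assert (E : z = x) by exact (@is_filter_lim_locally_unique C_AbsRing (AbsRing_NormedModule C_AbsRing) z x Hx).
    subst x. intros eps.
    set (r' := Rmin r (eps / (M + 1))).
    assert (Hr' : (0 < r')%R).
    { apply Rmin_pos; auto. apply Rdiv_lt_0_compat; [apply cond_pos | lra]. }
    exists (mkposreal r' Hr'). intros w Hw.
    change (Cmod (w - z) < r')%R in Hw.
    change (Cmod (f w - f z - (w - z) * d) <= eps * Cmod (w - z))%R.
    rewrite (Cmult_comm (w - z) d).
    assert (H1 := Rmin_l r (eps / (M + 1))). assert (H2 := Rmin_r r (eps / (M + 1))).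
    fold r' in H1, H2.
    eapply Rle_trans; [apply Hf; lra|]. simpl. rewrite Rmult_1_r, <- Rmult_assoc.
    apply Rmult_le_compat_r; [apply Cmod_ge_0|].
    assert (H3 : (Cmod (w - z) * (M + 1) < eps)%R) by (apply Rlt_div_r; lra).
    assert (H4 := Cmod_ge_0 (w - z)). nra.
Qed.

(** * Lambert series *)

Lemma Cmod_1m_ge (z : C) r : (Cmod z <= r)%R -> (1 - r <= Cmod (1 - z))%R.
Proof.
  intros H. assert (K := Cmod_triangle (1 - z) z).
  replace (1 - z + z) with (RtoC 1) in K by ring. rewrite Cmod_1 in K. lra.
Qed.

Lemma C1m_neq_0 (z : C) : (Cmod z < 1)%R -> 1 - z <> 0.
Proof.
  intros H. apply Cmod_gt_0. assert (K := Cmod_1m_ge z _ (Rle_refl _)). lra.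
Qed.

Definition lambert_term (b : R) (w : C) : C :=
  Cexp (RtoC b * w) / (RtoC b * (1 - Cexp (RtoC b * w))).

(** The common shape of all the series: [logP (e^w)] is the case [al = 1], and the
    inner series of [L] are the cases [al = (2l - 1) / (2m)]. *)
Definition lambert (al : R) (w : C) : C := CSeries (fun j => lambert_term (INR j + al) w).

Lemma Cmod_Cexp_scal b w : Cmod (Cexp (RtoC b * w)) = exp (b * Re w).
Proof. rewrite Cmod_Cexp. f_equal. unfold Re; simpl. ring. Qed.

Lemma exp_lt_1 x : (x < 0)%R -> (exp x < 1)%R.
Proof. intros H. rewrite <- exp_0. now apply exp_increasing. Qed.

Lemma exp_INR_mult j x : exp (INR j * x) = (exp x ^ j)%R.
Proof.
  induction j as [|j IH]; [simpl; rewrite Rmult_0_l; apply exp_0|].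
  rewrite S_INR, Rmult_plus_distr_r, exp_plus, IH, Rmult_1_l. simpl. ring.
Qed.

Lemma Cmod_Cexp_scal_le al x w j :
  (0 < x)%R -> (Re w <= - x)%R -> (0 < al)%R ->
  (Cmod (Cexp (RtoC (INR j + al) * w)) <= exp (- (al * x)) * exp (- x) ^ j)%R.
Proof.
  intros Hx Hw Hal. rewrite Cmod_Cexp_scal, <- exp_INR_mult, <- exp_plus. apply exp_le.
  assert (Hj := pos_INR j). nra.
Qed.

Lemma exp_pow_le_1 x j : (0 < x)%R -> (0 <= exp (- x) ^ j <= 1)%R.
Proof.
  intros Hx. assert (H := exp_pos (- x)). assert (H1 := exp_lt_1 (- x) ltac:(lra)).
  split; [apply pow_le; lra|]. rewrite <- (pow1 j). apply pow_incr. lra.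
Qed.

(** This keeps the denominators away from 0 uniformly in [b >= al] and [Re w <= - x],
    so that the terms are dominated by a geometric series. *)
Lemma Cmod_1m_Cexp_ge al x w j :
  (0 < x)%R -> (Re w <= - x)%R -> (0 < al)%R ->
  (1 - exp (- (al * x)) <= Cmod (1 - Cexp (RtoC (INR j + al) * w)))%R.
Proof.
  intros Hx Hw Hal. apply Cmod_1m_ge.
  eapply Rle_trans; [apply (Cmod_Cexp_scal_le al x); auto|].
  assert (H := exp_pow_le_1 x j Hx). assert (H1 := exp_pos (- (al * x))). nra.
Qed.

Lemma one_m_exp_pos al x : (0 < x)%R -> (0 < al)%R -> (0 < 1 - exp (- (al * x)))%R.
Proof.
  intros Hx Hal. assert (exp (- (al * x)) < 1)%R by (apply exp_lt_1; nra). lra.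
Qed.

Lemma lambert_term_le al x w j :
  (0 < x)%R -> (Re w <= - x)%R -> (0 < al)%R ->
  (Cmod (lambert_term (INR j + al) w) <=
     / (al * (1 - exp (- (al * x)))) * exp (- x) ^ j)%R.
Proof.
  intros Hx Hw Hal. unfold lambert_term.
  assert (Hk := one_m_exp_pos al x Hx Hal).
  assert (H1 := Cmod_1m_Cexp_ge al x w j Hx Hw Hal).
  assert (Hj := pos_INR j).
  assert (Hb : RtoC (INR j + al) <> 0) by (apply RtoC_neq_0; lra).
  assert (Hn : 1 - Cexp (RtoC (INR j + al) * w) <> 0) by (apply Cmod_gt_0; lra).
  rewrite Cmod_div by (apply Cmult_neq_0; auto). rewrite Cmod_mult, Cmod_R, Rabs_pos_eq by lra.
  unfold Rdiv. rewrite Rmult_comm. apply Rmult_le_compat.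
  - left. apply Rinv_0_lt_compat. apply Rmult_lt_0_compat; lra.
  - apply Cmod_ge_0.
  - apply Rinv_le_contravar; [apply Rmult_lt_0_compat; lra|]. apply Rmult_le_compat; lra.
  - eapply Rle_trans; [apply (Cmod_Cexp_scal_le al x); auto|].
    assert (H := exp_pow_le_1 x j Hx). assert (H2 := exp_pos (- (al * x))).
    rewrite <- (Rmult_1_l (exp (- x) ^ j)) at 2. apply Rmult_le_compat_r; [apply H|]. lra.
Qed.

Lemma exp_geom_range x : (0 < x)%R -> (0 <= exp (- x) < 1)%R.
Proof. intros Hx. split; [left; apply exp_pos | apply exp_lt_1; lra]. Qed.

Lemma lambert_ser al w : (0 < al)%R -> (Re w < 0)%R ->
  Cser (fun j => lambert_term (INR j + al) w) (lambert al w).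
Proof.
  intros Hal Hw.
  apply Cser_abs_CSeries with
    (fun j => / (al * (1 - exp (- (al * (- Re w))))) * exp (- (- Re w)) ^ j)%R.
  - intros k. apply lambert_term_le; lra.
  - eexists. apply is_series_geom_scal. apply exp_geom_range. lra.
Qed.

(** Second-order remainder of [e^v / (1 - e^v)] in closed form; the numerator is
    visibly quadratic in [x]. *)
Lemma lambert_term_remainder b w w' :
  b <> 0%R -> 1 - Cexp (RtoC b * w) <> 0 -> 1 - Cexp (RtoC b * w') <> 0 ->
  let E := Cexp (RtoC b * w) in
  let x := RtoC b * (w' - w) in
  lambert_term b w' - lambert_term b w - E / ((1 - E) * (1 - E)) * (w' - w) =
  E * ((Cexp x - 1 - x) * (1 - E) + x * E * (Cexp x - 1))
    / (RtoC b * ((1 - E) * (1 - E) * (1 - Cexp (RtoC b * w')))).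
Proof.
  intros Hb H1 H2 E x. unfold lambert_term.
  assert (HE : Cexp (RtoC b * w') = E * Cexp x).
  { unfold E, x. rewrite <- Cexp_plus. f_equal. ring. }
  assert (Hw : w' - w = x / RtoC b) by (unfold x; field; now apply RtoC_neq_0).
  rewrite HE in *. rewrite Hw. fold E in H1. fold E.
  field. repeat split; auto. now apply RtoC_neq_0.
Qed.

Lemma mul_exp_opp_le y : (y * exp (- y) <= 1)%R.
Proof.
  assert (H := exp_ineq1_le y). assert (H1 := exp_pos y). rewrite exp_Ropp.
  apply Rle_div_l; lra.
Qed.

(** The factor [b] produced by the two powers of [b (w' - w)] against one in the
    denominator is absorbed by half of the exponential decay, through [y e^{-y} <= 1]. *)
Lemma lambert_term_remainder_le al x w w' j :
  (0 < x)%R -> (Re w <= - x)%R -> (0 < al)%R -> (Cmod (w' - w) <= x / 2)%R ->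
  let E := Cexp (RtoC (INR j + al) * w) in
  (Cmod (lambert_term (INR j + al) w' - lambert_term (INR j + al) w
         - E / ((1 - E) * (1 - E)) * (w' - w))
   <= 12 / (x * (1 - exp (- (al * (x / 2)))) ^ 3) * Cmod (w' - w) ^ 2 * exp (- (x / 4)) ^ j)%R.
Proof.
  intros Hx Hw Hal Hd E.
  assert (Hj := pos_INR j). set (b := (INR j + al)%R) in *.
  assert (Hb : (0 < b)%R) by (unfold b; lra).
  set (k := (1 - exp (- (al * (x / 2))))%R).
  assert (Hk : (0 < k)%R) by (apply one_m_exp_pos; lra).
  assert (Hre := re_le_Cmod (w' - w)). apply Rabs_le_between in Hre.
  replace (Re (w' - w)) with (Re w' - Re w)%R in Hre by (unfold Re; simpl; ring).
  assert (H1 : (k <= Cmod (1 - E))%R) by (apply Cmod_1m_Cexp_ge; lra).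
  assert (H2 : (k <= Cmod (1 - Cexp (RtoC b * w')))%R) by (apply Cmod_1m_Cexp_ge; lra).
  assert (N1 : 1 - E <> 0) by (apply Cmod_gt_0; lra).
  assert (N2 : 1 - Cexp (RtoC b * w') <> 0) by (apply Cmod_gt_0; lra).
  assert (Nb : RtoC b <> 0) by (apply RtoC_neq_0; lra).
  unfold E. rewrite lambert_term_remainder by (auto; lra). fold E.
  set (y := RtoC b * (w' - w)).
  set (d := Cmod (w' - w)) in *. assert (Hd0 : (0 <= d)%R) by apply Cmod_ge_0.
  assert (Ey : Cmod y = (b * d)%R) by (unfold y, d; rewrite Cmod_mult, Cmod_R, Rabs_pos_eq; lra).
  assert (Eey := exp_pos (b * d)).
  assert (HE : Cmod E = exp (b * Re w)) by (apply Cmod_Cexp_scal).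
  assert (HE1 : (Cmod E <= 1)%R).
  { rewrite HE, <- exp_0. apply exp_le. nra. }
  assert (HE0 := Cmod_ge_0 E).
  assert (H1E : (Cmod (1 - E) <= 2)%R).
  { eapply Rle_trans; [apply Cmod_triangle|]. rewrite Cmod_opp, Cmod_1. lra. }
  assert (Hbd : (0 <= b * d)%R) by (apply Rmult_le_pos; lra).
  assert (Hnum : (Cmod ((Cexp y - 1 - y) * (1 - E) + y * E * (Cexp y - 1))
                  <= 3 * (b * d) ^ 2 * exp (b * d))%R).
  { eapply Rle_trans; [apply Cmod_triangle|]. rewrite !Cmod_mult.
    assert (A1 := Cexp_m1_id_le y). assert (A2 := Cexp_m1_le y). rewrite Ey in *.
    assert (B1 : (Cmod (Cexp y - 1 - y) * Cmod (1 - E) <= (b * d) ^ 2 * exp (b * d) * 2)%R).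
    { apply Rmult_le_compat; auto; apply Cmod_ge_0. }
    assert (B2 : (b * d * Cmod E * Cmod (Cexp y - 1) <= b * d * 1 * (b * d * exp (b * d)))%R).
    { apply Rmult_le_compat; auto; [apply Rmult_le_pos; auto | apply Cmod_ge_0 |].
      apply Rmult_le_compat_l; auto. }
    replace (3 * (b * d) ^ 2 * exp (b * d))%R
      with ((b * d) ^ 2 * exp (b * d) * 2 + b * d * 1 * (b * d * exp (b * d)))%R by ring. lra. }
  rewrite Cmod_div by (repeat apply Cmult_neq_0; auto).
  rewrite !Cmod_mult, Cmod_R, (Rabs_pos_eq b) by lra.
  apply Rle_trans with (exp (b * Re w) * (3 * (b * d) ^ 2 * exp (b * d)) / (b * k ^ 3))%R.
  - unfold Rdiv. apply Rmult_le_compat.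
    + apply Rmult_le_pos; apply Cmod_ge_0.
    + left. apply Rinv_0_lt_compat. repeat apply Rmult_lt_0_compat; lra.
    + rewrite HE. apply Rmult_le_compat_l; [left; apply exp_pos | exact Hnum].
    + apply Rinv_le_contravar; [apply Rmult_lt_0_compat; [lra | now apply pow_lt]|].
      apply Rmult_le_compat_l; [lra|].
      replace (k ^ 3)%R with (k * k * k)%R by ring.
      apply Rmult_le_compat; try lra; [apply Rmult_le_pos; lra|]. apply Rmult_le_compat; lra.
  - assert (F1 : (exp (b * Re w) * exp (b * d) <= exp (- (b * (x / 4))) * exp (- (b * (x / 4))))%R).
    { rewrite <- !exp_plus. apply exp_le. nra. }
    assert (F2 := mul_exp_opp_le (b * (x / 4))).
    assert (F3 : (exp (- (b * (x / 4))) <= exp (- (x / 4)) ^ j)%R).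
    { rewrite <- exp_INR_mult. apply exp_le. unfold b. nra. }
    assert (F4 := exp_pos (- (b * (x / 4)))).
    replace (exp (b * Re w) * (3 * (b * d) ^ 2 * exp (b * d)) / (b * k ^ 3))%R
      with (3 * d ^ 2 / k ^ 3 * (b * (exp (b * Re w) * exp (b * d))))%R by (field; lra).
    replace (12 / (x * k ^ 3) * d ^ 2 * exp (- (x / 4)) ^ j)%R
      with (3 * d ^ 2 / k ^ 3 * (4 / x * exp (- (x / 4)) ^ j))%R by (field; lra).
    apply Rmult_le_compat_l.
    + apply Rmult_le_pos; [assert (0 <= d ^ 2)%R by apply pow2_ge_0; lra|].
      left. apply Rinv_0_lt_compat. now apply pow_lt.
    + apply Rle_trans with (b * (exp (- (b * (x / 4))) * exp (- (b * (x / 4)))))%R.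
      * apply Rmult_le_compat_l; lra.
      * rewrite <- Rmult_assoc. apply Rmult_le_compat; try lra.
        -- apply Rmult_le_pos; lra.
        -- apply (proj1 (Rle_div_r _ _ _ Hx)).
           replace (b * exp (- (b * (x / 4))) * x)%R
             with (4 * (b * (x / 4) * exp (- (b * (x / 4)))))%R by field.
           apply Rle_trans with (4 * 1)%R; [apply Rmult_le_compat_l; [lra | exact F2] | lra].
Qed.

(** Termwise differentiation: the remainders are dominated by a geometric series times
    [|w' - w|^2]. *)
Lemma cdiff_lambert al w : (0 < al)%R -> (Re w < 0)%R -> exists d, cdiff (lambert al) w d.
Proof.
  intros Hal Hw. set (x := (- Re w)%R). assert (Hx : (0 < x)%R) by (unfold x; lra).
  assert (Hwx : (Re w <= - x)%R) by (unfold x; lra).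
  set (E := fun j => Cexp (RtoC (INR j + al) * w)).
  destruct (Cser_abs (fun j => E j / ((1 - E j) * (1 - E j)))
    (fun j => / ((1 - exp (- (al * x))) ^ 2) * exp (- x) ^ j)%R) as [d Hd].
  { intros j. assert (Hk := one_m_exp_pos al x Hx Hal).
    assert (H1 := Cmod_1m_Cexp_ge al x w j Hx Hwx Hal). fold (E j) in H1.
    assert (N1 : 1 - E j <> 0) by (apply Cmod_gt_0; lra).
    rewrite Cmod_div, Cmod_mult by (apply Cmult_neq_0; auto).
    unfold Rdiv. rewrite Rmult_comm. apply Rmult_le_compat; try apply Cmod_ge_0.
    - left. apply Rinv_0_lt_compat. apply Rmult_lt_0_compat; lra.
    - apply Rinv_le_contravar; [now apply pow_lt|].
      replace ((1 - exp (- (al * x))) ^ 2)%R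
        with ((1 - exp (- (al * x))) * (1 - exp (- (al * x))))%R by ring.
      apply Rmult_le_compat; lra.
    - eapply Rle_trans; [apply (Cmod_Cexp_scal_le al x); auto|].
      assert (H := exp_pow_le_1 x j Hx). assert (H2 := exp_pos (- (al * x))).
      rewrite <- (Rmult_1_l (exp (- x) ^ j)) at 2. apply Rmult_le_compat_r; [apply H|]. lra. }
  { eexists. apply is_series_geom_scal. now apply exp_geom_range. }
  exists d.
  set (q := exp (- (x / 4))). assert (Hq : (0 <= q < 1)%R) by (apply exp_geom_range; lra).
  set (K := (12 / (x * (1 - exp (- (al * (x / 2)))) ^ 3))%R).
  assert (HK : (0 <= K)%R).
  { left. apply Rdiv_lt_0_compat; [lra|]. apply Rmult_lt_0_compat; auto.
    apply pow_lt. apply one_m_exp_pos; lra. }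
  exists (x / 2)%R, (K / (1 - q))%R. split; [lra|].
  split; [apply Rdiv_le_0_compat; lra|]. intros w' Hw'.
  assert (Hre := re_le_Cmod (w' - w)). apply Rabs_le_between in Hre.
  replace (Re (w' - w)) with (Re w' - Re w)%R in Hre by (unfold Re; simpl; ring).
  assert (S : Cser (fun j => lambert_term (INR j + al) w' - lambert_term (INR j + al) w
                      - (w' - w) * (E j / ((1 - E j) * (1 - E j))))
                (lambert al w' - lambert al w - (w' - w) * d)).
  { apply Cser_minus; [apply Cser_minus; apply lambert_ser; lra | now apply Cser_scal]. }
  rewrite (Cmult_comm d).
  eapply (Cser_le _ _ (fun j => K * Cmod (w' - w) ^ 2 * q ^ j)%R _ S).
  - intros j. rewrite (Cmult_comm (w' - w)). apply lambert_term_remainder_le; lra.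
  - replace (K / (1 - q) * Cmod (w' - w) ^ 2)%R with (K * Cmod (w' - w) ^ 2 / (1 - q))%R
      by (field; lra).
    now apply is_series_geom_scal.
Qed.

Lemma logP_Cexp w : logP (Cexp w) = lambert 1 w.
Proof.
  unfold logP, lambert, CSeries. f_equal. apply FunctionalExtensionality.functional_extensionality.
  intros n. f_equal. apply map_ext. intros j. unfold lambert_term.
  rewrite Cexp_pow, plus_INR. reflexivity.
Qed.

(** * From products to Lambert series *)

Lemma Cser_psum (f : nat -> nat -> C) (s : nat -> C) n :
  (forall k, (k < n)%nat -> Cser (f k) (s k)) ->
  Cser (fun j => psum (fun k => f k j) n) (psum s n).
Proof.
  intros H. unfold psum at 2.
  apply (Cser_Csum (seq 0 n) (fun k j => f k j) s).
  intros k Hk. apply in_seq in Hk. apply H. lia.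
Qed.

Lemma lambert_uv_le (u v : C) j : (Cmod u < 1)%R -> (Cmod v < 1)%R ->
  (Cmod (u ^ (j + 1) / (RtoC (INR (j + 1)) * (1 - v ^ (j + 1))))
   <= / (1 - Cmod v) * Cmod u ^ j)%R.
Proof.
  intros Hu Hv. assert (Hv0 := Cmod_ge_0 v). assert (Hu0 := Cmod_ge_0 u).
  assert (Hvj : (Cmod (v ^ (j + 1)) <= Cmod v)%R).
  { rewrite Cmod_pow, Nat.add_1_r. simpl.
    assert (Cmod v ^ j <= 1)%R by (rewrite <- (pow1 j); apply pow_incr; lra).
    assert (0 <= Cmod v ^ j)%R by (apply pow_le; auto). nra. }
  assert (H1 := Cmod_1m_ge _ _ Hvj).
  assert (N : 1 - v ^ (j + 1) <> 0) by (apply Cmod_gt_0; lra).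
  assert (HI := INR_S_ge_1 j).
  rewrite Cmod_div by (apply Cmult_neq_0; auto; apply INR_S_neq_0).
  rewrite Cmod_mult, Cmod_R, (Rabs_pos_eq (INR (j + 1))), Cmod_pow by lra.
  unfold Rdiv. rewrite Rmult_comm. apply Rmult_le_compat.
  - left. apply Rinv_0_lt_compat. apply Rmult_lt_0_compat; lra.
  - now apply pow_le.
  - apply Rinv_le_contravar; [lra|]. rewrite <- (Rmult_1_l (1 - Cmod v)).
    apply Rmult_le_compat; lra.
  - rewrite Nat.add_1_r. simpl. assert (0 <= Cmod u ^ j)%R by (now apply pow_le). nra.
Qed.

Lemma lambert_uv_ser (u v : C) : (Cmod u < 1)%R -> (Cmod v < 1)%R ->
  Cser (fun j => u ^ (j + 1) / (RtoC (INR (j + 1)) * (1 - v ^ (j + 1))))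
       (CSeries (fun j => u ^ (j + 1) / (RtoC (INR (j + 1)) * (1 - v ^ (j + 1))))).
Proof.
  intros Hu Hv. eapply Cser_abs_CSeries; [intros k; now apply lambert_uv_le|].
  eexists. apply is_series_geom_scal. split; [apply Cmod_ge_0 | auto].
Qed.

(** Exact summation over [k < n] of the geometric progression [v^{jk}] leaves a
    remainder with a factor [v^{jn}], so no exchange of infinite sums is involved. *)
Lemma Cser_mlog_geom (u v s : C) : (Cmod u < 1)%R -> (Cmod v < 1)%R ->
  Cser (fun j => u ^ (j + 1) / (RtoC (INR (j + 1)) * (1 - v ^ (j + 1)))) s ->
  Cser (fun k => mlog (u * v ^ k)) s.
Proof.
  intros Hu Hv Hs. assert (Hv0 := Cmod_ge_0 v). assert (Hu0 := Cmod_ge_0 u).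
  apply Ccv_bound with (fun n => / (1 - Cmod v) / (1 - Cmod u) * Cmod v ^ n)%R.
  2:{ replace 0%R with (/ (1 - Cmod v) / (1 - Cmod u) * 0)%R by ring.
      apply is_lim_seq_mult'; [apply is_lim_seq_const|].
      apply is_lim_seq_geom. rewrite Rabs_pos_eq; lra. }
  intros n.
  assert (Huv : forall k, (Cmod (u * v ^ k) < 1)%R).
  { intros k. rewrite Cmod_mult, Cmod_pow.
    assert (Cmod v ^ k <= 1)%R by (rewrite <- (pow1 k); apply pow_incr; lra).
    assert (0 <= Cmod v ^ k)%R by (apply pow_le; auto). nra. }
  assert (Hn := Cser_psum (fun k j => (u * v ^ k) ^ (j + 1) / RtoC (INR (j + 1)))
                  (fun k => mlog (u * v ^ k)) n (fun k _ => mlog_ser _ (Huv k))).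
  assert (Hd := Cser_minus _ _ _ _ Hs Hn).
  replace (psum (fun k => mlog (u * v ^ k)) n - s)
    with (- (s - psum (fun k => mlog (u * v ^ k)) n)) by ring.
  rewrite Cmod_opp.
  apply (Cser_le _ _ (fun j => / (1 - Cmod v) * Cmod v ^ n * Cmod u ^ j)%R _ Hd).
  - intros j.
    assert (Hvj : (Cmod (v ^ (j + 1)) < 1)%R).
    { rewrite Cmod_pow, Nat.add_1_r. simpl.
      assert (Cmod v ^ j <= 1)%R by (rewrite <- (pow1 j); apply pow_incr; lra).
      assert (0 <= Cmod v ^ j)%R by (apply pow_le; auto). nra. }
    assert (N := C1m_neq_0 _ Hvj).
    assert (E : psum (fun k => (u * v ^ k) ^ (j + 1) / RtoC (INR (j + 1))) n =
      u ^ (j + 1) / (RtoC (INR (j + 1)) * (1 - v ^ (j + 1))) * (1 - (v ^ (j + 1)) ^ n)).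
    { rewrite <- (psum_geom (v ^ (j + 1)) n).
      replace (u ^ (j + 1) / (RtoC (INR (j + 1)) * (1 - v ^ (j + 1))) *
        (psum (fun k => (v ^ (j + 1)) ^ k) n * (1 - v ^ (j + 1))))
      with (u ^ (j + 1) / RtoC (INR (j + 1)) * psum (fun k => (v ^ (j + 1)) ^ k) n)
        by (field; split; auto; apply INR_S_neq_0).
      rewrite <- psum_scal. apply psum_ext. intros k _.
      rewrite Cpow_mult_l, <- !Cpow_mult_r, (Nat.mul_comm k). field. apply INR_S_neq_0. }
    rewrite E.
    replace (u ^ (j + 1) / (RtoC (INR (j + 1)) * (1 - v ^ (j + 1))) -
       u ^ (j + 1) / (RtoC (INR (j + 1)) * (1 - v ^ (j + 1))) * (1 - (v ^ (j + 1)) ^ n))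
    with (u ^ (j + 1) / (RtoC (INR (j + 1)) * (1 - v ^ (j + 1))) * (v ^ (j + 1)) ^ n) by ring.
    rewrite Cmod_mult.
    replace (/ (1 - Cmod v) * Cmod v ^ n * Cmod u ^ j)%R
      with (/ (1 - Cmod v) * Cmod u ^ j * Cmod v ^ n)%R by ring.
    apply Rmult_le_compat; try apply Cmod_ge_0.
    + now apply lambert_uv_le.
    + rewrite <- Cpow_mult_r, Cmod_pow, Nat.mul_add_distr_r, Nat.mul_1_l, pow_add.
      assert (Cmod v ^ (j * n) <= 1)%R by (rewrite <- (pow1 (j * n)); apply pow_incr; lra).
      assert (0 <= Cmod v ^ n)%R by (apply pow_le; auto). nra.
  - replace (/ (1 - Cmod v) / (1 - Cmod u) * Cmod v ^ n)%R
      with (/ (1 - Cmod v) * Cmod v ^ n / (1 - Cmod u))%R by (field; lra).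
    apply is_series_geom_scal. lra.
Qed.

Lemma Cinf_prod_exp (u f : nat -> C) (s : C) :
  (forall k, u k = Cexp (f k)) -> Cser f s -> Cinf_prod u = Cexp s.
Proof.
  intros H Hs. apply Ccv_Clim. apply Ccv_ext with (fun n => Cexp (psum f n)).
  - intros n. unfold psum. rewrite Cexp_Csum. f_equal. apply map_ext. auto.
  - now apply Ccv_Cexp.
Qed.

Lemma P_exp z : (Cmod z < 1)%R -> P z = Cexp (logP z).
Proof.
  intros Hz. apply Cinf_prod_exp with (fun k => mlog (z * z ^ k)).
  - intros k. rewrite Nat.add_1_r, Cpow_S.
    rewrite mlog_exp; [field; apply C1m_neq_0|];
    rewrite <- Cpow_S, Cmod_pow; apply pow_lt_1_compat; try lia; split; auto; apply Cmod_ge_0.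
  - apply Cser_mlog_geom; auto. now apply lambert_uv_ser.
Qed.

(** The contribution to [log Q_m] of one pair with [h + j = s]. *)
Definition lambert_residue (m s : nat) (z : C) : C :=
  CSeries (fun j => (z ^ s) ^ (j + 1) / (RtoC (INR (j + 1)) * (1 - (z ^ (2 * m)) ^ (j + 1)))).

Lemma Cmod_pow_lt_1 (z : C) n : (Cmod z < 1)%R -> (0 < n)%nat -> (Cmod (z ^ n) < 1)%R.
Proof.
  intros Hz Hn. rewrite Cmod_pow. apply pow_lt_1_compat; auto. split; auto. apply Cmod_ge_0.
Qed.

Lemma lambert_residue_ser m s z : (0 < m)%nat -> (0 < s)%nat -> (Cmod z < 1)%R ->
  Cser (fun j => (z ^ s) ^ (j + 1) / (RtoC (INR (j + 1)) * (1 - (z ^ (2 * m)) ^ (j + 1))))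
       (lambert_residue m s z).
Proof.
  intros Hm Hs Hz. apply lambert_uv_ser; apply Cmod_pow_lt_1; auto; lia.
Qed.

Lemma in_index_pairs m hj : In hj (index_pairs m) -> (1 <= fst hj < snd hj)%nat /\ (snd hj < m)%nat.
Proof.
  unfold index_pairs. intros H. apply in_flat_map in H. destruct H as (j & Hj & H).
  apply in_map_iff in H. destruct H as (h & <- & Hh). apply in_seq in Hj, Hh. simpl. lia.
Qed.

Lemma Q_exp m z : (0 < m)%nat -> (Cmod z < 1)%R ->
  Q m z = Cexp (Csum (map (fun hj => lambert_residue m (fst hj + snd hj) z) (index_pairs m))).
Proof.
  intros Hm Hz.
  apply Cinf_prod_exp with (fun k => Csum (map (fun hj => mlog (z ^ (fst hj + snd hj) * (z ^ (2 * m)) ^ k)) (index_pairs m))).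
  - intros k. rewrite Cexp_Csum. f_equal. apply map_ext_in. intros hj Hin.
    apply in_index_pairs in Hin.
    rewrite <- Cpow_mult_r, <- Cpow_add_r.
    replace (fst hj + snd hj + 2 * m * k)%nat with (2 * m * k + fst hj + snd hj)%nat by lia.
    assert (Hc := Cmod_pow_lt_1 z (2 * m * k + fst hj + snd hj) Hz ltac:(lia)).
    rewrite mlog_exp by auto. field. now apply C1m_neq_0.
  - apply (Cser_Csum (index_pairs m) (fun hj k => mlog (z ^ (fst hj + snd hj) * (z ^ (2 * m)) ^ k))
      (fun hj => lambert_residue m (fst hj + snd hj) z)).
    intros hj Hin. apply in_index_pairs in Hin.
    apply Cser_mlog_geom; try (apply Cmod_pow_lt_1; auto; lia).
    apply lambert_residue_ser; auto; lia.
Qed.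

(** * Analyticity of K and L on the slit disc *)

Lemma slit_disc_cut z : slit_disc z -> cut_plane z.
Proof.
  intros [H1 H2] [Hi Hr]. apply H2. split; auto. split; auto.
  assert (H := re_le_Cmod z). apply Rabs_le_between in H. lra.
Qed.

Lemma cut_plane_open z : cut_plane z -> exists e, (0 < e)%R /\
  forall w, (Cmod (w - z) < e)%R -> cut_plane w.
Proof.
  intros Hz.
  assert (G : forall w, (Rabs (Re w - Re z) <= Cmod (w - z))%R /\ (Rabs (Im w - Im z) <= Cmod (w - z))%R).
  { intros w. split; [apply (re_le_Cmod (w - z)) | apply (Im_le_Cmod (w - z))]. }
  destruct (Req_dec (Im z) 0) as [Hi|Hi].
  - assert (Hr : (0 < Re z)%R).
    { apply Rnot_le_lt. intros K. apply Hz. auto. }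
    exists (Re z). split; auto. intros w Hw [_ Kw].
    destruct (G w) as [G1 _]. apply Rabs_le_between in G1. lra.
  - exists (Rabs (Im z)). split; [now apply Rabs_pos_lt|]. intros w Hw [Kw _].
    destruct (G w) as [_ G1]. rewrite Kw in G1.
    replace (0 - Im z)%R with (- Im z)%R in G1 by ring. rewrite Rabs_Ropp in G1. lra.
Qed.

Lemma slit_disc_locally z : slit_disc z -> locally z slit_disc.
Proof.
  intros Hz. destruct (cut_plane_open z (slit_disc_cut z Hz)) as (e & He & Hc).
  assert (Hz1 := proj1 Hz).
  set (r := Rmin e (1 - Cmod z)). assert (Hr : (0 < r)%R) by (apply Rmin_pos; lra).
  apply locally_C. exists (mkposreal r Hr). intros w Hw.
  change (Cmod (w - z) < r)%R in Hw.
  assert (H1 := Rmin_l e (1 - Cmod z)). assert (H2 := Rmin_r e (1 - Cmod z)). fold r in H1, H2.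
  split.
  - replace w with (z + (w - z)) by ring. eapply Rle_lt_trans; [apply Cmod_triangle|]. lra.
  - intros [Ki Kr]. apply (Hc w); [lra|]. split; lra.
Qed.

(** It suffices to differentiate at the points of the disc itself because the slit
    disc is open. *)
Lemma analytic_on_slit f :
  (forall z, slit_disc z -> exists d, cdiff f z d) -> analytic_on slit_disc f.
Proof.
  intros H z Hz. apply filter_imp with slit_disc; [|now apply slit_disc_locally].
  intros w Hw. destruct (H w Hw) as [d Hd]. exact (cdiff_ex_derive f w d Hd).
Qed.

Lemma Re_Clog_neg z : slit_disc z -> (Re (Clog z) < 0)%R.
Proof.
  intros Hz. assert (Hp := proj1 (Cmod_gt_0 z) (cut_plane_neq_0 z (slit_disc_cut z Hz))).
  simpl. rewrite <- ln_1. apply ln_increasing; auto. apply Hz.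
Qed.

Lemma cdiff_lambert_Clog al b z : (0 < al)%R -> (0 < b)%R -> slit_disc z ->
  exists d, cdiff (fun v => lambert al (RtoC b * Clog v)) z d.
Proof.
  intros Hal Hb Hz. assert (Hr := Re_Clog_neg z Hz).
  destruct (cdiff_lambert al (RtoC b * Clog z)) as [d Hd]; auto.
  - unfold Re in *; simpl in *. nra.
  - eexists. apply (cdiff_comp (fun v => RtoC b * Clog v)); [|exact Hd].
    apply cdiff_scal, cdiff_Clog. now apply slit_disc_cut.
Qed.

Lemma cdiff_Csum {A : Type} (l : list A) (f : A -> C -> C) z :
  (forall a, In a l -> exists d, cdiff (f a) z d) ->
  exists d, cdiff (fun w => Csum (map (fun a => f a w) l)) z d.
Proof.
  induction l as [|a l IH]; intros H; simpl.
  - exists 0. apply cdiff_const.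
  - destruct (H a) as [d Hd]; [now left|].
    destruct IH as [e He]; [intros; apply H; now right|].
    exists (d + e). now apply cdiff_plus.
Qed.

Lemma K_analytic m : (1 <= m)%nat -> analytic_on slit_disc (fun z => K m (Cppow z) z).
Proof.
  intros Hm. apply analytic_on_slit. intros z Hz.
  assert (Hm0 : (0 < INR m)%R) by (apply lt_0_INR; lia).
  destruct (cdiff_lambert_Clog 1 (1 / INR m) z) as [d1 H1]; auto; [lra | apply Rdiv_lt_0_compat; lra|].
  destruct (cdiff_lambert_Clog 1 (1 / 2) z) as [d2 H2]; auto; [lra | lra |].
  destruct (cdiff_lambert_Clog 1 1 z) as [d3 H3]; auto; [lra | lra |].
  assert (H := cdiff_Cexp _ _ _ (cdiff_plus _ _ _ _ _
     (cdiff_scal (RtoC (1 / 2)) _ _ _ (cdiff_plus _ _ _ _ _ H1 (cdiff_scal (- (1)) _ _ _ H2)))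
     (cdiff_scal (RtoC ((INR m + 2) / 4)) _ _ _ H3))).
  eexists. destruct (cut_plane_open z (slit_disc_cut z Hz)) as (e & He & Hc).
  eapply cdiff_ext_loc; [exact He | | exact H]. intros w Hw.
  specialize (Hc w Hw). unfold K, sqrt_Pquot, Ppow, Cppow. rewrite !logP_Cexp.
  rewrite <- (Cexp_Clog w (cut_plane_neq_0 w Hc)) at 6. rewrite logP_Cexp, <- Cexp_plus.
  f_equal. replace (RtoC 1 * Clog w) with (Clog w) by ring. ring.
Qed.

Lemma L_analytic m : (1 <= m)%nat -> analytic_on slit_disc (fun z => L m (Cppow z)).
Proof.
  intros Hm. apply analytic_on_slit. intros z Hz.
  assert (Hm0 : (0 < INR m)%R) by (apply lt_0_INR; lia).
  destruct (cdiff_Csum (seq 1 m) (fun l w => RtoC (L_coef m l) *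
     lambert ((2 * INR l - 1) / (2 * INR m)) (RtoC 1 * Clog w)) z) as [d Hd].
  - intros l Hl. apply in_seq in Hl.
    assert (1 <= INR l)%R by (apply (le_INR 1); lia).
    destruct (cdiff_lambert_Clog ((2 * INR l - 1) / (2 * INR m)) 1 z) as [d Hd]; auto.
    + apply Rdiv_lt_0_compat; lra.
    + lra.
    + eexists. apply cdiff_scal. exact Hd.
  - eexists. eapply cdiff_ext; [|apply cdiff_Cexp, (cdiff_scal (- RtoC (1 / (2 * INR m)))), Hd].
    intros w. cbv beta. unfold L. f_equal. f_equal. f_equal. apply map_ext. intros l. f_equal.
    replace (RtoC 1 * Clog w) with (Clog w) by ring. reflexivity.
Qed.

(** * Tannery's theorem and standard limits *)

(** Comparison with a telescoping series. *)
Lemma ex_series_inv_sq : ex_series (fun k => / INR (k + 1) ^ 2)%R.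
Proof.
  assert (T : is_series (fun k => / (INR (k + 1) * INR (k + 2)))%R 1%R).
  { assert (E : forall n, (1 - / INR (n + 2))%R = sum_n (fun k => / (INR (k + 1) * INR (k + 2)))%R n).
    { induction n as [|n IH].
      - rewrite sum_O. simpl. field.
      - rewrite sum_Sn, <- IH.
        change (1 - / INR (S n + 2) = (1 - / INR (n + 2)) + / (INR (S n + 1) * INR (S n + 2)))%R.
        rewrite !plus_INR, !S_INR. simpl. field. assert (H := pos_INR n). lra. }
    change (is_lim_seq (sum_n (fun k => / (INR (k + 1) * INR (k + 2)))%R) 1%R).
    apply is_lim_seq_ext with (1 := E).
    replace (Finite 1) with (Finite (1 - 0)) by (f_equal; ring).
    apply is_lim_seq_minus'; [apply is_lim_seq_const|].
    apply is_lim_seq_ext with (fun n => / INR (S (S n)))%R.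
    { intros n. do 2 f_equal. lia. }
    apply (is_lim_seq_incr_1 (fun n => / INR (S n))%R).
    apply (is_lim_seq_incr_1 (fun n => / INR n)%R).
    replace (Finite 0) with (Rbar_inv p_infty) by reflexivity.
    apply is_lim_seq_inv; [apply is_lim_seq_INR | discriminate]. }
  apply (ex_series_le (K := R_AbsRing) (V := R_CompleteNormedModule) _
     (fun k => 2 * / (INR (k + 1) * INR (k + 2)))%R).
  - intros k. change (Rabs (/ INR (k + 1) ^ 2) <= 2 * / (INR (k + 1) * INR (k + 2)))%R.
    rewrite !plus_INR. simpl INR. assert (H := pos_INR k).
    rewrite Rabs_pos_eq by (left; apply Rinv_0_lt_compat; apply pow_lt; lra).
    assert (E : (2 * / ((INR k + 1) * (INR k + (1 + 1))) - / (INR k + 1) ^ 2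
       = INR k / ((INR k + 1) ^ 2 * (INR k + 2)))%R) by (field; lra).
    assert (0 <= INR k / ((INR k + 1) ^ 2 * (INR k + 2)))%R.
    { apply Rdiv_le_0_compat; auto. apply Rmult_lt_0_compat; [apply pow_lt|]; lra. }
    lra.
  - eexists. apply (is_series_scal (K := R_AbsRing) (V := R_NormedModule) 2%R). exact T.
Qed.

Lemma is_lim_seq_inv_INR : is_lim_seq (fun n => / INR (n + 1))%R 0%R.
Proof.
  apply is_lim_seq_ext with (fun n => / INR (S n))%R.
  { intros n. do 2 f_equal. lia. }
  apply (is_lim_seq_incr_1 (fun n => / INR n)%R).
  replace (Finite 0) with (Rbar_inv p_infty) by reflexivity.
  apply is_lim_seq_inv; [apply is_lim_seq_INR | discriminate].
Qed.

Lemma Ccv_psum (u : nat -> nat -> C) (v : nat -> C) n :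
  (forall k, Ccv (fun i => u i k) (v k)) -> Ccv (fun i => psum (u i) n) (psum v n).
Proof.
  intros H. induction n as [|n IH].
  - apply Ccv_ext with (fun _ => 0); [reflexivity | apply Ccv_const].
  - rewrite psum_S. apply Ccv_ext with (fun i => psum (u i) n + u i n).
    + intros i. now rewrite psum_S.
    + apply Ccv_plus; auto.
Qed.

(** Dominated convergence for series. It is used to let the parameter [a] tend to 0. *)
Lemma tannery (u : nat -> nat -> C) (v : nat -> C) (b : nat -> R) (s : nat -> C) (l : C) :
  (forall k, Ccv (fun i => u i k) (v k)) ->
  (forall i k, Cmod (u i k) <= b k)%R -> ex_series b ->
  (forall i, Cser (u i) (s i)) -> Cser v l -> Ccv s l.
Proof.
  intros Hc Hb [B HB] Hs Hl.
  assert (Hvb : forall k, (Cmod (v k) <= b k)%R).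
  { intros k. apply (Ccv_le (fun i => u i k)); auto. }
  assert (Htail : forall w t, (forall k, (Cmod (w k) <= b k)%R) -> Cser w t -> forall N,
     (Cmod (t - psum w (S N)) <= B - sum_n b N)%R).
  { intros w t Hw Ht N. apply (Cser_le _ _ (fun k => b (S N + k)%nat) _ (Cser_tail _ _ (S N) Ht)).
    - intros k. apply Hw.
    - apply (is_series_incr_n b (S N)); [lia|].
      assert (E : forall a x : R, (a - x + x)%R = a) by (intros; ring).
      simpl pred. unfold plus; simpl. rewrite E. exact HB. }
  apply is_lim_seq_spec. intros [eps Heps]. simpl.
  assert (HB' : is_lim_seq (sum_n b) B) by exact HB.
  apply is_lim_seq_spec in HB'. destruct (HB' (mkposreal (eps / 3) ltac:(lra))) as [N HN].
  simpl in HN. specialize (HN N (Nat.le_refl N)). apply Rabs_def2 in HN.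
  assert (Hp := Ccv_psum u v (S N) Hc).
  apply is_lim_seq_spec in Hp. destruct (Hp (mkposreal (eps / 3) ltac:(lra))) as [M HM].
  exists M. intros n Hn. specialize (HM n Hn). simpl in HM.
  rewrite Rminus_0_r, Rabs_pos_eq in * by apply Cmod_ge_0.
  replace (s n - l) with ((s n - psum (u n) (S N)) + ((psum (u n) (S N) - psum v (S N))
     + - (l - psum v (S N)))) by ring.
  eapply Rle_lt_trans; [apply Cmod_triangle|].
  assert (H1 := Cmod_triangle (psum (u n) (S N) - psum v (S N)) (- (l - psum v (S N)))).
  rewrite Cmod_opp in H1.
  assert (H2 := Htail (u n) (s n) (Hb n) (Hs n) N).
  assert (H3 := Htail v l Hvb Hl N). lra.
Qed.

(** * A Riemann-Lebesgue lemma for the Dirichlet kernels *)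

Lemma sin_PI_ge x y : (0 < x)%R -> (y < 1)%R -> exists sg, (0 < sg)%R /\
  forall s, (x <= s <= y)%R -> (sg <= sin (PI * s))%R.
Proof.
  intros Hx Hy. assert (HPI := PI_RGT_0).
  destruct (Rle_dec x y) as [Hxy|Hxy]; [|exists 1%R; split; [lra | intros; lra]].
  exists (Rmin (sin (PI * x)) (sin (PI * y))). split.
  - apply Rmin_pos; apply sin_gt_0; nra.
  - intros s Hs. destruct (Rle_dec s (1 / 2)) as [H|H].
    + eapply Rle_trans; [apply Rmin_l|]. apply sin_incr_1; nra.
    + eapply Rle_trans; [apply Rmin_r|].
      rewrite <- (sin_PI_x (PI * y)), <- (sin_PI_x (PI * s)). apply sin_incr_1; nra.
Qed.

(** Integration by parts in differential form: adding [h cos(N s + be) / (N sin(pi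
    s))] to [F] leaves a derivative of size 1/N. *)
Lemma riemann_lebesgue_le F h dh x y be N H sg :
  (0 < x)%R -> (x <= y)%R -> (y < 1)%R -> (0 < N)%R -> (0 < sg)%R ->
  (forall s, (x <= s <= y)%R -> (sg <= sin (PI * s))%R) ->
  (forall s, (x <= s <= y)%R -> rderiv F s (h s * RtoC (sin (N * s + be) / sin (PI * s)))) ->
  (forall s, (x <= s <= y)%R -> rderiv h s (dh s)) ->
  (forall s, (x <= s <= y)%R -> (Cmod (h s) <= H /\ Cmod (dh s) <= H)%R) ->
  (Cmod (F y - F x) <= (2 * H / sg + (H / sg + H * PI / sg ^ 2)) * / N)%R.
Proof.
  intros Hx Hxy Hy HN Hsg Hsin HF Hh Hb. assert (HPI := PI_RGT_0).
  assert (HH : (0 <= H)%R) by (eapply Rle_trans; [apply Cmod_ge_0 | apply (Hb x); lra]).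
  set (q := fun s => (cos (N * s + be) / (N * sin (PI * s)))%R).
  assert (Hq : forall s, (x <= s <= y)%R -> (Rabs (q s) <= / sg * / N)%R).
  { intros s Hs. unfold q. specialize (Hsin s Hs).
    unfold Rdiv. rewrite Rabs_mult, Rabs_inv, Rabs_mult, (Rabs_pos_eq N), (Rabs_pos_eq (sin _)) by lra.
    rewrite <- (Rmult_1_l (/ sg * / N)).
    apply Rmult_le_compat; try apply Rabs_pos.
    - left. apply Rinv_0_lt_compat, Rmult_lt_0_compat; lra.
    - apply Rabs_le, COS_bound.
    - rewrite <- Rinv_mult, Rmult_comm. apply Rinv_le_contravar; [nra|]. nra. }
  (* [q] is an antiderivative of the kernel up to sign and an error of order 1/N. *)
  set (Psi := fun s => F s + h s * RtoC (q s)).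
  set (dPsi := fun s => dh s * RtoC (q s)
     - h s * RtoC (PI * cos (PI * s) * cos (N * s + be) / (N * sin (PI * s) ^ 2))).
  assert (HPsi : (Cmod (Psi y - Psi x) <= (H / sg + H * PI / sg ^ 2) * / N * (y - x))%R).
  { apply (rderiv_MVT Psi dPsi x y); auto.
    - intros s Hs. assert (Hs' := Hsin s Hs). eapply rderiv_eq; [|apply rderiv_plus; [apply HF; auto|]].
      2:{ apply rderiv_mult; [apply Hh; auto|]. apply rderiv_RtoC.
          unfold q. auto_derive; [|reflexivity]. nra. }
      unfold dPsi.
      unfold dPsi.
      match goal with |- h s * RtoC ?A + (?X + h s * RtoC ?B) = _ =>
        replace (h s * RtoC A + (X + h s * RtoC B)) with (X + h s * RtoC (A + B))
          by (rewrite RtoC_plus; ring);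
        replace (A + B)%R with (- (PI * cos (PI * s) * cos (N * s + be) / (N * sin (PI * s) ^ 2)))%R
          by (field; lra)
      end.
      rewrite RtoC_opp. ring.
    - intros s Hs. unfold dPsi. specialize (Hb s Hs). assert (Hs' := Hsin s Hs).
      eapply Rle_trans; [apply Cmod_triangle|]. rewrite Cmod_opp, !Cmod_mult, !Cmod_R.
      rewrite Rmult_plus_distr_r. apply Rplus_le_compat.
      + unfold Rdiv. rewrite Rmult_assoc. apply Rmult_le_compat; try apply Rabs_pos;
          try apply Cmod_ge_0; try apply Hb. now apply Hq.
      + unfold Rdiv. rewrite !Rmult_assoc. apply Rmult_le_compat; try apply Rabs_pos;
          try apply Cmod_ge_0; try apply Hb.
        rewrite !Rabs_mult, Rabs_inv, Rabs_mult, (Rabs_pos_eq PI), (Rabs_pos_eq N) by lra.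
        rewrite (Rabs_pos_eq (sin _ ^ 2)) by apply pow2_ge_0.
        apply Rmult_le_compat_l; [lra|].
        apply Rle_trans with (1 * (1 * (/ (N * sin (PI * s) ^ 2))))%R.
        * assert (0 < / (N * sin (PI * s) ^ 2))%R
            by (apply Rinv_0_lt_compat, Rmult_lt_0_compat; [lra | apply pow_lt; lra]).
          apply Rmult_le_compat; try apply Rabs_pos.
          -- apply Rmult_le_pos; [apply Rabs_pos | lra].
          -- apply Rabs_le, COS_bound.
          -- apply Rmult_le_compat_r; [lra|]. apply Rabs_le, COS_bound.
        * rewrite !Rmult_1_l, <- Rinv_mult, (Rmult_comm (sg ^ 2)).
          assert (sg ^ 2 <= sin (PI * s) ^ 2)%R by (apply pow_incr; lra).
          assert (0 < sg ^ 2)%R by (apply pow_lt; lra).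
          apply Rinv_le_contravar; [apply Rmult_lt_0_compat; lra|].
          apply Rmult_le_compat_l; lra. }
  replace (F y - F x) with ((Psi y - Psi x) + (h x * RtoC (q x) - h y * RtoC (q y)))
    by (unfold Psi; ring).
  assert (HN' : (0 < / N)%R) by now apply Rinv_0_lt_compat.
  assert (Hhq : forall s, (x <= s <= y)%R -> (Cmod (h s * RtoC (q s)) <= H / sg * / N)%R).
  { intros s Hs. rewrite Cmod_mult, Cmod_R. unfold Rdiv. rewrite Rmult_assoc.
    apply Rmult_le_compat; [apply Cmod_ge_0 | apply Rabs_pos | now apply Hb | now apply Hq]. }
  eapply Rle_trans; [apply Cmod_triangle|].
  assert (T1 := Cmod_triangle (h x * RtoC (q x)) (- (h y * RtoC (q y)))). rewrite Cmod_opp in T1.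
  assert (T2 := Hhq x ltac:(lra)). assert (T3 := Hhq y ltac:(lra)).
  set (A := (H / sg + H * PI / sg ^ 2)%R) in *.
  assert (HA : (0 <= A)%R).
  { assert (0 < sg ^ 2)%R by now apply pow_lt.
    apply Rplus_le_le_0_compat; apply Rdiv_le_0_compat; auto. apply Rmult_le_pos; lra. }
  assert (T4 : (A * / N * (y - x) <= A * / N)%R).
  { rewrite <- (Rmult_1_r (A * / N)) at 2. apply Rmult_le_compat_l; [apply Rmult_le_pos; lra | lra]. }
  unfold Cminus in *.
  replace ((2 * H / sg + A) * / N)%R with (A * / N + (H / sg * / N + H / sg * / N))%R by (field; lra).
  lra.
Qed.

(** The kernel is the Dirichlet kernel for [be = 0] and the conjugate one for [be =
    pi/2]. Working with a function [F n] whose derivative is the oscillating integrand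
    avoids integrals altogether. *)
Lemma riemann_lebesgue (F : nat -> R -> C) h dh H be a b :
  (0 < a < 1)%R -> (0 < b < 1)%R ->
  (forall n s, (0 < s < 1)%R ->
     rderiv (F n) s (h s * RtoC (sin (INR (2 * n + 1) * PI * s + be) / sin (PI * s)))) ->
  (forall s, (0 < s < 1)%R -> rderiv h s (dh s)) ->
  (forall s, (0 < s < 1)%R -> (Cmod (h s) <= H /\ Cmod (dh s) <= H)%R) ->
  Ccv (fun n => F n b - F n a) 0.
Proof.
  intros Ha Hb HF Hh HH.
  assert (G : forall x y, (0 < x)%R -> (x <= y)%R -> (y < 1)%R -> Ccv (fun n => F n y - F n x) 0).
  { intros x y Hx Hxy Hy. destruct (sin_PI_ge x y Hx Hy) as (sg & Hsg & Hsin).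
    set (A := (2 * H / sg + (H / sg + H * PI / sg ^ 2))%R).
    assert (HPI := PI_RGT_0). assert (HPI1 : (1 <= PI)%R) by (assert (K := PI2_1); lra).
    assert (HH0 : (0 <= H)%R) by (eapply Rle_trans; [apply Cmod_ge_0 | apply (HH x); lra]).
    assert (HA : (0 <= A)%R).
    { assert (0 < sg ^ 2)%R by now apply pow_lt.
      unfold A. repeat apply Rplus_le_le_0_compat; apply Rdiv_le_0_compat; auto;
        try apply Rmult_le_pos; lra. }
    apply Ccv_bound with (fun n => A * / INR (n + 1))%R.
    2:{ apply is_lim_seq_scal_0, is_lim_seq_inv_INR. }
    intros n. replace (F n y - F n x - 0) with (F n y - F n x) by ring.
    assert (HN1 : (1 <= INR (n + 1))%R) by apply INR_S_ge_1.
    assert (HN : (INR (n + 1) <= INR (2 * n + 1) * PI)%R).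
    { assert (INR (n + 1) <= INR (2 * n + 1))%R by (apply le_INR; lia). nra. }
    apply Rle_trans with (A * / (INR (2 * n + 1) * PI))%R.
    - apply (riemann_lebesgue_le (F n) h dh x y be); auto; intros; try lra;
        [apply HF | apply Hh | apply HH]; lra.
    - apply Rmult_le_compat_l; auto. apply Rinv_le_contravar; lra. }
  destruct (Rle_dec a b) as [Hab|Hab]; [apply G; lra|].
  apply Ccv_ext with (fun n => (- (1)) * (F n a - F n b)); [intros; ring|].
  replace (RtoC 0) with ((- (1)) * 0) by ring. apply Ccv_scal, G; lra.
Qed.

(** * Three trigonometric series *)

Definition freq (k : nat) : R := (2 * PI * INR (k + 1))%R.

Lemma psum_cos_dirichlet s n : sin (PI * s) <> 0%R ->
  1 + 2 * psum (fun k => RtoC (cos (freq k * s))) n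
  = RtoC (sin (INR (2 * n + 1) * PI * s) / sin (PI * s)).
Proof.
  intros Hs. induction n as [|n IH].
  - rewrite psum_0. simpl INR. replace (1 * PI * s)%R with (PI * s)%R by ring.
    replace (sin (PI * s) / sin (PI * s))%R with 1%R by (field; auto). ring.
  - rewrite psum_S.
    replace (1 + 2 * (psum (fun k => RtoC (cos (freq k * s))) n + RtoC (cos (freq n * s))))
      with (1 + 2 * psum (fun k => RtoC (cos (freq k * s))) n + RtoC (2 * cos (freq n * s)))
      by (rewrite RtoC_mult; ring).
    rewrite IH, <- RtoC_plus. f_equal. unfold freq.
    set (A := (2 * PI * INR (n + 1) * s)%R).
    replace (INR (2 * n + 1) * PI * s)%R with (A - PI * s)%R
      by (unfold A; rewrite !plus_INR, mult_INR; simpl; ring).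
    replace (INR (2 * S n + 1) * PI * s)%R with (A + PI * s)%R
      by (replace (2 * S n + 1)%nat with (2 * n + 3)%nat by lia;
          unfold A; rewrite !plus_INR, mult_INR; simpl; ring).
    rewrite sin_plus, sin_minus. field. auto.
Qed.

Lemma psum_sin_dirichlet s n : sin (PI * s) <> 0%R ->
  2 * psum (fun k => RtoC (sin (freq k * s))) n
  = RtoC ((cos (PI * s) - cos (INR (2 * n + 1) * PI * s)) / sin (PI * s)).
Proof.
  intros Hs. induction n as [|n IH].
  - rewrite psum_0. simpl INR. replace (1 * PI * s)%R with (PI * s)%R by ring.
    replace ((cos (PI * s) - cos (PI * s)) / sin (PI * s))%R with 0%R by (field; auto). ring.
  - rewrite psum_S.
    replace (2 * (psum (fun k => RtoC (sin (freq k * s))) n + RtoC (sin (freq n * s))))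
      with (2 * psum (fun k => RtoC (sin (freq k * s))) n + RtoC (2 * sin (freq n * s)))
      by (rewrite RtoC_mult; ring).
    rewrite IH, <- RtoC_plus. f_equal. unfold freq.
    set (A := (2 * PI * INR (n + 1) * s)%R).
    replace (INR (2 * n + 1) * PI * s)%R with (A - PI * s)%R
      by (unfold A; rewrite !plus_INR, mult_INR; simpl; ring).
    replace (INR (2 * S n + 1) * PI * s)%R with (A + PI * s)%R
      by (replace (2 * S n + 1)%nat with (2 * n + 3)%nat by lia;
          unfold A; rewrite !plus_INR, mult_INR; simpl; ring).
    rewrite cos_plus, cos_minus. field. auto.
Qed.

Lemma rderiv_cos w s : rderiv (fun s => RtoC (cos (w * s))) s (RtoC (- (w * sin (w * s)))).
Proof. apply rderiv_RtoC. auto_derive; auto. ring. Qed.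

Lemma rderiv_sin w s : rderiv (fun s => RtoC (sin (w * s))) s (RtoC (w * cos (w * s))).
Proof. apply rderiv_RtoC. auto_derive; auto. ring. Qed.

Lemma sin_PI_pos s : (0 < s < 1)%R -> (0 < sin (PI * s))%R.
Proof. intros H. assert (K := PI_RGT_0). apply sin_gt_0; nra. Qed.

Lemma sin_freq_half k : sin (freq k * (1 / 2)) = 0%R.
Proof.
  unfold freq. replace (2 * PI * INR (k + 1) * (1 / 2))%R with (0 + INR (k + 1) * PI)%R by field.
  apply sin_eq_0_1. exists (Z.of_nat (k + 1)). rewrite <- INR_IZR_INZ. ring.
Qed.

(** The derivative of the n-th partial sum of [log (1 + x)] differs from [1/(1 + x)]
    by at most [x^{n+1}]; comparing with [x^{n+2}/(n+2)] on [0, 1] gives the bound. *)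
Lemma alt_harmonic n :
  (Rabs (sum_f_R0 (fun k => (-1) ^ k / INR (k + 1)) n - ln 2) <= / INR (n + 2))%R.
Proof.
  set (p := fun x => (sum_f_R0 (fun k => (-1) ^ k / INR (k + 1) * x ^ (k + 1)) n)%R).
  assert (Hp : forall x, (0 <= x)%R -> is_derive p x ((1 - (- x) ^ (n + 1)) / (1 + x))%R).
  { intros x Hx.
    assert (E : forall N, (sum_f_R0 (fun k => (- x) ^ k) N = (1 - (- x) ^ (N + 1)) / (1 + x))%R).
    { induction N as [|N IH]; simpl sum_f_R0; [simpl; field; lra|]. rewrite IH.
      replace (S N + 1)%nat with (S (N + 1)) by lia. rewrite Nat.add_1_r. simpl. field. lra. }
    assert (D : forall j, is_derive (fun x => (-1) ^ j / INR (j + 1) * x ^ (j + 1))%R x ((- x) ^ j)%R).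
    { intros j. replace ((- x) ^ j)%R with ((-1) ^ j * x ^ j)%R
        by (rewrite <- Rpow_mult_distr; f_equal; ring).
      auto_derive; auto. replace (pred (j + 1)) with j by lia. field. apply not_0_INR. lia. }
    rewrite <- E. unfold p. clear E p.
    induction n as [|N IH].
    - exact (D 0%nat).
    - exact (is_derive_plus _ _ _ _ _ IH (D (S N))). }
  assert (G : forall e, (e = 1 \/ e = -1)%R ->
    (e * (p 1 - ln 2) <= / INR (n + 2))%R).
  { intros e He.
    set (f := fun x => (e * (p x - ln (1 + x)) - x ^ (n + 2) / INR (n + 2))%R).
    assert (Hf : forall x, (0 <= x)%R -> is_derive f x
       (e * (- ((- x) ^ (n + 1) / (1 + x))) - x ^ (n + 1))%R).
    { intros x Hx. unfold f.
      assert (Hl : is_derive (fun x => (- ln (1 + x)))%R x (- / (1 + x))%R)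
        by (auto_derive; [lra | field; lra]).
      assert (H1 := is_derive_plus _ _ _ _ _ (Hp x Hx) Hl).
      assert (H2 := is_derive_scal _ _ e _ H1).
      assert (H3 : is_derive (fun x => - (x ^ (n + 2) / INR (n + 2)))%R x (- (x ^ (n + 1)))%R).
      { auto_derive; auto. replace (pred (n + 2)) with (n + 1)%nat by lia.
        field. apply not_0_INR. lia. }
      assert (H4 := is_derive_plus _ _ _ _ _ H2 H3).
      eapply (fun H => eq_rect _ (is_derive _ x) H4 _ H).
      unfold plus, scal, mult; simpl. unfold mult; simpl. field. lra. }
    destruct (MVT_gen f 0 1 (fun x => (e * (- ((- x) ^ (n + 1) / (1 + x))) - x ^ (n + 1))%R)) as [c [Hc E]].
    - intros x Hx. rewrite Rmin_left, Rmax_right in Hx by lra. apply Hf. lra.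
    - intros x Hx. rewrite Rmin_left, Rmax_right in Hx by lra.
      apply derivable_continuous_pt. eexists. apply is_derive_Reals. apply Hf. lra.
    - rewrite Rmin_left, Rmax_right in Hc by lra.
      assert (E0 : f 0%R = 0%R).
      { unfold f. assert (p 0%R = 0%R).
        { unfold p. clear. induction n as [|N IH]; simpl sum_f_R0.
          - simpl. field.
          - rewrite IH, pow_i by lia. ring. }
        rewrite H, Rplus_0_r, ln_1, pow_i by lia. unfold Rdiv. ring. }
      assert (Hs : (e * (- ((- c) ^ (n + 1) / (1 + c))) - c ^ (n + 1) <= 0)%R).
      { assert (Hc1 : (0 <= c ^ (n + 1))%R) by (apply pow_le; lra).
        assert (K : (Rabs (e * (- ((- c) ^ (n + 1) / (1 + c)))) <= c ^ (n + 1))%R).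
        { rewrite Rabs_mult, Rabs_Ropp. unfold Rdiv. rewrite Rabs_mult, Rabs_inv, <- RPow_abs, Rabs_Ropp.
          rewrite (Rabs_pos_eq c), (Rabs_pos_eq (1 + c)) by lra.
          replace (Rabs e) with 1%R by (destruct He as [-> | ->]; [rewrite Rabs_pos_eq; lra | rewrite Rabs_left; lra]).
          rewrite Rmult_1_l. apply Rle_div_l; [lra|]. nra. }
        apply Rabs_le_between in K. lra. }
      rewrite E0 in E. unfold f in E. rewrite pow1 in E.
      replace (1 + 1)%R with 2%R in E by ring.
      assert (E' : (e * (p 1 - ln 2) = / INR (n + 2) + (e * - ((- c) ^ (n + 1) / (1 + c)) - c ^ (n + 1)))%R).
      { unfold Rdiv in *. lra. }
      lra. }
  replace (sum_f_R0 (fun k => (-1) ^ k / INR (k + 1)) n)%R with (p 1%R).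
  - apply Rabs_le. assert (G1 := G 1%R ltac:(auto)). assert (G2 := G (-1)%R ltac:(auto)). lra.
  - unfold p. apply sum_eq. intros. rewrite pow1. ring.
Qed.

Lemma cos_PI_INR n : cos (INR n * PI) = ((-1) ^ n)%R.
Proof.
  induction n as [|n IH].
  - simpl. rewrite Rmult_0_l. apply cos_0.
  - rewrite S_INR, Rmult_plus_distr_r, Rmult_1_l, neg_cos, IH. simpl. ring.
Qed.

Lemma cos_freq_half k : cos (freq k * (1 / 2)) = ((-1) ^ (k + 1))%R.
Proof.
  unfold freq. replace (2 * PI * INR (k + 1) * (1 / 2))%R with (INR (k + 1) * PI)%R by field.
  apply cos_PI_INR.
Qed.

(** The derivative of the partial sum plus [ln (2 sin (pi s))] is a multiple of the
    conjugate Dirichlet kernel, so the sum is [- ln (2 sin (pi a))] up to a constant;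
    the alternating harmonic series at [a = 1/2] shows that the constant is 0. The
    convergence is only conditional. *)
Lemma Cser_cos_log a : (0 < a < 1)%R ->
  Cser (fun k => RtoC (cos (freq k * a) / INR (k + 1))) (RtoC (- ln (2 * sin (PI * a)))).
Proof.
  intros Ha.
  set (U := fun n s => psum (fun k => RtoC (/ INR (k + 1)) * RtoC (cos (freq k * s))) n).
  set (F := fun n s => U n s + RtoC (ln (2 * sin (PI * s)))).
  assert (H : Ccv (fun n => F n a - F n (1 / 2)%R) 0).
  { apply (riemann_lebesgue F (fun _ => RtoC PI) (fun _ => 0) PI (PI / 2)); try lra.
    - intros n s Hs. assert (Hp := sin_PI_pos s Hs).
      eapply rderiv_eq; [|apply rderiv_plus; [apply rderiv_psum;
         intros k _; apply rderiv_scal, rderiv_cos | apply rderiv_RtoC]].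
      2:{ auto_derive; [lra | reflexivity]. }
      rewrite (psum_ext _ (fun k => RtoC (- PI) * (2 * RtoC (sin (freq k * s))))).
      2:{ intros k _. unfold freq. rewrite <- !RtoC_mult. f_equal. field. apply not_0_INR. lia. }
      rewrite psum_scal, psum_scal, psum_sin_dirichlet by lra.
      rewrite sin_plus, cos_PI2, sin_PI2, <- !RtoC_mult, <- RtoC_plus. f_equal. field. lra.
    - intros s _. apply rderiv_const.
    - intros s _. assert (K := PI_RGT_0). rewrite Cmod_0, Cmod_R, Rabs_pos_eq; lra. }
  assert (Hhalf : Ccv (fun n => U n (1 / 2)%R) (RtoC (- ln 2))).
  { apply Ccv_bound with (fun n => / INR (n + 1))%R; [|apply is_lim_seq_inv_INR].
    intros n. destruct n as [|n].
    - unfold U. rewrite psum_0. simpl INR. rewrite Rinv_1.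
      replace (0 - RtoC (- ln 2)) with (RtoC (ln 2)) by (rewrite RtoC_opp; ring).
      assert (K := ln_lt_2). assert (K2 : (ln 2 < 1)%R).
      { rewrite <- (ln_exp 1). apply ln_increasing; [lra|]. assert (Z := exp_ineq1 1 ltac:(lra)). lra. }
      assert (K3 : (0 < ln 2)%R) by (rewrite <- ln_1; apply ln_increasing; lra).
      rewrite Cmod_R, Rabs_pos_eq; lra.
    - assert (K := alt_harmonic n).
      replace (U (S n) (1 / 2)%R - RtoC (- ln 2))
        with (RtoC (- (sum_f_R0 (fun k => (-1) ^ k / INR (k + 1))%R n - ln 2))).
      + rewrite Cmod_R, Rabs_Ropp. replace (S n + 1)%nat with (n + 2)%nat by lia. exact K.
      + assert (E : U (S n) (1 / 2)%R = RtoC (- sum_f_R0 (fun k => (-1) ^ k / INR (k + 1))%R n)).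
        { clear. unfold U. induction n as [|n IH].
          - rewrite psum_S, psum_0, cos_freq_half. simpl. rewrite <- RtoC_mult, <- RtoC_plus. f_equal. field.
          - rewrite psum_S, IH, cos_freq_half. simpl sum_f_R0.
            rewrite <- RtoC_mult, <- RtoC_plus. f_equal. rewrite pow_add. simpl. field.
            apply (not_0_INR (S n + 1)). lia. }
        rewrite E, <- RtoC_minus. f_equal. ring. }
  assert (H2 := Ccv_plus _ _ _ _ H Hhalf).
  assert (H3 := Ccv_minus _ _ _ _ H2 (Ccv_const (RtoC (ln (2 * sin (PI * a)) - ln 2)))).
  replace (0 + RtoC (- ln 2) - RtoC (ln (2 * sin (PI * a)) - ln 2))
    with (RtoC (- ln (2 * sin (PI * a)))) in H3
    by (rewrite RtoC_minus, !RtoC_opp; ring).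
  revert H3. apply Ccv_ext. intros n. unfold F.
  replace (PI * (1 / 2))%R with (PI / 2)%R by field. rewrite sin_PI2, Rmult_1_r, RtoC_minus.
  replace (psum (fun k => RtoC (cos (freq k * a) / INR (k + 1))) n) with (U n a).
  - ring.
  - apply psum_ext. intros k _. rewrite <- RtoC_mult. f_equal. unfold Rdiv. ring.
Qed.

Lemma Cmod_RtoC_cos_div (x y : R) : (0 < y)%R -> (Cmod (RtoC (cos x / y)) <= / y)%R.
Proof.
  intros Hy. rewrite Cmod_R. unfold Rdiv. rewrite Rabs_mult, Rabs_inv, (Rabs_pos_eq y) by lra.
  rewrite <- (Rmult_1_l (/ y)) at 2. apply Rmult_le_compat_r.
  - left. now apply Rinv_0_lt_compat.
  - apply Rabs_le, COS_bound.
Qed.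

Lemma INR_sq_pos k : (0 < INR (k + 1) ^ 2)%R.
Proof. apply pow_lt. assert (H := INR_S_ge_1 k). lra. Qed.

Lemma Ccv_cos w (x : nat -> R) (l : R) :
  is_lim_seq x l -> Ccv (fun n => RtoC (cos (w * x n))) (RtoC (cos (w * l))).
Proof.
  intros H. apply Ccv_components. simpl. split; [|apply is_lim_seq_const].
  apply (is_lim_seq_continuous cos (fun n => w * x n)%R (w * l)%R).
  - apply derivable_continuous_pt, derivable_pt_cos.
  - change (Finite (w * l)) with (Rbar_mult w l). now apply is_lim_seq_scal_l.
Qed.

Lemma is_lim_seq_inv_INR2 : is_lim_seq (fun n => / INR (n + 2))%R 0%R.
Proof.
  apply is_lim_seq_ext with (fun n => / INR (S n + 1))%R.
  - intros n. do 2 f_equal. lia.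
  - apply (is_lim_seq_incr_1 (fun n => / INR (n + 1))%R), is_lim_seq_inv_INR.
Qed.

Lemma inv_INR2_range n : (0 < / INR (n + 2) <= 1 / 2)%R.
Proof.
  rewrite plus_INR. simpl. assert (H := pos_INR n). split.
  - apply Rinv_0_lt_compat. lra.
  - unfold Rdiv. rewrite Rmult_1_l. apply Rinv_le_contravar; lra.
Qed.

Lemma Ccv_RtoC (x : nat -> R) (l : R) : is_lim_seq x l -> Ccv (fun n => RtoC (x n)) (RtoC l).
Proof.
  intros H. apply Ccv_components. simpl. split; [exact H | apply is_lim_seq_const].
Qed.

(** Fourier series of the second Bernoulli polynomial. Up to the Dirichlet kernel the
    second derivative of the partial sums is constant, so the sum is [pi^2 (a -
    1/2)^2] plus a constant on (0, 1), hence at 0 by continuity. The sums over even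
    and over all indices then determine the constant, and with it [zeta(2)]. *)
Lemma Cser_cos_sq a : (0 <= a < 1)%R ->
  Cser (fun k => RtoC (cos (freq k * a) / INR (k + 1) ^ 2)) (RtoC (PI ^ 2 * (a ^ 2 - a + 1 / 6))).
Proof.
  set (t := fun a k => RtoC (cos (freq k * a) / INR (k + 1) ^ 2)).
  assert (Hle : forall a k, (Cmod (t a k) <= / INR (k + 1) ^ 2)%R).
  { intros x k. apply Cmod_RtoC_cos_div, INR_sq_pos. }
  set (T := fun a => CSeries (t a)).
  assert (HT : forall a, Cser (t a) (T a)).
  { intros x. exact (Cser_abs_CSeries (t x) _ (Hle x) ex_series_inv_sq). }
  assert (H1 : forall a, (0 < a < 1)%R -> T a = T (1 / 2)%R + RtoC (PI ^ 2 * (a - 1 / 2) ^ 2)).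
  { clear a. intros a Ha.
    set (H := fun n u => psum (t u) n + RtoC (- (PI ^ 2 * (u - 1 / 2) ^ 2))).
    set (dH := fun n u => psum (fun k => RtoC (/ INR (k + 1) ^ 2) * RtoC (- (freq k * sin (freq k * u)))) n
                       + RtoC (- (2 * PI ^ 2 * (u - 1 / 2)))).
    assert (HH : forall n u, rderiv (H n) u (dH n u)).
    { intros n u. apply rderiv_plus.
      - apply (rderiv_psum (fun k s => t s k)). intros k _.
        apply rderiv_ext with (fun s => RtoC (/ INR (k + 1) ^ 2) * RtoC (cos (freq k * s))).
        + intros s. unfold t. rewrite <- RtoC_mult. f_equal. unfold Rdiv. ring.
        + apply rderiv_scal, rderiv_cos.
      - apply rderiv_RtoC. auto_derive; auto. ring. }
    assert (HdH : forall n u, (0 < u < 1)%R -> rderiv (dH n) u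
       (RtoC (- (2 * PI ^ 2)) * RtoC (sin (INR (2 * n + 1) * PI * u) / sin (PI * u)))).
    { intros n u Hu. assert (Hs := sin_PI_pos u Hu).
      eapply rderiv_eq; [|apply rderiv_plus; [apply rderiv_psum; intros k _|]].
      3:{ apply rderiv_RtoC. auto_derive; [auto | reflexivity]. }
      2:{ apply rderiv_scal. apply rderiv_ext with (fun s => RtoC (- freq k) * RtoC (sin (freq k * s))).
          - intros s. rewrite <- RtoC_mult. f_equal. ring.
          - apply rderiv_scal, rderiv_sin. }
      rewrite (psum_ext _ (fun k => RtoC (- (4 * PI ^ 2)) * RtoC (cos (freq k * u)))).
      2:{ intros k _. rewrite <- !RtoC_mult. f_equal. unfold freq. field. apply not_0_INR. lia. }
      rewrite psum_scal, <- psum_cos_dirichlet by lra.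
      replace (- (4 * PI ^ 2))%R with (- (2 * PI ^ 2) * 2)%R by ring.
      rewrite RtoC_mult.
      replace (- (2 * (PI * (PI * 1)) * 1))%R with (- (2 * PI ^ 2))%R by ring. ring. }
    assert (Hlim := riemann_lebesgue (fun n u => H n u + RtoC (a - u) * dH n u)
       (fun u => RtoC (- (2 * PI ^ 2) * (a - u))) (fun _ => RtoC (2 * PI ^ 2)) (2 * PI ^ 2) 0
       (1 / 2) a ltac:(lra) Ha).
    assert (HP : (0 <= PI ^ 2)%R) by apply pow2_ge_0.
    assert (L : Ccv (fun n => psum (t a) n - psum (t (1 / 2)%R) n) (RtoC (PI ^ 2 * (a - 1 / 2) ^ 2))).
    (* Taylor's formula at [1/2]: the function [H + (a - u) H'] of [u] has derivative [(a
       - u) H'' (u)], and [H' (1/2) = 0]. *)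
    { assert (L1 : Ccv (fun n => H n a + RtoC (a - a) * dH n a
           - (H n (1 / 2)%R + RtoC (a - 1 / 2) * dH n (1 / 2)%R)) 0).
      { apply Hlim.
        - intros n s Hs. eapply rderiv_eq; [|apply rderiv_plus; [apply HH|
            apply rderiv_mult; [apply rderiv_RtoC | apply HdH; auto]]].
          2:{ auto_derive; [auto | reflexivity]. }
          rewrite Rplus_0_r, (RtoC_mult (- (2 * PI ^ 2))). rewrite RtoC_opp. ring.
        - intros s _. apply rderiv_RtoC. auto_derive; auto. ring.
        - intros s Hs. rewrite !Cmod_R. split; apply Rabs_le; nra. }
      assert (L2 := Ccv_plus _ _ _ _ L1 (Ccv_const (RtoC (PI ^ 2 * (a - 1 / 2) ^ 2)))).
      replace (0 + RtoC (PI ^ 2 * (a - 1 / 2) ^ 2)) with (RtoC (PI ^ 2 * (a - 1 / 2) ^ 2)) in L2 by ring.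
      revert L2. apply Ccv_ext. intros n.
      assert (E : dH n (1 / 2)%R = 0).
      { unfold dH. rewrite (psum_ext _ (fun _ => 0 * 0)).
        - rewrite psum_scal. replace (- (2 * PI ^ 2 * (1 / 2 - 1 / 2)))%R with 0%R by field. ring.
        - intros k _. rewrite sin_freq_half. replace (- (freq k * 0))%R with 0%R by ring. ring. }
      rewrite E. unfold H.
      replace (a - a)%R with 0%R by ring.
      replace (- (PI ^ 2 * (1 / 2 - 1 / 2) ^ 2))%R with 0%R by field.
      rewrite RtoC_opp. ring. }
    assert (L2 := Ccv_minus _ _ _ _ (HT a) (HT (1 / 2)%R)).
    rewrite <- (Ccv_unique _ _ _ L2 L). ring. }
  (* The dominated limit [a -> 0] extends the formula from the open interval to 0. *)
  assert (H0 : T 0%R = T (1 / 2)%R + RtoC (PI ^ 2 / 4)).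
  { assert (L1 : Ccv (fun n => T (/ INR (n + 2))%R) (T 0%R)).
    { apply (tannery (fun n => t (/ INR (n + 2))%R) (t 0%R) (fun k => / INR (k + 1) ^ 2)%R);
        auto; [|apply ex_series_inv_sq].
      intros k. apply Ccv_ext with (fun n => RtoC (/ INR (k + 1) ^ 2) * RtoC (cos (freq k * / INR (n + 2)))).
      - intros n. unfold t. rewrite <- RtoC_mult. f_equal. unfold Rdiv. ring.
      - unfold t. unfold Rdiv. rewrite Rmult_comm, RtoC_mult.
        apply Ccv_scal, Ccv_cos, is_lim_seq_inv_INR2. }
    assert (L2 : Ccv (fun n => T (/ INR (n + 2))%R) (T (1 / 2)%R + RtoC (PI ^ 2 / 4))).
    { apply Ccv_ext with (fun n => T (1 / 2)%R + RtoC (PI ^ 2 * (/ INR (n + 2) - 1 / 2) ^ 2)).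
      - intros n. assert (K := inv_INR2_range n). rewrite <- H1; auto. lra.
      - apply Ccv_plus; [apply Ccv_const|]. apply Ccv_RtoC.
        replace (Finite (PI ^ 2 / 4)) with (Finite (PI ^ 2 * ((0 - 1 / 2) * (0 - 1 / 2))))
          by (f_equal; field).
        apply is_lim_seq_ext with (fun n => PI ^ 2 * ((/ INR (n + 2) - 1 / 2) * (/ INR (n + 2) - 1 / 2)))%R.
        { intros n. ring. }
        apply is_lim_seq_mult'; [apply is_lim_seq_const|].
        apply is_lim_seq_mult'; apply is_lim_seq_minus'; try apply is_lim_seq_const;
          apply is_lim_seq_inv_INR2. }
    exact (Ccv_unique _ _ _ L1 L2). }
  (* Since [cos (pi k) = (-1)^k], only even indices survive in the sum, each counted
     twice. *)
  assert (H2 : T 0%R + T (1 / 2)%R = RtoC (1 / 2) * T 0%R).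
  { assert (L1 : Ccv (fun n => psum (fun k => t 0%R k + t (1 / 2)%R k) (2 * n)) (T 0%R + T (1 / 2)%R)).
    { apply (Ccv_subseq (psum (fun k => t 0%R k + t (1 / 2)%R k)) _ (fun n => 2 * n)%nat); [intros; lia|].
      apply (Cser_plus _ _ _ _ (HT 0%R) (HT (1 / 2)%R)). }
    assert (L2 := Cser_scal (RtoC (1 / 2)) _ _ (HT 0%R)).
    apply (Ccv_unique _ _ _ L1). revert L2. apply Ccv_ext. intros n.
    induction n as [|n IH]; [reflexivity|].
    replace (2 * S n)%nat with (S (S (2 * n))) by lia.
    rewrite !psum_S, IH. unfold t. rewrite !cos_freq_half, !Rmult_0_r, cos_0.
    replace (2 * n + 1)%nat with (S (2 * n)) by lia. replace (S (2 * n) + 1)%nat with (2 * (n + 1))%nat by lia.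
    rewrite pow_1_odd, pow_1_even, mult_INR. simpl (INR 2).
    rewrite <- !RtoC_mult, <- !RtoC_plus, <- Cplus_assoc, <- !RtoC_plus. f_equal. f_equal.
    field. split; [apply not_0_INR; lia | apply (not_0_INR (S (2 * n))); lia]. }
  assert (E0 : T 0%R = RtoC (PI ^ 2 / 6)).
  { assert (E : T (1 / 2)%R = T 0%R - RtoC (PI ^ 2 / 4)) by (rewrite H0; ring).
    rewrite E in H2.
    assert (E3 : RtoC (3 / 2) * T 0%R = RtoC (PI ^ 2 / 4)).
    { replace (RtoC (3 / 2)) with (RtoC 1 + RtoC 1 - RtoC (1 / 2))
        by (rewrite <- RtoC_plus, <- RtoC_minus; f_equal; field).
      replace ((1 + 1 - RtoC (1 / 2)) * T 0%R) with
        ((T 0%R + (T 0%R - RtoC (PI ^ 2 / 4))) + RtoC (PI ^ 2 / 4) - RtoC (1 / 2) * T 0%R) by ring.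
      rewrite H2. ring. }
    replace (T 0%R) with (RtoC (2 / 3) * (RtoC (3 / 2) * T 0%R)).
    - rewrite E3, <- RtoC_mult. f_equal. field.
    - rewrite Cmult_assoc, <- RtoC_mult. replace (2 / 3 * (3 / 2))%R with 1%R by field. ring. }
  intros Ha. destruct (Req_dec a 0) as [->|Ha0].
  - replace (RtoC (PI ^ 2 * (0 ^ 2 - 0 + 1 / 6))) with (T 0%R); [apply HT|].
    rewrite E0. f_equal. field.
  - replace (RtoC (PI ^ 2 * (a ^ 2 - a + 1 / 6))) with (T a); [apply HT|].
    rewrite H1 by lra. assert (E : T (1 / 2)%R = T 0%R - RtoC (PI ^ 2 / 4)) by (rewrite H0; ring).
    rewrite E, E0, <- RtoC_minus, <- RtoC_plus. f_equal. field.
Qed.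

(** * Fourier series of the hyperbolic cosine *)

(** A linear term bounded by a quadratic one along a null sequence vanishes. *)
Lemma Cmod_small_eq_0 (z : C) (K : R) :
  (forall n, (Cmod z * / INR (n + 2) <= K * (/ INR (n + 2)) ^ 2)%R) -> z = 0.
Proof.
  intros H. apply Cmod_eq_0. apply Rle_antisym; [|apply Cmod_ge_0].
  assert (L : is_lim_seq (fun n => K * / INR (n + 2))%R 0%R).
  { apply is_lim_seq_scal_0, is_lim_seq_inv_INR2. }
  apply (is_lim_seq_le (fun _ => Cmod z) (fun n => K * / INR (n + 2))%R (Cmod z) 0%R); auto.
  - intros n. specialize (H n). assert (K1 := inv_INR2_range n).
    apply Rmult_le_reg_r with (/ INR (n + 2))%R; [lra|]. eapply Rle_trans; [exact H|]. right. ring.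
  - apply is_lim_seq_const.
Qed.

Lemma cos_m1_le x : (Rabs (cos x - 1) <= x ^ 2)%R.
Proof.
  assert (E : (cos x - 1 = - (2 * (sin (x / 2)) ^ 2))%R).
  { replace x with (2 * (x / 2))%R at 1 by field. rewrite cos_2a_sin. ring. }
  rewrite E, Rabs_Ropp.
  assert (H : (Rabs (sin (x / 2)) <= Rabs (x / 2))%R).
  { assert (G : forall y, (0 <= y)%R -> (Rabs (sin y) <= y)%R).
    { intros y Hy. assert (B := SIN_bound y). destruct (Rle_dec 1 y) as [H1|H1].
      - apply Rabs_le. lra.
      - destruct (Rle_lt_or_eq_dec 0 y Hy) as [Hp|<-]; [|rewrite sin_0, Rabs_R0; lra].
        assert (K := sin_lt_x y Hp). assert (K2 : (0 < sin y)%R).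
        { apply sin_gt_0; auto. assert (Z := PI2_1). lra. }
        rewrite Rabs_pos_eq; lra. }
    destruct (Rle_dec 0 (x / 2)) as [Hx|Hx].
    - rewrite (Rabs_pos_eq (x / 2)) by auto. now apply G.
    - rewrite <- Rabs_Ropp, <- sin_neg, (Rabs_left (x / 2)) by lra. apply G. lra. }
  rewrite Rabs_mult, (Rabs_pos_eq 2), <- RPow_abs by lra.
  assert (H2 : (Rabs (sin (x / 2)) ^ 2 <= Rabs (x / 2) ^ 2)%R).
  { apply pow_incr. split; [apply Rabs_pos | exact H]. }
  assert (H3 : ((x / 2) ^ 2 = x ^ 2 / 4)%R) by field.
  rewrite (pow2_abs (x / 2)), H3 in H2. assert (0 <= x ^ 2)%R by apply pow2_ge_0. lra.
Qed.

(** The numbers [c^2 + 4 pi^2 (k+1)^2], the denominators in the partial fractions of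
    the hyperbolic cotangent of [c/2]. *)
Definition coth_den (c : C) (k : nat) : C := c * c + RtoC (freq k ^ 2).

(** A quantitative form of [c] avoiding the poles [2 pi i k], which also gives
    absolute convergence. *)
Definition off_poles (ka : R) (c : C) : Prop :=
  (0 < ka)%R /\ forall k, (ka * INR (k + 1) ^ 2 <= Cmod (coth_den c k))%R.

Lemma coth_den_neq_0 ka (c : C) k : off_poles ka c -> coth_den c k <> 0.
Proof.
  intros [Hka HW]. apply Cmod_gt_0. eapply Rlt_le_trans; [|apply HW].
  apply Rmult_lt_0_compat; auto. apply INR_sq_pos.
Qed.

Definition cosh_term (c : C) (a : R) (k : nat) : C := RtoC (cos (freq k * a)) / coth_den c k.

Lemma cosh_term_le ka (c : C) a k : off_poles ka c ->
  (Cmod (cosh_term c a k) <= / ka * / INR (k + 1) ^ 2)%R.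
Proof.
  intros H. assert (N := coth_den_neq_0 ka c k H). destruct H as [Hka HW]. unfold cosh_term.
  rewrite Cmod_div by auto. rewrite <- Rinv_mult, Cmod_R.
  unfold Rdiv. rewrite <- (Rmult_1_l (/ (ka * _))). apply Rmult_le_compat; try apply Rabs_pos.
  - left. now apply Rinv_0_lt_compat, Cmod_gt_0.
  - apply Rabs_le, COS_bound.
  - apply Rinv_le_contravar; [|apply HW]. apply Rmult_lt_0_compat; auto. apply INR_sq_pos.
Qed.

Lemma ex_series_inv_sq_scal x : ex_series (fun k => x * / INR (k + 1) ^ 2)%R.
Proof.
  apply (ex_series_scal_l x (fun k => / INR (k + 1) ^ 2)%R). apply ex_series_inv_sq.
Qed.

Definition cosh_ser (c : C) (a : R) : C := CSeries (cosh_term c a).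

Lemma cosh_ser_correct ka (c : C) a : off_poles ka c -> Cser (cosh_term c a) (cosh_ser c a).
Proof.
  intros H.
  exact (Cser_abs_CSeries _ _ (fun k => cosh_term_le ka c a k H) (ex_series_inv_sq_scal (/ ka))).
Qed.

Lemma off_poles_opp ka (c : C) : off_poles ka c -> off_poles ka (- c).
Proof.
  intros [H1 H2]. split; auto. intros k. unfold coth_den.
  replace (- c * - c) with (c * c) by ring. apply H2.
Qed.

Lemma cosh_term_opp (c : C) a k : cosh_term (- c) a k = cosh_term c a k.
Proof. unfold cosh_term, coth_den. now replace (- c * - c) with (c * c) by ring. Qed.

Definition cosh_psum (c : C) (n : nat) (a : R) : C := 2 / c + 4 * c * psum (cosh_term c a) n.

Lemma cosh_psum_opp (c : C) n a : c <> 0 -> cosh_psum (- c) n a = - cosh_psum c n a.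
Proof.
  intros Hc. unfold cosh_psum.
  replace (psum (cosh_term (- c) a) n) with (psum (cosh_term c a) n).
  - field. auto.
  - apply psum_ext. intros. symmetry. apply cosh_term_opp.
Qed.

Definition dcosh_psum (c : C) (n : nat) (a : R) : C :=
  4 * c * psum (fun k => RtoC (- (freq k * sin (freq k * a))) / coth_den c k) n.

(** The partial sums satisfy [R'' - c^2 R = - 2 c D_n] with [D_n] the Dirichlet
    kernel, so [exp (c a) (R' - c R)] is constant in the limit. *)
Lemma cosh_psum_ode ka (c : C) a : off_poles ka c -> c <> 0 -> (0 < a < 1)%R ->
  Ccv (fun n => dcosh_psum c n a - c * cosh_psum c n a
                + c * Cexp (c * RtoC (1 / 2 - a)) * cosh_psum c n (1 / 2)) 0.
Proof.
  intros H Hc Ha.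
  set (F := fun n s => Cexp (c * RtoC s) * (dcosh_psum c n s - c * cosh_psum c n s)).
  assert (H1 : forall n s, rderiv (cosh_psum c n) s (dcosh_psum c n s)).
  { intros n s. unfold cosh_psum, dcosh_psum. eapply rderiv_eq; [|apply rderiv_plus;
      [apply rderiv_const | apply rderiv_scal, (rderiv_psum (fun k s => cosh_term c s k))]].
    2:{ intros k _. apply rderiv_ext with (fun s => / coth_den c k * RtoC (cos (freq k * s))).
        - intros x. unfold cosh_term. unfold Cdiv. ring.
        - apply rderiv_scal, rderiv_cos. }
    rewrite Cplus_0_l. f_equal. apply psum_ext. intros k _. unfold Cdiv. ring. }
  assert (H2 : forall n s, rderiv (dcosh_psum c n) s
     (4 * c * psum (fun k => RtoC (- (freq k ^ 2 * cos (freq k * s))) / coth_den c k) n)).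
  { intros n s. unfold dcosh_psum. apply rderiv_scal.
    apply (rderiv_psum (fun k s => RtoC (- (freq k * sin (freq k * s))) / coth_den c k)).
    intros k _. apply rderiv_ext with (fun s => RtoC (- freq k) / coth_den c k * RtoC (sin (freq k * s))).
    - intros x. rewrite Ropp_mult_distr_l, RtoC_mult. unfold Cdiv. ring.
    - eapply rderiv_eq; [|apply rderiv_scal, rderiv_sin].
      replace (- (freq k ^ 2 * cos (freq k * s)))%R with (- freq k * (freq k * cos (freq k * s)))%R by ring.
      rewrite (RtoC_mult (- freq k)). unfold Cdiv. ring. }
  assert (HF : forall n s, (0 < s < 1)%R -> rderiv (F n) s
     ((- (2 * c) * Cexp (c * RtoC s)) * RtoC (sin (INR (2 * n + 1) * PI * s + 0) / sin (PI * s)))).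
  { intros n s Hs. assert (Hp := sin_PI_pos s Hs).
    eapply rderiv_eq; [|apply rderiv_mult; [apply rderiv_exp | apply rderiv_plus; [apply H2|]]].
    2:{ apply rderiv_ext with (fun s => (- c) * cosh_psum c n s); [intros; ring|].
        apply rderiv_scal, H1. }
    rewrite Rplus_0_r, <- psum_cos_dirichlet by lra.
    assert (E : psum (fun k => RtoC (cos (freq k * s))) n =
       - psum (fun k => RtoC (- (freq k ^ 2 * cos (freq k * s))) / coth_den c k) n
         + c * c * psum (cosh_term c s) n).
    { rewrite <- psum_scal.
      replace (- psum (fun k => RtoC (- (freq k ^ 2 * cos (freq k * s))) / coth_den c k) n)
        with ((- (1)) * psum (fun k => RtoC (- (freq k ^ 2 * cos (freq k * s))) / coth_den c k) n) by ring.
      rewrite <- psum_scal, <- psum_plus. apply psum_ext. intros k _.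
      assert (N := coth_den_neq_0 ka c k H). unfold cosh_term.
      replace (- (freq k ^ 2 * cos (freq k * s)))%R with (- freq k ^ 2 * cos (freq k * s))%R by ring.
      rewrite RtoC_mult, RtoC_opp.
      replace (RtoC (freq k ^ 2)) with (coth_den c k - c * c) by (unfold coth_den; ring).
      field. auto. }
    rewrite E. unfold cosh_psum. field. auto. }
  assert (Hlim := riemann_lebesgue F (fun s => - (2 * c) * Cexp (c * RtoC s))
      (fun s => - (2 * c) * (c * Cexp (c * RtoC s)))
      (2 * Cmod c * exp (Cmod c) * (1 + Cmod c)) 0 (1 / 2) a ltac:(lra) Ha HF).
  assert (L : Ccv (fun n => F n a - F n (1 / 2)%R) 0).
  { apply Hlim.
    - intros s _. apply rderiv_scal, rderiv_exp.
    - intros s Hs. rewrite !Cmod_mult, Cmod_opp, Cmod_mult, Cmod_R, Rabs_pos_eq by lra.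
      assert (G0 := Cmod_ge_0 c).
      assert (G : (Cmod (Cexp (c * RtoC s)) <= exp (Cmod c))%R).
      { eapply Rle_trans; [apply Cmod_Cexp_le|]. apply exp_le.
        rewrite Cmod_mult, Cmod_R, Rabs_pos_eq by lra. nra. }
      assert (G1 := Cmod_ge_0 (Cexp (c * RtoC s))).
      assert (G2 : (0 <= Cmod c * exp (Cmod c))%R) by (apply Rmult_le_pos; lra).
      assert (G3 : (Cmod c * Cmod (Cexp (c * RtoC s)) <= Cmod c * exp (Cmod c))%R)
        by (apply Rmult_le_compat_l; auto).
      split; nra. }
  assert (L2 := Ccv_scal (Cexp (- (c * RtoC a))) _ _ L).
  rewrite Cmult_0_r in L2. revert L2. apply Ccv_ext. intros n. unfold F.
  assert (E : dcosh_psum c n (1 / 2) = 0).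
  { unfold dcosh_psum. rewrite (psum_ext _ (fun _ => 0 * 0)).
    - rewrite psum_scal. ring.
    - intros k _. rewrite sin_freq_half, Rmult_0_r, Ropp_0. unfold Cdiv. ring. }
  rewrite E.
  replace (c * RtoC (1 / 2 - a)) with (- (c * RtoC a) + c * RtoC (1 / 2))
    by (rewrite RtoC_minus; ring).
  rewrite Cexp_plus.
  replace (Cexp (c * RtoC a)) with (/ Cexp (- (c * RtoC a))).
  - field. apply Cexp_neq_0.
  - rewrite Cexp_opp. field. apply Cexp_neq_0.
Qed.

Definition cosh_sum (c : C) (a : R) : C := 2 / c + 4 * c * cosh_ser c a.

Lemma cosh_psum_cv ka (c : C) a : off_poles ka c -> Ccv (fun n => cosh_psum c n a) (cosh_sum c a).
Proof.
  intros H. apply Ccv_plus; [apply Ccv_const|]. apply Ccv_scal. exact (cosh_ser_correct ka c a H).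
Qed.

(** Adding the previous limits for [c] and [- c] eliminates the derivative. *)
Lemma cosh_sum_half ka (c : C) a : off_poles ka c -> c <> 0 -> (0 < a < 1)%R ->
  2 * cosh_sum c a =
  (Cexp (c * RtoC (1 / 2 - a)) + Cexp (- (c * RtoC (1 / 2 - a)))) * cosh_sum c (1 / 2).
Proof.
  intros H Hc Ha.
  assert (L1 := cosh_psum_ode ka c a H Hc Ha).
  assert (Hc' : - c <> 0).
  { intros E. apply Hc. replace c with (- - c) by ring. rewrite E. ring. }
  assert (L2 := cosh_psum_ode ka (- c) a (off_poles_opp ka c H) Hc' Ha).
  set (X := Cexp (c * RtoC (1 / 2 - a))) in *.
  assert (EX : Cexp (- c * RtoC (1 / 2 - a)) = Cexp (- (c * RtoC (1 / 2 - a)))) by (f_equal; ring).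
  rewrite EX in L2. set (Y := Cexp (- (c * RtoC (1 / 2 - a)))) in *.
  assert (L := Ccv_plus _ _ _ _ L1 L2).
  assert (L3 := Ccv_minus _ _ _ _ (Ccv_scal ((X + Y) * c) _ _ (cosh_psum_cv ka c (1 / 2) H))
     (Ccv_scal (2 * c) _ _ (cosh_psum_cv ka c a H))).
  assert (E : (X + Y) * c * cosh_sum c (1 / 2) - 2 * c * cosh_sum c a = 0 + 0).
  { apply (Ccv_unique _ _ _ L3). revert L. apply Ccv_ext. intros n.
    rewrite !(cosh_psum_opp c) by auto.
    assert (Ed : dcosh_psum (- c) n a = - dcosh_psum c n a).
    { unfold dcosh_psum. rewrite (psum_ext (fun k => RtoC (- (freq k * sin (freq k * a))) / coth_den (- c) k)
         (fun k => RtoC (- (freq k * sin (freq k * a))) / coth_den c k)).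
      - ring.
      - intros k _. unfold coth_den. now replace (- c * - c) with (c * c) by ring. }
    rewrite Ed. ring. }
  replace (2 * cosh_sum c a) with (((X + Y) * c * cosh_sum c (1 / 2)
     - ((X + Y) * c * cosh_sum c (1 / 2) - 2 * c * cosh_sum c a)) / c) by (field; auto).
  rewrite E. field. auto.
Qed.

(** Near [a = 0] the series is [c (a^2 - a)] up to a constant and a quadratic error,
    because subtracting the Bernoulli series makes the terms O(k^{-4}). In particular
    its one-sided derivative at 0 is [- c]. *)
Lemma cosh_sum_near_0 ka (c : C) : off_poles ka c -> exists K, forall a, (0 <= a < 1)%R ->
  (Cmod (cosh_sum c a - cosh_sum c 0 - c * RtoC (a ^ 2 - a)) <= K * a ^ 2)%R.
Proof.
  intros H. destruct (ex_series_inv_sq_scal (/ ka)) as [B HB].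
  exists (Cmod (4 * c) * (Cmod (c * c) * B))%R. intros a Ha.
  assert (S1 := Cser_minus _ _ _ _ (cosh_ser_correct ka c a H) (cosh_ser_correct ka c 0%R H)).
  assert (S2 := Cser_minus _ _ _ _ (Cser_cos_sq a Ha) (Cser_cos_sq 0%R ltac:(lra))).
  assert (S3 := Cser_minus _ _ _ _ S1 (Cser_scal (RtoC (/ (4 * PI ^ 2))) _ _ S2)).
  assert (HPI := PI_RGT_0). assert (HP2 : (0 < PI ^ 2)%R) by now apply pow_lt.
  assert (E : cosh_sum c a - cosh_sum c 0 - c * RtoC (a ^ 2 - a) =
     4 * c * (cosh_ser c a - cosh_ser c 0 - RtoC (/ (4 * PI ^ 2)) *
       (RtoC (PI ^ 2 * (a ^ 2 - a + 1 / 6)) - RtoC (PI ^ 2 * (0 ^ 2 - 0 + 1 / 6))))).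
  { rewrite <- RtoC_minus, <- RtoC_mult.
    replace (/ (4 * PI ^ 2) * (PI ^ 2 * (a ^ 2 - a + 1 / 6) - PI ^ 2 * (0 ^ 2 - 0 + 1 / 6)))%R
      with (/ 4 * (a ^ 2 - a))%R by (field; lra).
    unfold cosh_sum. rewrite RtoC_mult, RtoC_inv by lra. generalize (2 / c). intros. field. }
  rewrite E, Cmod_mult, !Rmult_assoc. apply Rmult_le_compat_l; [apply Cmod_ge_0|].
  apply (Cser_le _ _ (fun k => Cmod (c * c) * a ^ 2 * (/ ka * / INR (k + 1) ^ 2))%R _ S3).
  2:{ replace (Cmod (c * c) * (B * a ^ 2))%R with (Cmod (c * c) * a ^ 2 * B)%R by ring.
      apply (is_series_scal (K := R_AbsRing) (V := R_NormedModule)). exact HB. }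
  intros k. assert (N := coth_den_neq_0 ka c k H). assert (HI := INR_S_ge_1 k).
  assert (Hf : (freq k <> 0)%R) by (unfold freq; apply Rgt_not_eq; nra).
  replace (cosh_term c a k - cosh_term c 0 k - _) with
    ((- (c * c)) * RtoC (cos (freq k * a) - 1) * (/ RtoC (freq k ^ 2)) * (/ coth_den c k)).
  2:{ unfold cosh_term. rewrite Rmult_0_r, cos_0, <- !RtoC_minus, <- RtoC_mult.
      replace (/ (4 * PI ^ 2) * (cos (freq k * a) / INR (k + 1) ^ 2 - 1 / INR (k + 1) ^ 2))%R
        with ((cos (freq k * a) - 1) * / freq k ^ 2)%R.
      2:{ unfold freq. field. split; lra. }
      rewrite RtoC_mult, RtoC_inv by now apply pow_nonzero.
      rewrite RtoC_minus.
      replace (c * c) with (coth_den c k - RtoC (freq k ^ 2)) by (unfold coth_den; ring).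
      field. split; auto. apply RtoC_neq_0. now apply pow_nonzero. }
  rewrite !Cmod_mult, Cmod_opp, !Cmod_mult, !Cmod_R, <- RtoC_inv, Cmod_R, Cmod_inv
    by (auto; now apply pow_nonzero).
  assert (F1 := cos_m1_le (freq k * a)).
  assert (Hf2 : (0 < freq k ^ 2)%R) by (apply pow2_gt_0; auto).
  rewrite (Rabs_pos_eq (/ _)) by (left; now apply Rinv_0_lt_compat).
  assert (F2 : (Rabs (cos (freq k * a) - 1) * / freq k ^ 2 <= a ^ 2)%R).
  { apply Rle_div_l; auto. eapply Rle_trans; [exact F1|]. right. ring. }
  assert (F3 : (/ Cmod (coth_den c k) <= / ka * / INR (k + 1) ^ 2)%R).
  { destruct H as [Hka HW]. rewrite <- Rinv_mult. apply Rinv_le_contravar; [|apply HW].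
    apply Rmult_lt_0_compat; auto. apply INR_sq_pos. }
  rewrite !Rmult_assoc. rewrite <- Rmult_assoc. rewrite <- (Rmult_assoc (Cmod c)).
  apply Rmult_le_compat_l; [apply Rmult_le_pos; apply Cmod_ge_0|].
  rewrite <- Rmult_assoc. apply Rmult_le_compat; auto.
  - apply Rmult_le_pos; [apply Rabs_pos | left; now apply Rinv_0_lt_compat].
  - left. now apply Rinv_0_lt_compat, Cmod_gt_0.
Qed.

Lemma Cexp_affine_le (c : C) : exists K, forall a, (0 <= a <= 1)%R ->
  (Cmod (Cexp (c * RtoC a) - 1 - c * RtoC a) <= K * a ^ 2)%R.
Proof.
  exists (Cmod c ^ 2 * exp (Cmod c))%R. intros a Ha.
  assert (E : Cmod (c * RtoC a) = (Cmod c * a)%R) by (rewrite Cmod_mult, Cmod_R, Rabs_pos_eq; lra).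
  assert (H := Cexp_m1_id_le (c * RtoC a)). rewrite E in H.
  eapply Rle_trans; [exact H|]. assert (Hc := Cmod_ge_0 c).
  replace (Cmod c ^ 2 * exp (Cmod c) * a ^ 2)%R with ((Cmod c * a) ^ 2 * exp (Cmod c))%R by ring.
  apply Rmult_le_compat_l; [apply pow2_ge_0 | apply exp_le; nra].
Qed.

Lemma cosh_sum_0_half ka (c : C) : off_poles ka c -> c <> 0 ->
  2 * cosh_sum c 0 = (Cexp (c * RtoC (1 / 2)) + Cexp (- (c * RtoC (1 / 2)))) * cosh_sum c (1 / 2).
Proof.
  intros H Hc. destruct (cosh_sum_near_0 ka c H) as [K HK].
  assert (L1 : Ccv (fun n => 2 * cosh_sum c (/ INR (n + 2))) (2 * cosh_sum c 0)).
  { apply Ccv_scal.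
    assert (L0 : Ccv (fun n => cosh_sum c 0 + c * RtoC ((/ INR (n + 2)) ^ 2 - / INR (n + 2))
        + (cosh_sum c (/ INR (n + 2)) - cosh_sum c 0 - c * RtoC ((/ INR (n + 2)) ^ 2 - / INR (n + 2))))
       (cosh_sum c 0 + c * 0 + 0)).
    { assert (Lsq : is_lim_seq (fun n => (/ INR (n + 2)) ^ 2)%R 0%R).
      { apply is_lim_seq_ext with (fun n => (/ INR (n + 2)) * / INR (n + 2))%R; [intros; ring|].
        replace (Finite 0) with (Finite (0 * 0)) by (f_equal; ring).
        apply is_lim_seq_mult'; apply is_lim_seq_inv_INR2. }
      apply Ccv_plus; [apply Ccv_plus; [apply Ccv_const|]|].
      - apply Ccv_scal. apply Ccv_RtoC.
        replace (Finite 0) with (Finite (0 - 0)) by (f_equal; ring).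
        apply is_lim_seq_minus'; auto. apply is_lim_seq_inv_INR2.
      - apply Ccv_bound with (fun n => K * (/ INR (n + 2)) ^ 2)%R.
        + intros n. assert (R := inv_INR2_range n).
          match goal with |- (Cmod (?x - _) <= _)%R => replace (x - 0) with x by ring end.
          apply HK. lra.
        + now apply is_lim_seq_scal_0. }
    replace (cosh_sum c 0 + c * 0 + 0) with (cosh_sum c 0) in L0 by ring.
    revert L0. apply Ccv_ext. intros n. ring. }
  apply (Ccv_unique _ _ _ L1).
  apply Ccv_ext with (fun n => cosh_sum c (1 / 2) *
    (Cexp (c * RtoC (1 / 2 - / INR (n + 2))) + Cexp (- (c * RtoC (1 / 2 - / INR (n + 2)))))).
  - intros n. assert (R := inv_INR2_range n). rewrite (cosh_sum_half ka c) by (auto; lra). ring.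
  - rewrite (Cmult_comm (_ + _)). apply Ccv_scal.
    assert (L : Ccv (fun n => c * RtoC (1 / 2 - / INR (n + 2))) (c * RtoC (1 / 2))).
    { apply Ccv_scal, Ccv_RtoC.
      replace (Finite (1 / 2)) with (Finite (1 / 2 - 0)) by (f_equal; ring).
      apply is_lim_seq_minus'; [apply is_lim_seq_const | apply is_lim_seq_inv_INR2]. }
    apply Ccv_plus; apply Ccv_Cexp; auto.
    replace (- (c * RtoC (1 / 2))) with ((- (1)) * (c * RtoC (1 / 2))) by ring.
    apply Ccv_ext with (fun n => (- (1)) * (c * RtoC (1 / 2 - / INR (n + 2)))); [intros; ring|].
    now apply Ccv_scal.
Qed.

(** The one-sided derivative at 0 of [cosh (c (1/2 - a))] times the value at [1/2]
    must be [- c], which determines that value as [1 / sinh (c/2)]. *)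
Lemma cosh_sum_half_eq ka (c : C) : off_poles ka c -> c <> 0 ->
  (Cexp (c * RtoC (1 / 2)) - Cexp (- (c * RtoC (1 / 2)))) * cosh_sum c (1 / 2) = 2.
Proof.
  intros H Hc. destruct (cosh_sum_near_0 ka c H) as [K HK].
  set (s := cosh_sum c (1 / 2)). set (X := Cexp (c * RtoC (1 / 2))).
  set (Y := Cexp (- (c * RtoC (1 / 2)))).
  destruct (Cexp_affine_le c) as [K1 H1]. destruct (Cexp_affine_le (- c)) as [K2 H2].
  assert (E : c * (2 - (X - Y) * s) = 0).
  { apply (Cmod_small_eq_0 _ (2 * K + Cmod (2 * c) + Cmod (X * s) * K2 + Cmod (Y * s) * K1)%R).
    intros n. set (a := (/ INR (n + 2))%R). assert (Ha := inv_INR2_range n). fold a in Ha.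
    assert (A0 := HK a ltac:(lra)). assert (A1 := H1 a ltac:(lra)). assert (A2 := H2 a ltac:(lra)).
    assert (Ea := cosh_sum_half ka c a H Hc ltac:(lra)).
    assert (E0 := cosh_sum_0_half ka c H Hc). fold s X Y in Ea, E0.
    replace (Cexp (c * RtoC (1 / 2 - a))) with (X * Cexp (- c * RtoC a)) in Ea.
    2:{ unfold X. rewrite <- Cexp_plus. f_equal. rewrite RtoC_minus. ring. }
    replace (Cexp (- (c * RtoC (1 / 2 - a)))) with (Y * Cexp (c * RtoC a)) in Ea.
    2:{ unfold Y. rewrite <- Cexp_plus. f_equal. rewrite RtoC_minus. ring. }
    set (e0 := cosh_sum c a - cosh_sum c 0 - c * RtoC (a ^ 2 - a)) in *.
    set (e1 := Cexp (c * RtoC a) - 1 - c * RtoC a) in *.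
    set (e2 := Cexp (- c * RtoC a) - 1 - - c * RtoC a) in *.
    (* The linear terms in [a] of the two expressions for the series are compared;
       everything else is quadratic. *)
    assert (I : c * (2 - (X - Y) * s) * RtoC a =
       2 * e0 + (2 * c) * RtoC (a ^ 2) + (- ((X * s) * e2)) + (- ((Y * s) * e1))).
    { unfold e0. replace (2 * (cosh_sum c a - cosh_sum c 0 - c * RtoC (a ^ 2 - a)))
        with (2 * cosh_sum c a - 2 * cosh_sum c 0 - 2 * c * RtoC (a ^ 2 - a)) by ring.
      rewrite Ea, E0, RtoC_minus. unfold e1, e2. ring. }
    replace (Cmod (c * (2 - (X - Y) * s)) * a)%R with (Cmod (c * (2 - (X - Y) * s) * RtoC a)).
    2:{ rewrite Cmod_mult, Cmod_R, Rabs_pos_eq; lra. }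
    rewrite I.
    assert (T1 := Cmod_triangle (2 * e0 + (2 * c) * RtoC (a ^ 2) + (- ((X * s) * e2))) (- ((Y * s) * e1))).
    assert (T2 := Cmod_triangle (2 * e0 + (2 * c) * RtoC (a ^ 2)) (- ((X * s) * e2))).
    assert (T3 := Cmod_triangle (2 * e0) ((2 * c) * RtoC (a ^ 2))).
    rewrite Cmod_opp, (Cmod_mult (Y * s)) in T1. rewrite Cmod_opp, (Cmod_mult (X * s)) in T2.
    rewrite (Cmod_mult 2 e0), (Cmod_mult (2 * c)), !Cmod_R, (Rabs_pos_eq 2), (Rabs_pos_eq (a ^ 2)) in T3
      by (try apply pow2_ge_0; lra).
    assert (U1 : (Cmod (X * s) * Cmod e2 <= Cmod (X * s) * (K2 * a ^ 2))%R)
      by (apply Rmult_le_compat_l; auto; apply Cmod_ge_0).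
    assert (U2 : (Cmod (Y * s) * Cmod e1 <= Cmod (Y * s) * (K1 * a ^ 2))%R)
      by (apply Rmult_le_compat_l; auto; apply Cmod_ge_0).
    rewrite !Rmult_plus_distr_r. lra. }
  replace ((X - Y) * s) with (2 - (c * (2 - (X - Y) * s)) / c) by (field; auto).
  rewrite E. field. auto.
Qed.

(** Fourier expansion of [cosh (c (1/2 - a)) / sinh (c / 2)]; the case [a = 0] is the
    partial fraction expansion of the hyperbolic cotangent of [c/2]. *)
Lemma cosh_fourier ka (c : C) a : off_poles ka c -> c <> 0 -> (0 <= a < 1)%R ->
  (Cexp (c * RtoC (1 / 2)) - Cexp (- (c * RtoC (1 / 2)))) * cosh_sum c a =
  Cexp (c * RtoC (1 / 2 - a)) + Cexp (- (c * RtoC (1 / 2 - a))).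
Proof.
  intros H Hc Ha. set (D := Cexp (c * RtoC (1 / 2)) - Cexp (- (c * RtoC (1 / 2)))).
  assert (HD : D * cosh_sum c (1 / 2) = 2) by exact (cosh_sum_half_eq ka c H Hc).
  assert (E : 2 * cosh_sum c a = (Cexp (c * RtoC (1 / 2 - a)) + Cexp (- (c * RtoC (1 / 2 - a))))
     * cosh_sum c (1 / 2)).
  { destruct (Req_dec a 0) as [->|Ha0].
    - rewrite (cosh_sum_0_half ka c) by auto. now rewrite Rminus_0_r.
    - apply (cosh_sum_half ka c); auto. lra. }
  replace (D * cosh_sum c a) with (D * (2 * cosh_sum c a) / 2) by (field).
  rewrite E. set (Z := Cexp (c * RtoC (1 / 2 - a)) + Cexp (- (c * RtoC (1 / 2 - a)))) in *.
  replace (D * (Z * cosh_sum c (1 / 2)) / 2) with ((D * cosh_sum c (1 / 2)) * Z / 2) by field.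
  rewrite HD. field.
Qed.

(** * The Kronecker double series *)

(** For a complex number with real part [r], imaginary part [i] and modulus [p],
    multiplied by [x] and moved up by [2 pi y], the squared modulus is a quadratic
    form in [x, y] that is definite as soon as [r > 0]. *)
Lemma quadratic_form_ge (r i p x y : R) :
  (0 < p)%R -> (p * p = r * r + i * i)%R -> (0 < r)%R -> (0 <= x)%R -> (0 <= y)%R ->
  ((1 - Rabs i / p) * Rmin (p ^ 2) (4 * PI ^ 2) * (x ^ 2 + y ^ 2) <=
     (x * r) ^ 2 + (x * i + 2 * PI * y) ^ 2)%R.
Proof.
  intros Hp E Hr Hx Hy.
  assert (Hi : (Rabs i < p)%R).
  { apply Rabs_def1; nra. }
  set (ro := (Rabs i / p)%R).
  assert (Hro : (0 <= ro < 1)%R).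
  { split; [apply Rdiv_le_0_compat; [apply Rabs_pos | lra] | apply Rlt_div_l; lra]. }
  assert (Hab : (Rabs i = ro * p)%R) by (unfold ro; field; lra).
  assert (H1 := Rmin_l (p ^ 2) (4 * PI ^ 2)). assert (H2 := Rmin_r (p ^ 2) (4 * PI ^ 2)).
  set (mu := Rmin (p ^ 2) (4 * PI ^ 2)) in *.
  assert (HPI := PI_RGT_0).
  assert (S1 : ((x * r) ^ 2 + (x * i + 2 * PI * y) ^ 2 =
     (x * p) ^ 2 + (2 * PI * y) ^ 2 + 2 * (x * (2 * PI * y)) * i)%R).
  { replace ((x * p) ^ 2)%R with (x * x * (p * p))%R by ring. rewrite E. ring. }
  rewrite S1.
  assert (S2 : (- (ro * p) <= i)%R).
  { rewrite <- Hab. assert (K := Rle_abs (- i)). rewrite Rabs_Ropp in K. lra. }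
  assert (Hxy : (0 <= x * (2 * PI * y))%R) by (apply Rmult_le_pos; nra).
  assert (S3 : (2 * (x * (2 * PI * y)) * (- (ro * p)) <= 2 * (x * (2 * PI * y)) * i)%R)
    by (apply Rmult_le_compat_l; lra).
  assert (S4 : (0 <= ro * (x * p - 2 * PI * y) ^ 2)%R) by (apply Rmult_le_pos; [lra | apply pow2_ge_0]).
  assert (S5 : ((1 - ro) * mu * (x ^ 2 + y ^ 2) <= (1 - ro) * ((x * p) ^ 2 + (2 * PI * y) ^ 2))%R).
  { rewrite Rmult_assoc. apply Rmult_le_compat_l; [lra|].
    assert (A1 : (0 <= x ^ 2)%R) by apply pow2_ge_0. assert (A2 : (0 <= y ^ 2)%R) by apply pow2_ge_0.
    assert (B1 : (mu * x ^ 2 <= p ^ 2 * x ^ 2)%R) by (apply Rmult_le_compat_r; lra).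
    assert (B2 : (mu * y ^ 2 <= 4 * PI ^ 2 * y ^ 2)%R) by (apply Rmult_le_compat_r; lra).
    nra. }
  nra.
Qed.

(** The form factors as [(x t + 2 pi i y) (x t - 2 pi i y)], and both factors have
    modulus at least a multiple of the Euclidean norm of [(x, y)]. *)
Lemma kronecker_den_ge (t : C) : (0 < Re t)%R -> exists ka, (0 < ka)%R /\ forall x y : R,
  (0 <= x)%R -> (0 <= y)%R ->
  (ka * (x ^ 2 + y ^ 2) <= Cmod (RtoC x * t * (RtoC x * t) + RtoC ((2 * PI * y) ^ 2)))%R.
Proof.
  intros Ht. set (p := Cmod t).
  assert (Hp : (0 < p)%R).
  { apply Cmod_gt_0. intros E. rewrite E in Ht. simpl in Ht. lra. }
  assert (E : (p * p = Re t * Re t + Im t * Im t)%R).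
  { assert (K := Cmod2_alt t). fold p in K. lra. }
  assert (E' : (p * p = Re t * Re t + - Im t * - Im t)%R) by lra.
  exists ((1 - Rabs (Im t) / p) * Rmin (p ^ 2) (4 * PI ^ 2))%R.
  assert (HPI := PI_RGT_0).
  assert (Hk : (0 < (1 - Rabs (Im t) / p) * Rmin (p ^ 2) (4 * PI ^ 2))%R).
  { apply Rmult_lt_0_compat; [|apply Rmin_pos; [now apply pow_lt | assert (0 < PI ^ 2)%R by (now apply pow_lt); lra]].
    assert (Rabs (Im t) / p < 1)%R; [|lra]. apply Rlt_div_l; auto. apply Rabs_def1; nra. }
  split; auto. intros x y Hx Hy.
  assert (Q1 := quadratic_form_ge _ _ _ x y Hp E Ht Hx Hy).
  assert (Q2 := quadratic_form_ge _ _ _ x y Hp E' Ht Hx Hy). rewrite Rabs_Ropp in Q2.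
  set (ka := ((1 - Rabs (Im t) / p) * Rmin (p ^ 2) (4 * PI ^ 2))%R) in *.
  set (u := RtoC x * t + Ci * RtoC (2 * PI * y)). set (v := RtoC x * t - Ci * RtoC (2 * PI * y)).
  replace (RtoC x * t * (RtoC x * t) + RtoC ((2 * PI * y) ^ 2)) with (u * v).
  2:{ unfold u, v. replace (RtoC ((2 * PI * y) ^ 2)) with (RtoC (2 * PI * y) * RtoC (2 * PI * y))
        by (rewrite <- RtoC_mult; f_equal; ring).
      assert (EC : Ci * Ci = - (1)) by (apply injective_projections; simpl; ring).
      replace ((RtoC x * t + Ci * RtoC (2 * PI * y)) * (RtoC x * t - Ci * RtoC (2 * PI * y)))
        with (RtoC x * t * (RtoC x * t) - (Ci * Ci) * (RtoC (2 * PI * y) * RtoC (2 * PI * y))) by ring.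
      rewrite EC. ring. }
  rewrite Cmod_mult.
  assert (Mu : (Cmod u ^ 2 = (x * Re t) ^ 2 + (x * Im t + 2 * PI * y) ^ 2)%R).
  { rewrite Cmod2_alt. unfold u, Re, Im. simpl. ring. }
  assert (Mv : (Cmod v ^ 2 = (x * Re t) ^ 2 + (x * - Im t + 2 * PI * y) ^ 2)%R).
  { rewrite Cmod2_alt. unfold v, Re, Im. simpl. ring. }
  assert (Hxy : (0 <= ka * (x ^ 2 + y ^ 2))%R).
  { apply Rmult_le_pos; [lra|]. assert (0 <= x ^ 2)%R by apply pow2_ge_0.
    assert (0 <= y ^ 2)%R by apply pow2_ge_0. lra. }
  rewrite <- Mu in Q1. rewrite <- Mv in Q2.
  apply Rsqr_incr_0_var; [|apply Rmult_le_pos; apply Cmod_ge_0].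
  unfold Rsqr.
  replace (Cmod u * Cmod v * (Cmod u * Cmod v))%R with (Cmod u ^ 2 * Cmod v ^ 2)%R by ring.
  apply Rmult_le_compat; auto.
Qed.

(** Summation by parts against a sequence whose variation telescopes. *)
Lemma abel_bound (b d : nat -> C) (e : nat -> R) M J :
  (forall j, Cmod (psum b j) <= M)%R ->
  (forall j, Cmod (d j) <= e j)%R ->
  (forall j, Cmod (d (S j) - d j) <= e j - e (S j))%R ->
  (Cmod (psum (fun j => (b j * d j)%C) J) <= M * e 0%nat)%R.
Proof.
  intros HM Hd He.
  assert (H0 : (0 <= M)%R) by (eapply Rle_trans; [apply Cmod_ge_0 | apply (HM 0%nat)]).
  assert (E : psum (fun j => b j * d j) J =
     psum b J * d J - psum (fun j => psum b (S j) * (d (S j) - d j)) J).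
  { induction J as [|J IH]; [rewrite !psum_0; ring|].
    rewrite !(psum_S _ J), IH. ring. }
  assert (H1 : (Cmod (psum (fun j => (psum b (S j) * (d (S j) - d j))%C) J) <= M * (e 0%nat - e J))%R).
  { clear E. induction J as [|J IH].
    - rewrite psum_0, Cmod_0. lra.
    - rewrite psum_S. eapply Rle_trans; [apply Cmod_triangle|]. rewrite Cmod_mult.
      assert (K : (Cmod (psum b (S J)) * Cmod (d (S J) - d J) <= M * (e J - e (S J)))%R)
        by (apply Rmult_le_compat; auto; apply Cmod_ge_0).
      lra. }
  rewrite E. eapply Rle_trans; [apply Cmod_triangle|]. rewrite Cmod_opp, Cmod_mult.
  assert (K : (Cmod (psum b J) * Cmod (d J) <= M * e J)%R)
    by (apply Rmult_le_compat; auto; apply Cmod_ge_0).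
  lra.
Qed.

Lemma psum_cos_bounded a : (0 < a < 1)%R -> exists M, (0 < M)%R /\ forall n j,
  (Cmod (psum (fun k => RtoC (cos (freq (n + k) * a))) j) <= M)%R.
Proof.
  intros Ha. assert (Hs := sin_PI_pos a Ha).
  assert (Hi : (0 < / sin (PI * a))%R) by now apply Rinv_0_lt_compat.
  exists (/ sin (PI * a))%R. split; [lra|]. intros n j.
  set (p := psum (fun k => RtoC (cos (freq k * a)))).
  assert (E : psum (fun k => RtoC (cos (freq (n + k) * a))) j = p (n + j)%nat - p n).
  { unfold p. rewrite psum_add. ring. }
  rewrite E.
  assert (E2 : 2 * (p (n + j)%nat - p n) =
     RtoC (sin (INR (2 * (n + j) + 1) * PI * a) / sin (PI * a)) - RtoC (sin (INR (2 * n + 1) * PI * a) / sin (PI * a))).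
  { rewrite <- !psum_cos_dirichlet by lra. fold p. ring. }
  assert (G : forall x, (Cmod (RtoC (sin x / sin (PI * a))) <= / sin (PI * a))%R).
  { intros x. rewrite Cmod_R. unfold Rdiv. rewrite Rabs_mult, (Rabs_pos_eq (/ _)) by lra.
    rewrite <- (Rmult_1_l (/ sin (PI * a))) at 2. apply Rmult_le_compat_r; [lra|].
    apply Rabs_le, SIN_bound. }
  assert (K : (Cmod (2 * (p (n + j)%nat - p n)) <= / sin (PI * a) + / sin (PI * a))%R).
  { rewrite E2. eapply Rle_trans; [apply Cmod_triangle|]. rewrite Cmod_opp.
    apply Rplus_le_compat; apply G. }
  rewrite Cmod_mult, Cmod_R, Rabs_pos_eq in K by lra. lra.
Qed.

(** Away from the integers the partial sums of [cos (2 pi k a)] are bounded, and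
    [1/(x^2 + y^2)] telescopes the variation of the denominators in [y]. This makes
    the tails O(1/(i^2 + n^2)), a gain of one summation over the trivial bound. *)
Lemma cosh_term_tail (t : C) a : (0 < Re t)%R -> (0 < a < 1)%R ->
  exists ka K, (0 <= K)%R /\ forall i, off_poles ka (RtoC (INR (i + 1)) * t) /\
    forall n, (Cmod (cosh_ser (RtoC (INR (i + 1)) * t) a - psum (cosh_term (RtoC (INR (i + 1)) * t) a) n)
      <= K * / (INR (i + 1) ^ 2 + INR (n + 1) ^ 2))%R.
Proof.
  intros Ht Ha. destruct (kronecker_den_ge t Ht) as (ka & Hka & Hden).
  destruct (psum_cos_bounded a Ha) as (M & HM & Hpsum).
  assert (HPI := PI_RGT_0).
  assert (Hq : (0 < (2 * PI) ^ 2 / ka ^ 2)%R) by (apply Rdiv_lt_0_compat; apply pow_lt; lra).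
  assert (Hika : (0 < / ka)%R) by now apply Rinv_0_lt_compat.
  set (Kd := (/ ka + (2 * PI) ^ 2 / ka ^ 2)%R).
  exists ka, (M * Kd)%R. split; [apply Rmult_le_pos; unfold Kd; lra|]. intros i.
  set (x := INR (i + 1)). assert (Hx : (1 <= x)%R) by apply INR_S_ge_1.
  set (c := RtoC x * t).
  assert (Hlow : forall k, (ka * (x ^ 2 + INR (k + 1) ^ 2) <= Cmod (coth_den c k))%R).
  { intros k. unfold coth_den, freq. apply Hden; [lra | apply pos_INR]. }
  assert (Hoff : off_poles ka c).
  { split; auto. intros k. eapply Rle_trans; [|apply Hlow].
    apply Rmult_le_compat_l; [lra|]. assert (0 <= x ^ 2)%R by apply pow2_ge_0. lra. }
  split; auto. intros n.
  assert (Hs := Cser_tail _ _ n (cosh_ser_correct ka c a Hoff)).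
  apply (Ccv_le _ _ _) with (2 := Hs). intros J.
  assert (Hsq : forall k, (0 < x ^ 2 + INR (k + 1) ^ 2)%R).
  { intros k. assert (A1 := INR_sq_pos k). assert (0 <= x ^ 2)%R by apply pow2_ge_0. lra. }
  rewrite (psum_ext _ (fun k => RtoC (cos (freq (n + k) * a)) * / coth_den c (n + k)))
    by (intros; reflexivity).
  set (e := fun j => (Kd * / (x ^ 2 + INR (n + j + 1) ^ 2))%R).
  replace (M * Kd * / (x ^ 2 + INR (n + 1) ^ 2))%R with (M * e 0%nat)%R
    by (unfold e; rewrite Nat.add_0_r; ring).
  apply (abel_bound (fun k => RtoC (cos (freq (n + k) * a))) (fun j => / coth_den c (n + j)) e); auto;
    unfold e.
  - intros j. assert (N := coth_den_neq_0 ka c (n + j) Hoff). rewrite Cmod_inv by auto.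
    apply Rle_trans with (/ ka * / (x ^ 2 + INR (n + j + 1) ^ 2))%R.
    + rewrite <- Rinv_mult. apply Rinv_le_contravar; [|apply Hlow].
      apply Rmult_lt_0_compat; auto.
    + apply Rmult_le_compat_r; [left; now apply Rinv_0_lt_compat | unfold Kd; lra].
  - intros j. assert (N := coth_den_neq_0 ka c (n + j) Hoff).
    assert (N' := coth_den_neq_0 ka c (n + S j) Hoff).
    replace (/ coth_den c (n + S j) - / coth_den c (n + j))
      with ((coth_den c (n + j) - coth_den c (n + S j)) / (coth_den c (n + j) * coth_den c (n + S j)))
      by (field; auto).
    rewrite Cmod_div, Cmod_mult by (apply Cmult_neq_0; auto).
    assert (A1 := Hsq (n + j)%nat). assert (A2 := Hsq (n + S j)%nat).
    assert (L1 := Hlow (n + j)%nat). assert (L2 := Hlow (n + S j)%nat).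
    set (y := INR (n + j + 1)) in *.
    assert (Ey : INR (n + S j + 1) = (y + 1)%R).
    { unfold y. replace (n + S j + 1)%nat with (S (n + j + 1)) by lia. now rewrite S_INR. }
    assert (Hy : (1 <= y)%R) by apply INR_S_ge_1.
    assert (En : Cmod (coth_den c (n + j) - coth_den c (n + S j)) = ((2 * PI) ^ 2 * (2 * y + 1))%R).
    { unfold coth_den, freq. fold y. rewrite Ey.
      replace (c * c + RtoC ((2 * PI * y) ^ 2) - (c * c + RtoC ((2 * PI * (y + 1)) ^ 2)))
        with (- (RtoC ((2 * PI) ^ 2 * (2 * y + 1)))).
      - rewrite Cmod_opp, Cmod_R. apply Rabs_pos_eq. apply Rmult_le_pos; [apply pow2_ge_0 | lra].
      - replace ((2 * PI * (y + 1)) ^ 2)%R with ((2 * PI * y) ^ 2 + (2 * PI) ^ 2 * (2 * y + 1))%R by ring.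
        rewrite RtoC_plus. ring. }
    rewrite En. rewrite Ey in *.
    apply Rle_trans with ((2 * PI) ^ 2 * (2 * y + 1) / ((ka * (x ^ 2 + y ^ 2)) * (ka * (x ^ 2 + (y + 1) ^ 2))))%R.
    + unfold Rdiv. apply Rmult_le_compat_l; [apply Rmult_le_pos; [apply pow2_ge_0 | lra]|].
      apply Rinv_le_contravar; [repeat apply Rmult_lt_0_compat; auto|].
      apply Rmult_le_compat; auto; apply Rmult_le_pos; lra.
    + assert (E : ((2 * PI) ^ 2 * (2 * y + 1) / ((ka * (x ^ 2 + y ^ 2)) * (ka * (x ^ 2 + (y + 1) ^ 2)))
        = (2 * PI) ^ 2 / ka ^ 2 * (/ (x ^ 2 + y ^ 2) - / (x ^ 2 + (y + 1) ^ 2)))%R) by (field; lra).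
      rewrite E, <- Rmult_minus_distr_l. apply Rmult_le_compat_r; [|unfold Kd; lra].
      assert (/ (x ^ 2 + (y + 1) ^ 2) <= / (x ^ 2 + y ^ 2))%R by (apply Rinv_le_contravar; nra). lra.
Qed.

Lemma is_series_telescope n :
  is_series (fun i => / (INR (n + i + 1) * INR (n + i + 2)))%R (/ INR (n + 1))%R.
Proof.
  assert (E : forall N, (/ INR (n + 1) - / INR (n + N + 2))%R
     = sum_n (fun i => / (INR (n + i + 1) * INR (n + i + 2)))%R N).
  { assert (Hn := pos_INR n). induction N as [|N IH].
    - rewrite sum_O. rewrite Nat.add_0_r, !plus_INR. simpl. field. lra.
    - rewrite sum_Sn, <- IH.
      change (/ INR (n + 1) - / INR (n + S N + 2) = (/ INR (n + 1) - / INR (n + N + 2))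
        + / (INR (n + S N + 1) * INR (n + S N + 2)))%R.
      assert (H := pos_INR N).
      rewrite !plus_INR, !S_INR. simpl. field. lra. }
  change (is_lim_seq (sum_n (fun i => / (INR (n + i + 1) * INR (n + i + 2)))%R) (/ INR (n + 1))%R).
  apply is_lim_seq_ext with (1 := E).
  replace (Finite (/ INR (n + 1))) with (Finite (/ INR (n + 1) - 0)) by (f_equal; ring).
  apply is_lim_seq_minus'; [apply is_lim_seq_const|].
  apply is_lim_seq_ext with (fun N => / INR ((N + (n + 1)) + 1))%R.
  { intros N. do 2 f_equal. lia. }
  apply (is_lim_seq_incr_n (fun N => / INR (N + 1))%R (n + 1)), is_lim_seq_inv_INR.
Qed.

(** Interchange of the order of summation when the inner tails are O(1/(i^2 + n^2)),
    although the double series itself is only conditionally convergent: the tails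
    summed over [i] are O(1/n). *)
Lemma Cser_exchange (u : nat -> nat -> C) (X Y : nat -> C) s K :
  (forall k, Cser (fun i => u i k) (Y k)) ->
  (forall i n, (Cmod (X i - psum (u i) n) <= K * / (INR (i + 1) ^ 2 + INR (n + 1) ^ 2))%R) ->
  (0 <= K)%R -> Cser X s -> Cser Y s.
Proof.
  intros HY HX HK Hs.
  apply Ccv_bound with (fun n => 2 * K * / INR (n + 1))%R.
  2:{ apply is_lim_seq_scal_0, is_lim_seq_inv_INR. }
  intros n.
  assert (H1 := Cser_psum (fun k i => u i k) Y n (fun k _ => HY k)).
  assert (H2 := Cser_minus _ _ _ _ Hs H1).
  replace (psum Y n - s) with (- (s - psum Y n)) by ring. rewrite Cmod_opp.
  apply (Cser_le _ _ (fun i => 2 * K * / (INR (n + i + 1) * INR (n + i + 2)))%R _ H2).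
  - intros i. eapply Rle_trans; [apply HX|].
    rewrite (Rmult_comm 2 K), Rmult_assoc. apply Rmult_le_compat_l; auto.
    rewrite !plus_INR. simpl INR. assert (A := pos_INR i). assert (B := pos_INR n).
    set (p := INR i) in *. set (q := INR n) in *.
    replace (2 * / ((q + p + 1) * (q + p + (1 + 1))))%R
      with (/ ((q + p + 1) * (q + p + (1 + 1)) / 2))%R by (field; lra).
    apply Rinv_le_contravar; [apply Rdiv_lt_0_compat; [apply Rmult_lt_0_compat; lra | lra]|].
    assert (Z : (0 <= (p - q) ^ 2)%R) by apply pow2_ge_0. lra.
  - apply (is_series_scal (K := R_AbsRing) (V := R_NormedModule)). apply is_series_telescope.
Qed.

(** * The transformation formula for the generalized eta product *)

(** Summed over [i], this is the logarithm of [prod_k 1 / ((1 - q^{k+a}) (1 -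
    q^{k+1-a}))] for [q = e^{-t}]. *)
Definition theta_term (a : R) (t : C) (i : nat) : C :=
  (Cexp (- (RtoC (INR (i + 1) * a) * t)) + Cexp (- (RtoC (INR (i + 1) * (1 - a)) * t)))
  / (RtoC (INR (i + 1)) * (1 - Cexp (- (RtoC (INR (i + 1)) * t)))).

Lemma Re_pos_neq_0 (t : C) : (0 < Re t)%R -> t <> 0.
Proof. intros H E. rewrite E in H. simpl in H. lra. Qed.

Lemma Re_scal_pos x (t : C) : (0 < x)%R -> (0 < Re t)%R -> (0 < Re (RtoC x * t))%R.
Proof. intros Hx Ht. unfold Re in *. simpl. nra. Qed.

Lemma C1m_Cexp_opp_neq_0 (c : C) : (0 < Re c)%R -> 1 - Cexp (- c) <> 0.
Proof.
  intros H. apply C1m_neq_0. rewrite Cmod_Cexp. apply exp_lt_1. unfold Re in *. simpl. lra.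
Qed.

Lemma cosh_sum_exp ka (c : C) a : off_poles ka c -> (0 < Re c)%R -> (0 <= a < 1)%R ->
  cosh_sum c a = (Cexp (- (c * RtoC a)) + Cexp (- (c * RtoC (1 - a)))) / (1 - Cexp (- c)).
Proof.
  intros H Hc Ha. assert (N := C1m_Cexp_opp_neq_0 c Hc).
  assert (E := cosh_fourier ka c a H (Re_pos_neq_0 c Hc) Ha).
  set (h := Cexp (- (c * RtoC (1 / 2)))).
  assert (E1 : h * Cexp (c * RtoC (1 / 2)) = 1).
  { unfold h. rewrite <- Cexp_plus, <- Cexp_0. f_equal. ring. }
  assert (E2 : h * h = Cexp (- c)).
  { unfold h. rewrite <- Cexp_plus. f_equal.
    replace (c) with (c * (RtoC (1 / 2) + RtoC (1 / 2))) at 3.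
    - ring.
    - rewrite <- RtoC_plus. replace (1 / 2 + 1 / 2)%R with 1%R by field. ring. }
  assert (E3 : h * Cexp (c * RtoC (1 / 2 - a)) = Cexp (- (c * RtoC a))).
  { unfold h. rewrite <- Cexp_plus. f_equal. rewrite RtoC_minus. ring. }
  assert (E4 : h * Cexp (- (c * RtoC (1 / 2 - a))) = Cexp (- (c * RtoC (1 - a)))).
  { unfold h. rewrite <- Cexp_plus. f_equal.
    replace (1 - a)%R with (1 / 2 + (1 / 2 - a))%R by field. rewrite RtoC_plus. ring. }
  rewrite <- E3, <- E4, <- Cmult_plus_distr_l, <- E. rewrite <- E2 in *. fold h.
  replace (h * ((Cexp (c * RtoC (1 / 2)) - h) * cosh_sum c a))
    with ((h * Cexp (c * RtoC (1 / 2)) - h * h) * cosh_sum c a) by ring.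
  rewrite E1. field. auto.
Qed.

(** Transformation of the logarithm of a generalized eta product. By [cosh_sum_exp]
    each term is a series over [k]; summing over [i] first gives the same kind of
    series with [t] replaced by [4 pi^2 / t] and [a] by 0, that is a hyperbolic
    cotangent, whose expansion [1 + 2 e^{-c} / (1 - e^{-c})] yields the logarithm of
    the sine and the dual series. The terms with a power of [t] come from the
    Bernoulli series at 0 and at [a]. *)
Theorem theta_log (a : R) (t B : C) : (0 < a < 1)%R -> (0 < Re t)%R ->
  Cser (fun k => RtoC (cos (freq k * a)) * lambert_term (INR k + 1) (- (RtoC (4 * PI ^ 2) / t))) B ->
  Cser (theta_term a t)
    (RtoC (PI ^ 2 / 3) / t - RtoC (ln (2 * sin (PI * a))) - t * RtoC (1 / 2 * (a ^ 2 - a + 1 / 6)) + 2 * B).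
Proof.
  intros Ha Ht HB. assert (HPI := PI_RGT_0). assert (HP2 : (0 < PI ^ 2)%R) by now apply pow_lt.
  assert (Ht0 := Re_pos_neq_0 t Ht).
  set (t' := RtoC (4 * PI ^ 2) / t) in *.
  assert (Ht' : (0 < Re t')%R).
  { unfold t', Cdiv. apply Re_scal_pos; [lra|].
    assert (K : (0 < Re t * Re t + Im t * Im t)%R) by nra.
    unfold Cinv, Re, Im in *. simpl. apply Rdiv_lt_0_compat; [exact Ht|]. lra. }
  assert (Ht0' := Re_pos_neq_0 t' Ht').
  destruct (cosh_term_tail t a Ht Ha) as (ka & K & HK & Htail).
  destruct (kronecker_den_ge t' Ht') as (ka' & Hka' & Hden').
  assert (Hoff' : forall k, off_poles ka' (RtoC (INR (k + 1)) * t')).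
  { intros k. split; auto. intros i. unfold coth_den, freq.
    eapply Rle_trans; [|apply Hden'; apply pos_INR].
    apply Rmult_le_compat_l; [lra|]. assert (H := INR_sq_pos k). lra. }
  set (c := fun i => RtoC (INR (i + 1)) * t). set (c' := fun k => RtoC (INR (k + 1)) * t').
  assert (HI : forall i, (0 < INR (i + 1))%R) by (intros i; assert (Q := INR_S_ge_1 i); lra).
  assert (HCI : forall i, RtoC (INR (i + 1)) <> 0) by (intros; apply INR_S_neq_0).
  (* [Y k] is the sum over [i] of the k-th terms: up to the factor [4 pi^2 / t^2] the
     denominators for [(t, i, k)] and for [(4 pi^2 / t, k, i)] coincide. *)
  set (Y := fun k => RtoC (cos (freq k * a)) * (RtoC (4 * PI ^ 2) / (t * t) * cosh_ser (c' k) 0)).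
  assert (HY : forall k, Cser (fun i => cosh_term (c i) a k) (Y k)).
  { intros k. unfold Y. apply Cser_ext with
      (fun i => RtoC (cos (freq k * a)) * (RtoC (4 * PI ^ 2) / (t * t) * cosh_term (c' k) 0 i)).
    2:{ apply Cser_scal, Cser_scal, (cosh_ser_correct ka'), Hoff'. }
    intros i. unfold cosh_term. rewrite Rmult_0_r, cos_0.
    destruct (Htail i) as [Hoff _]. assert (N := coth_den_neq_0 _ _ k Hoff).
    assert (N' := coth_den_neq_0 _ _ i (Hoff' k)). fold (c i) in N. fold (c' k) in N'.
    assert (E : coth_den (c i) k = t * t / RtoC (4 * PI ^ 2) * coth_den (c' k) i).
    { unfold coth_den, c, c', t', freq.
      replace ((2 * PI * INR (k + 1)) ^ 2)%R with (4 * PI ^ 2 * (INR (k + 1) * INR (k + 1)))%R by ring.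
      replace ((2 * PI * INR (i + 1)) ^ 2)%R with (4 * PI ^ 2 * (INR (i + 1) * INR (i + 1)))%R by ring.
      rewrite !RtoC_mult. field. repeat split; auto; apply RtoC_neq_0; lra. }
    rewrite E. field. repeat split; auto. apply RtoC_neq_0; lra. }
  destruct (Cser_abs (fun i => cosh_ser (c i) a) (fun i => K * / INR (i + 1) ^ 2)%R) as [s Hs].
  { intros i. destruct (Htail i) as [_ H]. specialize (H 0%nat). rewrite psum_0 in H.
    replace (cosh_ser (RtoC (INR (i + 1)) * t) a - 0) with (cosh_ser (c i) a) in H by (unfold c; ring).
    eapply Rle_trans; [exact H|]. apply Rmult_le_compat_l; auto.
    apply Rinv_le_contravar; [apply INR_sq_pos|]. simpl INR. lra. }
  { apply ex_series_inv_sq_scal. }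
  assert (HsY : Cser Y s).
  { apply (Cser_exchange (fun i k => cosh_term (c i) a k) (fun i => cosh_ser (c i) a) Y s K); auto.
    intros i n. apply Htail. }
  assert (HA : Cser (theta_term a t) (2 / t * RtoC (PI ^ 2 * (0 ^ 2 - 0 + 1 / 6)) + 4 * t * s)).
  { assert (H0 := Cser_plus _ _ _ _ (Cser_scal (2 / t) _ _ (Cser_cos_sq 0 ltac:(lra))) (Cser_scal (4 * t) _ _ Hs)).
    revert H0. apply Cser_ext. intros i. destruct (Htail i) as [Hoff _].
    assert (Hci : (0 < Re (c i))%R) by (apply Re_scal_pos; auto).
    assert (E := cosh_sum_exp ka (c i) a Hoff Hci ltac:(lra)).
    assert (Nc : 1 - Cexp (- c i) <> 0) by now apply C1m_Cexp_opp_neq_0.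
    replace (theta_term a t i) with (cosh_sum (c i) a / RtoC (INR (i + 1))).
    - unfold cosh_sum, c. rewrite Rmult_0_r, cos_0, RtoC_div by (apply pow_nonzero; apply Rgt_not_eq, HI).
      rewrite RtoC_pow. field. repeat split; auto.
    - rewrite E. unfold theta_term.
      replace (RtoC (INR (i + 1) * a) * t) with (c i * RtoC a) by (unfold c; rewrite RtoC_mult; ring).
      replace (RtoC (INR (i + 1) * (1 - a)) * t) with (c i * RtoC (1 - a))
        by (unfold c; rewrite RtoC_mult; ring).
      fold (c i). field. auto. }
  assert (HY2 : Cser (fun k => 4 * t * Y k)
     (RtoC (- ln (2 * sin (PI * a))) + 2 * B - t * RtoC (/ (2 * PI ^ 2)) * RtoC (PI ^ 2 * (a ^ 2 - a + 1 / 6)))).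
  { assert (H0 := Cser_minus _ _ _ _ (Cser_plus _ _ _ _ (Cser_cos_log a Ha) (Cser_scal 2 _ _ HB))
        (Cser_scal (t * RtoC (/ (2 * PI ^ 2))) _ _ (Cser_cos_sq a ltac:(lra)))).
    revert H0. apply Cser_ext. intros k.
    assert (Hck : (0 < Re (c' k))%R) by (apply Re_scal_pos; auto).
    assert (E := cosh_sum_exp ka' (c' k) 0 (Hoff' k) Hck ltac:(lra)).
    assert (Nc : 1 - Cexp (- c' k) <> 0) by now apply C1m_Cexp_opp_neq_0.
    unfold Y, lambert_term.
    replace (RtoC (INR k + 1) * - t') with (- c' k)
      by (unfold c'; rewrite plus_INR; simpl INR; ring).
    replace (INR k + 1)%R with (INR (k + 1)) by (rewrite plus_INR; reflexivity).
    replace (c' k * RtoC 0) with (RtoC 0) in E by ring.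
    replace (c' k * RtoC (1 - 0)) with (c' k) in E by (rewrite Rminus_0_r; ring).
    replace (- RtoC 0) with (RtoC 0) in E by ring. rewrite Cexp_0 in E.
    set (e := Cexp (- c' k)) in *.
    assert (Es : cosh_ser (c' k) 0 = ((1 + e) / (1 - e) - 2 / c' k) / (4 * c' k)).
    { rewrite <- E. unfold cosh_sum. field. now apply Re_pos_neq_0. }
    rewrite Es. unfold c', t'.
    rewrite !RtoC_div by (try apply pow_nonzero; apply Rgt_not_eq, HI).
    rewrite RtoC_inv by lra. rewrite RtoC_pow, !RtoC_mult.
    field. repeat split; auto; apply RtoC_neq_0; try lra; try (apply pow_nonzero; lra). }
  assert (E := Cser_unique _ _ _ (Cser_scal (4 * t) _ _ HsY) HY2).
  rewrite E in HA.
  match goal with |- Cser _ ?S => match type of HA with Cser _ ?S' => replace S with S'; auto end end.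
  rewrite RtoC_opp.
  replace (PI ^ 2 * (0 ^ 2 - 0 + 1 / 6))%R with (PI ^ 2 / 3 * / 2)%R by field.
  rewrite (RtoC_mult (PI ^ 2 / 3)), RtoC_inv by lra.
  rewrite <- (Cmult_assoc t), <- RtoC_mult.
  replace (/ (2 * PI ^ 2) * (PI ^ 2 * (a ^ 2 - a + 1 / 6)))%R with (1 / 2 * (a ^ 2 - a + 1 / 6))%R
    by (field; lra).
  field. auto.
Qed.

(** * The transformation of P *)

Lemma Ccv_mult u v a b : Ccv u a -> Ccv v b -> Ccv (fun n => u n * v n) (a * b).
Proof.
  intros Hu Hv.
  apply Ccv_bound with (fun n => Cmod (u n - a) * Cmod (v n - b) + (Cmod (u n - a) * Cmod b + Cmod a * Cmod (v n - b)))%R.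
  - intros n. replace (u n * v n - a * b)
      with ((u n - a) * (v n - b) + ((u n - a) * b + a * (v n - b))) by ring.
    eapply Rle_trans; [apply Cmod_triangle|]. rewrite Cmod_mult. apply Rplus_le_compat_l.
    eapply Rle_trans; [apply Cmod_triangle|]. rewrite !Cmod_mult. lra.
  - replace (Finite 0) with (Finite (0 * 0 + (0 * Cmod b + Cmod a * 0))) by (f_equal; ring).
    apply is_lim_seq_plus'; [now apply is_lim_seq_mult'|].
    apply is_lim_seq_plus'; apply is_lim_seq_mult'; auto; apply is_lim_seq_const.
Qed.

(** The derivative at 0 of [1 - e^{- a c}] along the null sequence that stands for [a
    -> 0]. *)
Lemma Cexp_small_quotient (c : C) :
  Ccv (fun n => (1 - Cexp (- (RtoC (/ INR (n + 2)) * c))) / RtoC (/ INR (n + 2))) c.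
Proof.
  destruct (Cexp_affine_le (- c)) as [K HK].
  apply Ccv_bound with (fun n => K * / INR (n + 2))%R.
  2:{ apply is_lim_seq_scal_0, is_lim_seq_inv_INR2. }
  intros n. assert (Ha := inv_INR2_range n). set (a := (/ INR (n + 2))%R) in *.
  assert (Na : RtoC a <> 0) by (apply RtoC_neq_0; lra).
  specialize (HK a ltac:(lra)).
  replace ((1 - Cexp (- (RtoC a * c))) / RtoC a - c)
    with (- ((Cexp (- c * RtoC a) - 1 - - c * RtoC a) / RtoC a)).
  2:{ replace (- c * RtoC a) with (- (RtoC a * c)) by ring. field. auto. }
  rewrite Cmod_opp, Cmod_div, Cmod_R, Rabs_pos_eq by (auto; lra).
  apply (proj2 (Rle_div_l _ _ a (proj1 Ha))). eapply Rle_trans; [exact HK|]. right. ring.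
Qed.

Lemma sin_small_quotient :
  Ccv (fun n => RtoC (sin (PI * / INR (n + 2)) / (/ INR (n + 2)))) (RtoC PI).
Proof.
  destruct (Cexp_affine_le (Ci * RtoC PI)) as [K HK].
  apply Ccv_bound with (fun n => K * / INR (n + 2))%R.
  2:{ apply is_lim_seq_scal_0, is_lim_seq_inv_INR2. }
  intros n. assert (Ha := inv_INR2_range n). set (a := (/ INR (n + 2))%R) in *.
  specialize (HK a ltac:(lra)).
  rewrite <- RtoC_minus, Cmod_R.
  replace (sin (PI * a) / a - PI)%R with ((sin (PI * a) - PI * a) / a)%R by (field; lra).
  unfold Rdiv. rewrite Rabs_mult, Rabs_inv, (Rabs_pos_eq a) by lra.
  apply (proj2 (Rle_div_l _ _ a (proj1 Ha))).
  apply Rle_trans with (K * a ^ 2)%R; [|right; ring].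
  eapply Rle_trans; [|exact HK].
  replace (sin (PI * a) - PI * a)%R with (Im (Cexp (Ci * RtoC PI * RtoC a) - 1 - Ci * RtoC PI * RtoC a)).
  - apply Im_le_Cmod.
  - unfold Cexp, Ci, Re, Im; simpl.
    replace ((0 * PI - 1 * 0) * a - (0 * 0 + 1 * PI) * 0)%R with 0%R by ring.
    replace ((0 * PI - 1 * 0) * 0 + (0 * 0 + 1 * PI) * a)%R with (PI * a)%R by ring.
    rewrite exp_0. ring.
Qed.

(** After removal of the terms [e^{-iat} / i], whose sum is logarithmic in [a], the
    series is dominated uniformly for [a <= 1/2]. *)
Lemma theta_remainder_cv (t : C) (R : nat -> C) : (0 < Re t)%R ->
  (forall n, Cser (fun i => (Cexp (- (RtoC (INR (i + 1) * / INR (n + 2)) * t)) * Cexp (- (RtoC (INR (i + 1)) * t))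
      + Cexp (- (RtoC (INR (i + 1) * (1 - / INR (n + 2))) * t)))
      / (RtoC (INR (i + 1)) * (1 - Cexp (- (RtoC (INR (i + 1)) * t))))) (R n)) ->
  Ccv R (2 * lambert 1 (- t)).
Proof.
  intros Ht HR. set (x := Re t) in *.
  assert (Hxt : (Re (- t) <= - x)%R) by (unfold x, Re; simpl; lra).
  assert (Hk := one_m_exp_pos 1 x Ht ltac:(lra)). set (k0 := (1 - exp (- (1 * x)))%R) in *.
  apply (tannery _ (fun i => 2 * lambert_term (INR i + 1) (- t))
          (fun i => 2 / k0 * exp (- (x / 2)) * exp (- (x / 2)) ^ i)%R R) with (4 := HR).
  - intros i. set (y := INR (i + 1)).
    assert (Hl : is_lim_seq (fun n => y * / INR (n + 2))%R 0%R).
    { apply is_lim_seq_scal_0, is_lim_seq_inv_INR2. }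
    assert (L1 : Ccv (fun n => Cexp ((- t) * RtoC (y * / INR (n + 2)))) (Cexp ((- t) * RtoC 0))).
    { now apply Ccv_Cexp, Ccv_scal, Ccv_RtoC. }
    assert (L2 : Ccv (fun n => Cexp ((- t) * RtoC (y - y * / INR (n + 2)))) (Cexp ((- t) * RtoC (y - 0)))).
    { apply Ccv_Cexp, Ccv_scal, Ccv_RtoC. apply is_lim_seq_minus'; auto. apply is_lim_seq_const. }
    assert (L3 := Ccv_scal (/ (RtoC y * (1 - Cexp (- (RtoC y * t))))) _ _
      (Ccv_plus _ _ _ _ (Ccv_scal (Cexp (- (RtoC y * t))) _ _ L1) L2)).
    unfold lambert_term. replace (INR i + 1)%R with y by (unfold y; rewrite plus_INR; reflexivity).
    replace (2 * (Cexp (RtoC y * - t) / (RtoC y * (1 - Cexp (RtoC y * - t))))) with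
      (/ (RtoC y * (1 - Cexp (- (RtoC y * t)))) *
        (Cexp (- (RtoC y * t)) * Cexp (- t * RtoC 0) + Cexp (- t * RtoC (y - 0)))).
    + revert L3. apply Ccv_ext. intros n. unfold Cdiv. rewrite Cmult_comm. f_equal.
      rewrite (Cmult_comm (Cexp (- (RtoC y * t)))). f_equal; [f_equal; f_equal; ring|].
      f_equal. replace (y * (1 - / INR (n + 2)))%R with (y - y * / INR (n + 2))%R by ring. ring.
    + rewrite Rminus_0_r. replace (- t * RtoC 0) with (RtoC 0) by ring.
      replace (- t * RtoC y) with (- (RtoC y * t)) by ring.
      replace (RtoC y * - t) with (- (RtoC y * t)) by ring. rewrite Cexp_0. unfold Cdiv. ring.
  - intros n i. assert (Ha := inv_INR2_range n). set (a := (/ INR (n + 2))%R) in *.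
    assert (Hy := INR_S_ge_1 i). set (y := INR (i + 1)) in *.
    assert (Hre : forall r, Cmod (Cexp (- (RtoC r * t))) = exp (- (r * x))).
    { intros r. rewrite Cmod_Cexp. f_equal. unfold x, Re. simpl. ring. }
    assert (Hden : (k0 <= Cmod (1 - Cexp (- (RtoC y * t))))%R).
    { replace (- (RtoC y * t)) with (RtoC (INR i + 1) * - t)
        by (unfold y; rewrite plus_INR; simpl INR; ring).
      apply (Cmod_1m_Cexp_ge 1 x); auto. lra. }
    assert (Nd : 1 - Cexp (- (RtoC y * t)) <> 0) by (apply Cmod_gt_0; lra).
    assert (Ny : RtoC y <> 0) by (apply RtoC_neq_0; lra).
    rewrite Cmod_div by (apply Cmult_neq_0; auto). rewrite Cmod_mult, Cmod_R, (Rabs_pos_eq y) by lra.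
    replace (2 / k0 * exp (- (x / 2)) * exp (- (x / 2)) ^ i)%R with (2 * exp (- (x / 2)) ^ (i + 1) * / k0)%R
      by (rewrite Nat.add_1_r; simpl; unfold Rdiv; ring).
    unfold Rdiv. apply Rmult_le_compat.
    + apply Cmod_ge_0.
    + left. apply Rinv_0_lt_compat. apply Rmult_lt_0_compat; lra.
    + rewrite <- exp_INR_mult. fold y.
      eapply Rle_trans; [apply Cmod_triangle|]. rewrite Cmod_mult, !Hre, <- exp_plus.
      assert (exp (- (y * a * x) + - (y * x)) <= exp (y * - (x / 2)))%R.
      { apply exp_le. assert (0 <= y * a * x)%R by (repeat apply Rmult_le_pos; lra). nra. }
      assert (exp (- (y * (1 - a) * x)) <= exp (y * - (x / 2)))%R.
      { apply exp_le. assert (0 <= y * x * (1 / 2 - a))%R by (repeat apply Rmult_le_pos; lra). nra. }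
      lra.
    + apply Rinv_le_contravar; auto. rewrite <- (Rmult_1_l k0). apply Rmult_le_compat; lra.
  - eexists. apply is_series_geom_scal. apply exp_geom_range. lra.
  - apply Cser_scal, lambert_ser; [lra|]. unfold x in *. lra.
Qed.

Lemma Re_inv_pos (t : C) : (0 < Re t)%R -> (0 < Re (RtoC (4 * PI ^ 2) / t))%R.
Proof.
  intros Ht. assert (HPI := PI_RGT_0). assert (HP2 : (0 < PI ^ 2)%R) by now apply pow_lt.
  unfold Cdiv. apply Re_scal_pos; [lra|].
  assert (K : (0 < Re t * Re t + Im t * Im t)%R) by nra.
  unfold Cinv, Re, Im in *. simpl. apply Rdiv_lt_0_compat; [exact Ht|]. lra.
Qed.

(** The limit [a -> 0] of the formula for the generalized product gives the square of
    the formula for P: the factor [1 - e^{-at}] vanishes to the same order as [sin (pi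
    a)]. *)
Lemma eta_squared (t : C) : (0 < Re t)%R ->
  RtoC (2 * PI) * Cexp (2 * lambert 1 (- t)) =
  t * Cexp (RtoC (PI ^ 2 / 3) / t - t * RtoC (1 / 12) + 2 * lambert 1 (- (RtoC (4 * PI ^ 2) / t))).
Proof.
  intros Ht. set (t' := RtoC (4 * PI ^ 2) / t).
  assert (Ht' : (0 < Re t')%R) by now apply Re_inv_pos.
  assert (Hw : (Re (- t') < 0)%R) by (change (- Re t' < 0)%R; lra).
  set (w := - t') in *. set (a := fun n => (/ INR (n + 2))%R).
  assert (Ha : forall n, (0 < a n <= 1 / 2)%R) by apply inv_INR2_range.
  set (bt := fun n k => RtoC (cos (freq k * a n)) * lambert_term (INR k + 1) w).
  assert (Hbt : forall n k, (Cmod (bt n k) <= / (1 * (1 - exp (- (1 * (- Re w))))) * exp (- (- Re w)) ^ k)%R).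
  { intros n k. unfold bt. rewrite Cmod_mult, Cmod_R, <- Rmult_1_l.
    apply Rmult_le_compat; [apply Rabs_pos | apply Cmod_ge_0 | apply Rabs_le, COS_bound |].
    apply lambert_term_le; lra. }
  assert (Hgeo : ex_series (fun k => / (1 * (1 - exp (- (1 * (- Re w))))) * exp (- (- Re w)) ^ k)%R).
  { eexists. apply is_series_geom_scal, exp_geom_range. lra. }
  set (B := fun n => CSeries (bt n)).
  assert (HB : forall n, Cser (bt n) (B n)).
  { intros n. exact (Cser_abs_CSeries _ _ (Hbt n) Hgeo). }
  assert (LB : Ccv B (lambert 1 w)).
  { apply (tannery bt (fun k => lambert_term (INR k + 1) w) _ B) with (2 := Hbt); auto.
    - intros k. apply Ccv_ext with (fun n => lambert_term (INR k + 1) w * RtoC (cos (freq k * a n))).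
      + intros n. unfold bt. ring.
      + assert (L := Ccv_scal (lambert_term (INR k + 1) w) _ _ (Ccv_cos (freq k) a 0 is_lim_seq_inv_INR2)).
        rewrite Rmult_0_r, cos_0, Cmult_1_r in L. exact L.
    - apply lambert_ser; auto. lra. }
  set (Th := fun n => RtoC (PI ^ 2 / 3) / t - RtoC (ln (2 * sin (PI * a n)))
      - t * RtoC (1 / 2 * (a n ^ 2 - a n + 1 / 6)) + 2 * B n).
  assert (HTh : forall n, Cser (theta_term (a n) t) (Th n)).
  { intros n. specialize (Ha n). apply theta_log; auto; [lra|]. apply HB. }
  set (z := fun n => Cexp (- (RtoC (a n) * t))).
  assert (Hz : forall n, (Cmod (z n) < 1)%R).
  { intros n. unfold z. rewrite Cmod_Cexp. apply exp_lt_1.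
    assert (K := Re_scal_pos (a n) t (proj1 (Ha n)) Ht). unfold Re in *. simpl in *. lra. }
  (* [1 / (1 - e^{-xt}) = 1 + e^{-xt} / (1 - e^{-xt})] isolates the Mercator series of
     [e^{-at}]. *)
  assert (LR : Ccv (fun n => Th n - mlog (z n)) (2 * lambert 1 (- t))).
  { apply theta_remainder_cv; auto. intros n. fold (a n).
    assert (H0 := Cser_minus _ _ _ _ (HTh n) (mlog_ser _ (Hz n))).
    revert H0. apply Cser_ext. intros i. unfold theta_term.
    assert (Hi : (0 < INR (i + 1))%R) by (assert (Q := INR_S_ge_1 i); lra).
    assert (N := C1m_Cexp_opp_neq_0 (RtoC (INR (i + 1)) * t) (Re_scal_pos _ _ Hi Ht)).
    assert (E : z n ^ (i + 1) = Cexp (- (RtoC (INR (i + 1) * a n) * t))).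
    { unfold z. rewrite Cexp_pow. f_equal. rewrite RtoC_mult. ring. }
    rewrite E. field. split; auto. apply INR_S_neq_0. }
  apply Ccv_Cexp in LR.
  assert (L1 := Ccv_mult _ _ _ _ (Ccv_scal 2 _ _ sin_small_quotient) LR).
  assert (L2 : Ccv (fun n => RtoC (PI ^ 2 / 3) / t - t * RtoC (1 / 2 * (a n ^ 2 - a n + 1 / 6)) + 2 * B n)
     (RtoC (PI ^ 2 / 3) / t - t * RtoC (1 / 12) + 2 * lambert 1 w)).
  { apply Ccv_plus; [|now apply Ccv_scal]. apply Ccv_minus; [apply Ccv_const|].
    apply Ccv_scal, Ccv_RtoC.
    replace (Finite (1 / 12)) with (Finite (1 / 2 * (0 * 0 - 0 + 1 / 6))) by (f_equal; field).
    apply is_lim_seq_ext with (fun n => 1 / 2 * (a n * a n - a n + 1 / 6))%R; [intros; ring|].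
    apply is_lim_seq_mult'; [apply is_lim_seq_const|].
    apply is_lim_seq_plus'; [|apply is_lim_seq_const].
    apply is_lim_seq_minus'; [apply is_lim_seq_mult'|]; apply is_lim_seq_inv_INR2. }
  apply Ccv_Cexp in L2.
  assert (L3 := Ccv_mult _ _ _ _ (Cexp_small_quotient t) L2).
  rewrite RtoC_mult. apply (Ccv_unique _ _ _ L1).
  revert L3. apply Ccv_ext. intros n. fold (a n).
  assert (Hs : (0 < sin (PI * a n))%R) by (apply sin_PI_pos; specialize (Ha n); lra).
  assert (Na : RtoC (a n) <> 0) by (apply RtoC_neq_0; specialize (Ha n); lra).
  rewrite (Cexp_minus (Th n)), mlog_exp by auto. unfold Th.
  match goal with |- _ * Cexp ?X = _ => set (E := X) end.
  replace (RtoC (PI ^ 2 / 3) / t - RtoC (ln (2 * sin (PI * a n)))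
      - t * RtoC (1 / 2 * (a n ^ 2 - a n + 1 / 6)) + 2 * B n)
    with (E - RtoC (ln (2 * sin (PI * a n)))) by (unfold E; ring).
  rewrite Cexp_minus, Cexp_RtoC, exp_ln by lra.
  rewrite RtoC_div by (specialize (Ha n); lra). rewrite RtoC_mult.
  assert (Nz := C1m_neq_0 _ (Hz n)). unfold z in *.
  field. repeat split; auto. apply RtoC_neq_0; lra.
Qed.

Lemma cdiff_continuity f (t0 v : C) s d : cdiff f (t0 + RtoC s * v) d ->
  continuity_pt (fun s => Re (f (t0 + RtoC s * v))) s.
Proof.
  intros H. destruct (cdiff_lip _ _ _ H) as (r & L & Hr & HL & Hlip).
  intros eps Heps. assert (Hv := Cmod_ge_0 v).
  set (dl := Rmin (r / (Cmod v + 1)) (eps / ((L + 1) * (Cmod v + 1)))).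
  exists dl. split.
  - apply Rmin_pos; apply Rdiv_lt_0_compat; auto; [lra | apply Rmult_lt_0_compat; lra].
  - intros x [_ Hx]. simpl in Hx. unfold R_dist in Hx. simpl. unfold R_dist.
    assert (D1 := Rmin_l (r / (Cmod v + 1)) (eps / ((L + 1) * (Cmod v + 1)))).
    assert (D2 := Rmin_r (r / (Cmod v + 1)) (eps / ((L + 1) * (Cmod v + 1)))). fold dl in D1, D2.
    assert (E : Cmod (t0 + RtoC x * v - (t0 + RtoC s * v)) = (Rabs (x - s) * Cmod v)%R).
    { replace (t0 + RtoC x * v - (t0 + RtoC s * v)) with (RtoC (x - s) * v) by (rewrite RtoC_minus; ring).
      now rewrite Cmod_mult, Cmod_R. }
    assert (A0 := Rabs_pos (x - s)).
    assert (A1 : (Rabs (x - s) * (Cmod v + 1) < r)%R) by (apply (Rlt_div_r _ _ (Cmod v + 1)); lra).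
    assert (A2 : (Rabs (x - s) * ((L + 1) * (Cmod v + 1)) < eps)%R).
    { apply (Rlt_div_r _ _ ((L + 1) * (Cmod v + 1))); [apply Rmult_lt_0_compat; lra | lra]. }
    assert (Hl := Hlip (t0 + RtoC x * v)). rewrite E in Hl.
    assert (K : (Rabs (x - s) * Cmod v < r)%R) by nra. specialize (Hl K).
    eapply Rle_lt_trans; [apply (re_le_Cmod (f (t0 + RtoC x * v) - f (t0 + RtoC s * v)))|].
    eapply Rle_lt_trans; [exact Hl|].
    assert (0 <= Rabs (x - s) * Cmod v)%R by (apply Rmult_le_pos; auto).
    assert (0 <= L * Rabs (x - s))%R by (apply Rmult_le_pos; auto). nra.
Qed.

Lemma Cser_real u s : (forall n, Im (u n) = 0%R) -> Cser u s -> Im s = 0%R.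
Proof.
  intros H Hs. apply Ccv_components in Hs. destruct Hs as [_ Hs].
  assert (E : forall n, Im (psum u n) = 0%R).
  { induction n as [|n IH]; [reflexivity|]. rewrite psum_S.
    change (Im (psum u n) + Im (u n) = 0)%R. rewrite IH, H. ring. }
  assert (L : is_lim_seq (fun n => Im (psum u n)) 0%R).
  { apply is_lim_seq_ext with (fun _ => 0%R); [intros; now rewrite E | apply is_lim_seq_const]. }
  apply is_lim_seq_unique in Hs. apply is_lim_seq_unique in L. rewrite Hs in L. now inversion L.
Qed.

Lemma lambert_real al r : (0 < al)%R -> (r < 0)%R -> Im (lambert al (RtoC r)) = 0%R.
Proof.
  intros Hal Hr. apply (Cser_real (fun j => lambert_term (INR j + al) (RtoC r))).
  - intros n. unfold lambert_term. rewrite <- RtoC_mult, Cexp_RtoC, <- RtoC_minus, <- RtoC_mult.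
    assert (Hn := pos_INR n).
    rewrite <- RtoC_div; [apply im_RtoC|].
    assert (exp ((INR n + al) * r) < 1)%R by (apply exp_lt_1; nra).
    apply Rmult_integral_contrapositive. split; lra.
  - apply lambert_ser; auto.
Qed.

Lemma Re_pos_cut (t : C) : (0 < Re t)%R -> cut_plane t.
Proof. intros H [_ K]. lra. Qed.

Lemma cdiff_lambert_comp al f z d : (0 < al)%R -> (Re (f z) < 0)%R -> cdiff f z d ->
  exists e, cdiff (fun v => lambert al (f v)) z e.
Proof.
  intros Hal Hf H. destruct (cdiff_lambert al (f z) Hal Hf) as [e He].
  eexists. exact (cdiff_comp f (lambert al) z d e H He).
Qed.

(** A logarithm of the quotient of the two sides of the formula for P. *)
Definition eta_defect (t : C) : C :=
  lambert 1 (- t) - lambert 1 (- (RtoC (4 * PI ^ 2) / t)) - RtoC (PI ^ 2 / 6) / t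
  + t * RtoC (1 / 24) - RtoC (1 / 2) * Clog t + RtoC (1 / 2 * ln (2 * PI)).

Lemma cdiff_eta_defect t : (0 < Re t)%R -> exists d, cdiff eta_defect t d.
Proof.
  intros Ht. assert (Ht0 := Re_pos_neq_0 t Ht).
  assert (H1 : cdiff (fun v => - (1) * v + 0) t (- (1))) by apply cdiff_affine.
  assert (Hr1 : (Re (- (1) * t + 0) < 0)%R).
  { replace (- (1) * t + 0) with (- t) by ring. change (- Re t < 0)%R. lra. }
  destruct (cdiff_lambert_comp 1 _ t _ ltac:(lra) Hr1 H1) as [d1 D1].
  assert (H2 : cdiff (fun v => - RtoC (4 * PI ^ 2) * / v) t (- RtoC (4 * PI ^ 2) * (- / (t * t))))
    by (now apply cdiff_scal, cdiff_inv).
  assert (Hr : (Re (- RtoC (4 * PI ^ 2) * / t) < 0)%R).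
  { assert (K := Re_inv_pos t Ht).
    replace (- RtoC (4 * PI ^ 2) * / t) with (- (RtoC (4 * PI ^ 2) / t)) by (unfold Cdiv; ring).
    change (- Re (RtoC (4 * PI ^ 2) / t) < 0)%R. lra. }
  destruct (cdiff_lambert_comp 1 _ t _ ltac:(lra) Hr H2) as [d2 D2].
  assert (H := cdiff_plus _ _ _ _ _ (cdiff_plus _ _ _ _ _ (cdiff_plus _ _ _ _ _ D1 (cdiff_scal (- (1)) _ _ _ D2))
     (cdiff_plus _ _ _ _ _ (cdiff_scal (- RtoC (PI ^ 2 / 6)) _ _ _ (cdiff_inv t Ht0))
                 (cdiff_scal (- RtoC (1 / 2)) _ _ _ (cdiff_Clog t (Re_pos_cut t Ht)))))
     (cdiff_affine (RtoC (1 / 24)) (RtoC (1 / 2 * ln (2 * PI))) t)).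
  eexists. eapply cdiff_ext; [|exact H].
  intros v. cbv beta. unfold eta_defect.
  replace (- (1) * v + 0) with (- v) by ring.
  replace (- RtoC (4 * PI ^ 2) * / v) with (- (RtoC (4 * PI ^ 2) / v)) by (unfold Cdiv; ring).
  unfold Cdiv. ring.
Qed.

Lemma eta_defect_sq t : (0 < Re t)%R -> Cexp (eta_defect t) * Cexp (eta_defect t) = 1.
Proof.
  intros Ht. assert (HPI := PI_RGT_0). assert (Ht0 := Re_pos_neq_0 t Ht).
  rewrite <- Cexp_plus.
  assert (E := eta_squared t Ht).
  set (l1 := lambert 1 (- t)) in *. set (l2 := lambert 1 (- (RtoC (4 * PI ^ 2) / t))) in *.
  set (X := RtoC (PI ^ 2 / 3) / t - t * RtoC (1 / 12) + 2 * l2) in *.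
  replace (eta_defect t + eta_defect t) with (2 * l1 + RtoC (ln (2 * PI)) - X - Clog t).
  - rewrite !Cexp_minus, Cexp_plus, Cexp_RtoC, exp_ln, Cexp_Clog by (auto; lra).
    rewrite (Cmult_comm (Cexp (2 * l1))), E. field. split; auto. apply Cexp_neq_0.
  - unfold eta_defect, X. fold l1 l2.
    replace (RtoC (PI ^ 2 / 3)) with (RtoC (PI ^ 2 / 6) + RtoC (PI ^ 2 / 6)) by (rewrite <- RtoC_plus; f_equal; field).
    replace (RtoC (1 / 12)) with (RtoC (1 / 24) + RtoC (1 / 24)) by (rewrite <- RtoC_plus; f_equal; field).
    replace (RtoC (ln (2 * PI))) with (RtoC (1 / 2 * ln (2 * PI)) + RtoC (1 / 2 * ln (2 * PI)))
      by (rewrite <- RtoC_plus; f_equal; field).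
    replace (Clog t) with (RtoC (1 / 2) * Clog t + RtoC (1 / 2) * Clog t) at 1.
    + field. auto.
    + replace (RtoC (1 / 2) * Clog t + RtoC (1 / 2) * Clog t) with ((RtoC (1 / 2) + RtoC (1 / 2)) * Clog t) by ring.
      rewrite <- RtoC_plus. replace (1 / 2 + 1 / 2)%R with 1%R by field. ring.
Qed.

Lemma sqrt_unity (x : C) : x * x = 1 -> x = 1 \/ x = - (1).
Proof.
  intros H. destruct (Ceq_dec (x - 1) 0) as [E|E].
  - left. replace x with ((x - 1) + 1) by ring. rewrite E. ring.
  - right. assert (K : x + 1 = (x * x - 1) / (x - 1)) by (field; auto).
    rewrite H in K. replace x with ((x + 1) - 1) by ring. rewrite K. field. auto.
Qed.

(** The quotient is a square root of 1, hence of constant sign on the half-plane by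
    the intermediate value theorem on a segment from 1, and it is positive at [t = 1],
    where all terms are real. *)
Lemma eta_defect_1 t : (0 < Re t)%R -> Cexp (eta_defect t) = 1.
Proof.
  intros Ht. destruct (sqrt_unity _ (eta_defect_sq t Ht)) as [E|E]; auto. exfalso.
  set (g := fun s : R => Re ((fun v => - (1) * Cexp (eta_defect v)) (1 + RtoC s * (t - 1)))).
  assert (Hre : forall s, (0 <= s <= 1)%R -> (0 < Re (1 + RtoC s * (t - 1)))%R).
  { intros s Hs. unfold Re in *. simpl.
    replace (1 + (s * (fst t + - (1)) - 0 * (snd t + - 0)))%R with ((1 - s) + s * fst t)%R by ring. nra. }
  assert (Hc : forall s, (0 <= s <= 1)%R -> continuity_pt g s).
  { intros s Hs. destruct (cdiff_eta_defect _ (Hre s Hs)) as [d Hd].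
    eapply cdiff_continuity. apply cdiff_scal, cdiff_Cexp. exact Hd. }
  assert (Im1 : Im (eta_defect 1) = 0%R).
  { assert (HPI := PI_RGT_0). assert (HP2 : (0 < PI ^ 2)%R) by now apply pow_lt.
    unfold eta_defect. rewrite <- RtoC_opp, <- !RtoC_div, <- RtoC_opp by lra.
    assert (I1 := lambert_real 1 (- (1)) ltac:(lra) ltac:(lra)).
    assert (I2 := lambert_real 1 (- (4 * PI ^ 2 / 1)) ltac:(lra) ltac:(lra)).
    assert (I3 : Im (Clog 1) = 0%R).
    { simpl. unfold Carg. simpl. destruct (Rle_dec 0 0); [|lra].
      rewrite Cmod_1. replace (1 / 1)%R with 1%R by field. apply acos_1. }
    unfold Im in *. simpl. simpl in I1, I2, I3. rewrite I1, I2, I3. ring. }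
  destruct (Ranalysis5.IVT_interv g 0 1 Hc ltac:(lra)) as [s [Hs Es]].
  - unfold g. replace (1 + RtoC 0 * (t - 1)) with (RtoC 1) by ring.
    unfold Cexp. rewrite Im1, sin_0, cos_0.
    assert (K := exp_pos (Re (eta_defect 1))). unfold Re in *. simpl in *. lra.
  - unfold g. replace (1 + RtoC 1 * (t - 1)) with t by ring. rewrite E. unfold Re. simpl. lra.
  - unfold g in Es. destruct (sqrt_unity _ (eta_defect_sq _ (Hre s Hs))) as [E'|E'];
      rewrite E' in Es; unfold Re in Es; simpl in Es; lra.
Qed.

(** The modularity of the Dedekind eta function, with the principal square root. *)
Theorem eta_transformation t : (0 < Re t)%R ->
  Cexp (lambert 1 (- t)) =
  RtoC (exp (- (1 / 2 * ln (2 * PI)))) * Csqrt t *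
  Cexp (RtoC (PI ^ 2 / 6) / t - t * RtoC (1 / 24) + lambert 1 (- (RtoC (4 * PI ^ 2) / t))).
Proof.
  intros Ht. assert (E := eta_defect_1 t Ht).
  unfold Csqrt, Cppow. rewrite <- Cexp_RtoC, <- !Cexp_plus.
  rewrite <- (Cmult_1_r (Cexp (_ + _))), <- E, <- Cexp_plus. f_equal.
  unfold eta_defect. rewrite RtoC_opp. ring.
Qed.

(** * The sine product *)

(** The expansion [cosh_fourier] at [a = 0] for the imaginary value [c = 2 pi i x]. *)
Lemma cot_partial_fractions x : (0 < x < 1)%R ->
  is_series (fun k => 2 * x / (INR (k + 1) ^ 2 - x ^ 2))%R
            (/ x - PI * cos (PI * x) / sin (PI * x))%R.
Proof.
  intros Hx. assert (HPI := PI_RGT_0). assert (HP2 : (0 < PI ^ 2)%R) by now apply pow_lt.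
  assert (Hs := sin_PI_pos x Hx).
  set (c := Ci * RtoC (2 * PI * x)).
  assert (EC : Ci * Ci = - (1)) by (apply injective_projections; simpl; ring).
  assert (Hd : forall k, (0 < INR (k + 1) ^ 2 - x ^ 2)%R).
  { intros k. assert (K := INR_S_ge_1 k). nra. }
  assert (Eden : forall k, coth_den c k = RtoC (4 * PI ^ 2 * (INR (k + 1) ^ 2 - x ^ 2))).
  { intros k. unfold coth_den, c, freq.
    replace (Ci * RtoC (2 * PI * x) * (Ci * RtoC (2 * PI * x)))
      with ((Ci * Ci) * (RtoC (2 * PI * x) * RtoC (2 * PI * x))) by ring.
    rewrite EC, <- RtoC_mult.
    replace (4 * PI ^ 2 * (INR (k + 1) ^ 2 - x ^ 2))%R
      with ((2 * PI * INR (k + 1)) ^ 2 - 2 * PI * x * (2 * PI * x))%R by ring.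
    rewrite RtoC_minus. ring. }
  assert (Hoff : off_poles (4 * PI ^ 2 * (1 - x ^ 2)) c).
  { split; [apply Rmult_lt_0_compat; nra|]. intros k. rewrite Eden, Cmod_R, Rabs_pos_eq.
    - rewrite Rmult_assoc. apply Rmult_le_compat_l; [lra|].
      assert (K := INR_S_ge_1 k). assert (1 <= INR (k + 1) ^ 2)%R by nra. nra.
    - left. apply Rmult_lt_0_compat; [lra | apply Hd]. }
  assert (Hc : c <> 0).
  { unfold c. apply Cmult_neq_0; [apply Ci_nz | apply RtoC_neq_0; nra]. }
  assert (E := cosh_fourier _ c 0 Hoff Hc ltac:(lra)).
  assert (EX : forall e, (e = 1 \/ e = -1)%R -> Cexp (RtoC e * (c * RtoC (1 / 2))) = RtoC (cos (PI * x)) + RtoC e * Ci * RtoC (sin (PI * x))).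
  { intros e He. unfold c. replace (RtoC e * (Ci * RtoC (2 * PI * x) * RtoC (1 / 2))) with (Ci * RtoC (e * (PI * x))).
    - unfold Cexp, Ci, Re, Im. simpl.
      replace (0 * (e * (PI * x)) - 1 * 0)%R with 0%R by ring.
      replace (0 * 0 + 1 * (e * (PI * x)))%R with (e * (PI * x))%R by ring. rewrite exp_0.
      apply injective_projections; simpl; destruct He as [-> | ->];
        rewrite ?Rmult_1_l; replace (-1 * (PI * x))%R with (- (PI * x))%R by ring;
        rewrite ?cos_neg, ?sin_neg; ring.
    - replace (e * (PI * x))%R with (e * (2 * PI * x) * (1 / 2))%R by field. rewrite !RtoC_mult. ring. }
  rewrite Rminus_0_r in E.
  assert (E1 := EX 1%R ltac:(auto)). assert (E2 := EX (-1)%R ltac:(auto)).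
  replace (RtoC 1 * (c * RtoC (1 / 2))) with (c * RtoC (1 / 2)) in E1 by ring.
  replace (RtoC (-1) * (c * RtoC (1 / 2))) with (- (c * RtoC (1 / 2))) in E2 by ring.
  rewrite E1, E2 in E. unfold cosh_sum in E.
  assert (Ns : RtoC (sin (PI * x)) <> 0) by (apply RtoC_neq_0; lra).
  assert (NP : RtoC PI <> 0) by (apply RtoC_neq_0; lra).
  assert (Nx : RtoC x <> 0) by (apply RtoC_neq_0; lra).
  assert (ES : - (8 * RtoC PI * RtoC PI * RtoC x) * cosh_ser c 0 = RtoC (PI * cos (PI * x) / sin (PI * x) - / x)).
  { rewrite RtoC_minus, RtoC_div, RtoC_mult, RtoC_inv by lra.
    replace (RtoC (cos (PI * x)) + RtoC 1 * Ci * RtoC (sin (PI * x)) +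
      (RtoC (cos (PI * x)) + RtoC (-1) * Ci * RtoC (sin (PI * x)))) with (2 * RtoC (cos (PI * x))) in E by ring.
    replace (RtoC (cos (PI * x))) with
      ((RtoC (cos (PI * x)) + RtoC 1 * Ci * RtoC (sin (PI * x)) -
       (RtoC (cos (PI * x)) + RtoC (-1) * Ci * RtoC (sin (PI * x)))) * (2 / c + 4 * c * cosh_ser c 0) / 2)
      by (rewrite E; field).
    unfold c. rewrite !RtoC_mult.
    replace (- (8 * RtoC PI * RtoC PI * RtoC x) * cosh_ser (Ci * (RtoC 2 * RtoC PI * RtoC x)) 0)
      with ((Ci * Ci) * (8 * RtoC PI * RtoC PI * RtoC x) * cosh_ser (Ci * (RtoC 2 * RtoC PI * RtoC x)) 0)
      by (rewrite EC; ring).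
    set (S := cosh_ser (Ci * (RtoC 2 * RtoC PI * RtoC x)) 0).
    field. repeat split; auto; apply Ci_nz. }
  assert (HS := Cser_scal (8 * RtoC PI * RtoC PI * RtoC x) _ _ (cosh_ser_correct _ c 0 Hoff)).
  replace (8 * RtoC PI * RtoC PI * RtoC x * cosh_ser c 0)
    with (- (- (8 * RtoC PI * RtoC PI * RtoC x) * cosh_ser c 0)) in HS by ring.
  rewrite ES, <- RtoC_opp in HS.
  apply Cser_components in HS. destruct HS as [HS _]. rewrite re_RtoC in HS.
  replace (- (PI * cos (PI * x) / sin (PI * x) - / x))%R
    with (/ x - PI * cos (PI * x) / sin (PI * x))%R in HS by ring.
  revert HS. apply is_series_ext. intros k. specialize (Hd k).
  unfold cosh_term. rewrite Eden, Rmult_0_r, cos_0, <- !RtoC_mult, <- RtoC_div, <- RtoC_mult, re_RtoC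
    by (apply Rgt_not_eq, Rmult_lt_0_compat; lra).
  match goal with |- ?a = ?b => change (@eq R a b) end. field. lra.
Qed.

(** Logarithm of the partial product of the sine product; the case split gives the
    empty sum for [n = 0]. *)
Definition sine_log (n : nat) (x : R) : R :=
  match n with O => 0%R | S p => sum_f_R0 (fun k => ln (1 - x ^ 2 / INR (k + 1) ^ 2)) p end.

Lemma sine_log_S n x : sine_log (S n) x = (sine_log n x + ln (1 - x ^ 2 / INR (n + 1) ^ 2))%R.
Proof. destruct n as [|n]; simpl sine_log; [simpl; ring | reflexivity]. Qed.

Lemma one_m_sq_pos x k : (0 < x < 1)%R -> (0 < 1 - x ^ 2 / INR (k + 1) ^ 2)%R.
Proof.
  intros Hx. assert (K := INR_S_ge_1 k). assert (K2 := INR_sq_pos k).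
  assert (x ^ 2 / INR (k + 1) ^ 2 < 1)%R; [|lra]. apply Rlt_div_l; auto. nra.
Qed.

Lemma is_derive_sine_log n x : (0 < x < 1)%R ->
  is_derive (sine_log n) x (- Re (psum (fun k => RtoC (2 * x / (INR (k + 1) ^ 2 - x ^ 2))) n))%R.
Proof.
  intros Hx. induction n as [|n IH].
  - replace (- Re (psum (fun k => RtoC (2 * x / (INR (k + 1) ^ 2 - x ^ 2))) 0))%R with 0%R
      by (rewrite psum_0; simpl; ring).
    apply is_derive_Reals, (derivable_pt_lim_const 0).
  - apply is_derive_ext with (fun x => sine_log n x + ln (1 - x ^ 2 / INR (n + 1) ^ 2))%R.
    { intros t. now rewrite sine_log_S. }
    assert (Hp := one_m_sq_pos x n Hx). assert (K2 := INR_sq_pos n). assert (K := INR_S_ge_1 n).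
    assert (H2 : is_derive (fun x => ln (1 - x ^ 2 / INR (n + 1) ^ 2))%R x
              (- (2 * x / (INR (n + 1) ^ 2 - x ^ 2)))%R).
    { auto_derive; [exact Hp|]. simpl in *. field. split; nra. }
    assert (H3 := is_derive_plus _ _ _ _ _ IH H2).
    eapply (fun H => eq_rect _ (is_derive _ x) H3 _ H).
    rewrite psum_S. unfold plus, Re. simpl. ring.
Qed.

Lemma Cser_RtoC (w : nat -> R) (l : R) : is_series w l -> Cser (fun k => RtoC (w k)) (RtoC l).
Proof.
  intros H. unfold Cser. apply Ccv_components. rewrite re_RtoC, im_RtoC. split.
  - apply is_lim_seq_incr_1. apply is_lim_seq_ext with (sum_n w); [|exact H].
    intros n. symmetry. apply (sum_n_components (fun k => RtoC (w k)) n).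
  - apply is_lim_seq_ext with (fun _ => 0%R); [|apply is_lim_seq_const].
    intros n. induction n as [|n IH]; [reflexivity|].
    rewrite psum_S. change (0 = Im (psum (fun k => RtoC (w k)) n) + 0)%R. rewrite <- IH. ring.
Qed.

(** Telescoping bound on the tail of the partial fraction expansion, uniform in [x];
    this is what makes the logarithms of the sine product converge uniformly up to 0. *)
Lemma cot_tail_le n x : (0 < x < 1)%R ->
  (0 <= / x - PI * cos (PI * x) / sin (PI * x)
     - Re (psum (fun k => RtoC (2 * x / (INR (k + 1) ^ 2 - x ^ 2))) (S n)) <= 2 * / INR (n + 1))%R.
Proof.
  intros Hx. assert (H := cot_partial_fractions x Hx).
  set (u := fun k => RtoC (2 * x / (INR (k + 1) ^ 2 - x ^ 2))).
  assert (Hu : Cser u (RtoC (/ x - PI * cos (PI * x) / sin (PI * x)))).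
  { exact (Cser_RtoC _ _ H). }
  assert (Hpos : forall k, (0 <= 2 * x / (INR (k + 1) ^ 2 - x ^ 2))%R).
  { intros k. assert (K := INR_S_ge_1 k). apply Rdiv_le_0_compat; [lra | nra]. }
  assert (Ht := Cser_tail _ _ (S n) Hu).
  set (S' := RtoC (/ x - PI * cos (PI * x) / sin (PI * x)) - psum u (S n)) in *.
  assert (E : (/ x - PI * cos (PI * x) / sin (PI * x) - Re (psum u (S n)))%R = Re S') by reflexivity.
  rewrite E. split.
  - apply Ccv_components in Ht. destruct Ht as [Ht _].
    apply (is_lim_seq_le (fun _ => 0%R) _ 0%R (Re S')) with (3 := Ht); [|apply is_lim_seq_const].
    intros j. induction j as [|j IH]; [rewrite psum_0; simpl; lra|].
    rewrite psum_S. change (0 <= Re (psum (fun k => u (S n + k)%nat) j) + Re (u (S n + j)%nat))%R.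
    assert (K := Hpos (S n + j)%nat). unfold u at 2. rewrite re_RtoC. lra.
  - eapply Rle_trans; [apply Rle_abs|]. eapply Rle_trans; [apply re_le_Cmod|].
    apply (Cser_le _ _ (fun i => 2 * / (INR (n + i + 1) * INR (n + i + 2)))%R _ Ht).
    + intros k. unfold u. rewrite Cmod_R, Rabs_pos_eq by apply Hpos.
      replace (S n + k + 1)%nat with (n + k + 2)%nat by lia.
      set (p := INR (n + k + 1)). assert (Hp : (1 <= p)%R) by apply INR_S_ge_1.
      replace (INR (n + k + 2)) with (p + 1)%R
        by (unfold p; rewrite !plus_INR; simpl; ring).
      apply Rle_trans with (2 * 1 * / (p * (p + 1)))%R; [|lra].
      unfold Rdiv. apply Rmult_le_compat; try lra.
      * left. apply Rinv_0_lt_compat. nra.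
      * apply Rinv_le_contravar; nra.
    + apply (is_series_scal (K := R_AbsRing) (V := R_NormedModule)). apply is_series_telescope.
Qed.

Lemma is_lim_seq_sine_log_0 n : is_lim_seq (fun N => sine_log n (/ INR (N + 2))) 0%R.
Proof.
  induction n as [|n IH].
  - apply is_lim_seq_const.
  - apply is_lim_seq_ext with (fun N => sine_log n (/ INR (N + 2))
      + ln (1 - (/ INR (N + 2)) * (/ INR (N + 2)) * / INR (n + 1) ^ 2))%R.
    { intros N. rewrite sine_log_S. do 2 f_equal. unfold Rdiv. ring. }
    replace (Finite 0) with (Finite (0 + ln (1 - 0 * 0 * / INR (n + 1) ^ 2)))
      by (f_equal; rewrite !Rmult_0_l, Rminus_0_r, ln_1; ring).
    apply is_lim_seq_plus'; auto.
    apply (is_lim_seq_continuous ln).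
    + apply derivable_continuous_pt. exists (/ (1 - 0 * 0 * / INR (n + 1) ^ 2))%R.
      apply derivable_pt_lim_ln. rewrite !Rmult_0_l. lra.
    + apply is_lim_seq_minus'; [apply is_lim_seq_const|].
      apply is_lim_seq_mult'; [|apply is_lim_seq_const].
      apply is_lim_seq_mult'; apply is_lim_seq_inv_INR2.
Qed.

Lemma is_lim_seq_ln_sinc : is_lim_seq (fun N => ln (sin (PI * / INR (N + 2)) / (PI * / INR (N + 2)))) 0%R.
Proof.
  assert (HPI := PI_RGT_0).
  replace (Finite 0) with (Finite (ln (PI * / PI))) by (f_equal; rewrite Rinv_r, ln_1; lra).
  apply is_lim_seq_ext with (fun N => ln (sin (PI * / INR (N + 2)) / (/ INR (N + 2)) * / PI)).
  { intros N. f_equal. assert (H := inv_INR2_range N). field.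
    repeat split; try lra; apply not_0_INR; lia. }
  apply (is_lim_seq_continuous ln).
  - apply derivable_continuous_pt. exists (/ (PI * / PI))%R. apply derivable_pt_lim_ln.
    rewrite Rinv_r; lra.
  - apply is_lim_seq_mult'; [|apply is_lim_seq_const].
    assert (H := sin_small_quotient). apply Ccv_components in H. apply H.
Qed.

(** The logarithm of the quotient has a derivative bounded by 2/n on (0, 1), by
    [cot_tail_le], and tends to 0 at 0. *)
Lemma sine_product x : (0 < x < 1)%R ->
  is_lim_seq (fun n => exp (sine_log (S n) x)) (sin (PI * x) / (PI * x))%R.
Proof.
  intros Hx. assert (HPI := PI_RGT_0). assert (Hs := sin_PI_pos x Hx).
  (* [f n] is the logarithm of the quotient of the full product by its partial product. *)
  set (f := fun n y => (ln (sin (PI * y) / (PI * y)) - sine_log (S n) y)%R).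
  assert (Hf : forall n y, (0 < y < 1)%R -> is_derive (f n) y
    (- (/ y - PI * cos (PI * y) / sin (PI * y)
      - Re (psum (fun k => RtoC (2 * y / (INR (k + 1) ^ 2 - y ^ 2))) (S n))))%R).
  { intros n y Hy. assert (Hsy := sin_PI_pos y Hy).
    assert (H1 : is_derive (fun y => ln (sin (PI * y) / (PI * y))) y
        (PI * cos (PI * y) / sin (PI * y) - / y)%R).
    { auto_derive.
      - split; [nra|]. split; [apply Rdiv_lt_0_compat; nra | auto].
      - field. repeat split; nra. }
    assert (H2 := is_derive_minus _ _ _ _ _ H1 (is_derive_sine_log (S n) y Hy)).
    eapply (fun H => eq_rect _ (is_derive _ y) H2 _ H).
    unfold minus, plus, opp. simpl. ring. }
  assert (Hb : forall n, (Rabs (f n x) <= 2 * / INR (n + 1))%R).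
  { intros n.
    assert (L : is_lim_seq (fun N => Rabs (f n x - f n (/ INR (N + 2))%R)) (Rabs (f n x - 0))%R).
    { apply (is_lim_seq_abs _ (f n x - 0)%R). apply is_lim_seq_minus'; [apply is_lim_seq_const|].
      unfold f. replace (Finite 0) with (Finite (0 - 0)) by (f_equal; ring).
      apply is_lim_seq_minus'; [apply is_lim_seq_ln_sinc | apply is_lim_seq_sine_log_0]. }
    rewrite Rminus_0_r in L.
    apply (is_lim_seq_le _ (fun _ => 2 * / INR (n + 1))%R (Rabs (f n x)) (2 * / INR (n + 1))%R) with (2 := L).
    2:{ apply is_lim_seq_const. }
    intros N. assert (HN := inv_INR2_range N). set (e := (/ INR (N + 2))%R) in *.
    assert (Hin : forall y, (Rmin e x <= y <= Rmax e x)%R -> (0 < y < 1)%R).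
    { intros y [Y1 Y2]. assert (0 < Rmin e x)%R by (apply Rmin_pos; lra).
      assert (Rmax e x < 1)%R by (apply Rmax_lub_lt; lra). lra. }
    destruct (MVT_gen (f n) e x _ (fun y Hy => Hf n y (Hin y (conj (Rlt_le _ _ (proj1 Hy)) (Rlt_le _ _ (proj2 Hy))))))
      as [c [Hc E]].
    - intros y Hy. apply derivable_continuous_pt. eexists. apply is_derive_Reals, Hf, Hin, Hy.
    - rewrite E. specialize (Hin c Hc). assert (K := cot_tail_le n c Hin).
      rewrite Rabs_mult, Rabs_Ropp, (Rabs_pos_eq (_ - _)) by lra.
      assert (Rabs (x - e) <= 1)%R by (apply Rabs_le; lra).
      assert (0 <= Rabs (x - e))%R by apply Rabs_pos. nra. }
  assert (L0 : is_lim_seq (fun n => f n x) 0%R).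
  { apply is_lim_seq_abs_0. apply is_lim_seq_0_le with (fun n => 2 * / INR (n + 1))%R.
    - intros n. split; [apply Rabs_pos | apply Hb].
    - apply is_lim_seq_scal_0, is_lim_seq_inv_INR. }
  assert (L1 : is_lim_seq (fun n => exp (ln (sin (PI * x) / (PI * x)) - f n x))
                 (exp (ln (sin (PI * x) / (PI * x)) - 0))%R).
  { apply (is_lim_seq_continuous exp).
    - apply derivable_continuous_pt, derivable_pt_exp.
    - apply is_lim_seq_minus'; auto. apply is_lim_seq_const. }
  rewrite Rminus_0_r, exp_ln in L1 by (apply Rdiv_lt_0_compat; nra).
  revert L1. apply is_lim_seq_ext. intros n. f_equal. unfold f. ring.
Qed.

(** * The Gamma function *)

Lemma ex_RInt_pos (f : R -> R) u v :
  (forall t, (0 < t)%R -> continuous f t) -> (0 < u)%R -> (0 < v)%R -> ex_RInt f u v.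
Proof.
  intros Hf Hu Hv. apply (ex_RInt_continuous (V := R_CompleteNormedModule)). intros z [Hz _]. apply Hf.
  eapply Rlt_le_trans; [|exact Hz]. now apply Rmin_pos.
Qed.

Lemma RInt_pos_mono (f : R -> R) u v u' v' :
  (forall t, (0 < t)%R -> continuous f t) -> (forall t, (0 < t)%R -> (0 <= f t)%R) ->
  (0 < u')%R -> (u' <= u)%R -> (u <= v)%R -> (v <= v')%R -> (RInt f u v <= RInt f u' v')%R.
Proof.
  intros Hc Hp Hu' Hu Huv Hv.
  assert (E1 := RInt_Chasles f u' u v' (ex_RInt_pos f u' u Hc Hu' ltac:(lra)) (ex_RInt_pos f u v' Hc ltac:(lra) ltac:(lra))).
  assert (E2 := RInt_Chasles f u v v' (ex_RInt_pos f u v Hc ltac:(lra) ltac:(lra)) (ex_RInt_pos f v v' Hc ltac:(lra) ltac:(lra))).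
  assert (P1 : (0 <= RInt f u' u)%R).
  { apply RInt_ge_0; auto; [apply ex_RInt_pos; auto; lra | intros; apply Hp; lra]. }
  assert (P2 : (0 <= RInt f v v')%R).
  { apply RInt_ge_0; auto; [apply ex_RInt_pos; auto; lra | intros; apply Hp; lra]. }
  change (RInt f u' u + RInt f u v' = RInt f u' v')%R in E1.
  change (RInt f u v + RInt f v v' = RInt f u v')%R in E2. lra.
Qed.

(** The least upper bound of the integrals over compact intervals is the limit,
    because these integrals increase with the interval. *)
Lemma improper_integral_pos (f : R -> R) (B : R) :
  (forall t, (0 < t)%R -> continuous f t) -> (forall t, (0 < t)%R -> (0 <= f t)%R) ->
  (forall u v, (0 < u <= 1)%R -> (1 <= v)%R -> (RInt f u v <= B)%R) ->
  exists l, is_RInt_gen f (at_right 0) (Rbar_locally p_infty) l /\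
    is_lim_seq (fun n => RInt f (/ INR (n + 2)) (INR (n + 2))) l.
Proof.
  intros Hc Hp HB.
  set (E := fun y => exists u v, (0 < u <= 1)%R /\ (1 <= v)%R /\ y = RInt f u v).
  destruct (completeness E) as [l [Hl1 Hl2]].
  - exists B. intros y (u & v & Hu & Hv & ->). now apply HB.
  - exists (RInt f 1 1), 1%R, 1%R. repeat split; lra.
  - assert (Hlim : forall eps : posreal, exists u0 v0, (0 < u0)%R /\ (1 <= v0)%R /\
       forall u v, (0 < u <= u0)%R -> (v0 <= v)%R -> (Rabs (RInt f u v - l) < eps)%R).
    { intros eps. destruct (classic (exists u v, (0 < u <= 1)%R /\ (1 <= v)%R /\ (l - eps < RInt f u v)%R))
        as [(u0 & v0 & Hu0 & Hv0 & K)|N].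
      - exists u0, v0. split; [lra|]. split; auto. intros u v Hu Hv.
        assert (M := RInt_pos_mono f u0 v0 u v Hc Hp ltac:(lra) ltac:(lra) ltac:(lra) ltac:(lra)).
        assert (U : (RInt f u v <= l)%R).
        { apply Hl1. exists u, v. repeat split; lra. }
        apply Rabs_def1; destruct eps; simpl in *; lra.
      - exfalso. assert (K : (l <= l - eps)%R).
        { apply Hl2. intros y (u & v & Hu & Hv & ->). apply Rnot_lt_le. intros K. apply N.
          exists u, v. auto. }
        destruct eps; simpl in *; lra. }
    exists l. split.
    + intros P [eps HP]. destruct (Hlim eps) as (u0 & v0 & Hu0 & Hv0 & K).
      apply Filter_prod with (Q := fun u => (0 < u <= u0)%R) (R := fun v => (v0 <= v)%R).
      * exists (mkposreal u0 Hu0). intros y Hy Hy0.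
        change (Rabs (y - 0) < u0)%R in Hy. apply Rabs_def2 in Hy. lra.
      * exists v0. intros x Hx. lra.
      * intros u v Hu Hv. exists (RInt f u v). split.
        -- apply (RInt_correct f u v), ex_RInt_pos; auto; lra.
        -- apply HP. apply K; auto.
    + apply is_lim_seq_spec. intros eps. destruct (Hlim eps) as (u0 & v0 & Hu0 & Hv0 & K).
      assert (L1 := is_lim_seq_inv_INR2). apply is_lim_seq_spec in L1.
      destruct (L1 (mkposreal u0 Hu0)) as [N1 H1].
      destruct (INR_unbounded v0) as [N2 H2].
      exists (N1 + N2)%nat. intros n Hn. apply K.
      * assert (Z := inv_INR2_range n). specialize (H1 n ltac:(lia)). simpl in H1.
        rewrite Rminus_0_r, Rabs_pos_eq in H1; lra.
      * assert (INR N2 <= INR (n + 2))%R by (apply le_INR; lia). lra.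
Qed.

Definition gamma_integrand (x t : R) : R := (Rpower t (x - 1) * exp (- t))%R.

Lemma gamma_integrand_continuous x t : (0 < t)%R -> continuous (gamma_integrand x) t.
Proof.
  intros Ht. apply (ex_derive_continuous (K := R_AbsRing) (V := R_NormedModule)).
  unfold gamma_integrand, Rpower. auto_derive. auto.
Qed.

Lemma gamma_integrand_pos x t : (0 <= gamma_integrand x t)%R.
Proof. unfold gamma_integrand, Rpower. left. apply Rmult_lt_0_compat; apply exp_pos. Qed.

Lemma ln_le_m1 z : (0 < z)%R -> (ln z <= z - 1)%R.
Proof.
  intros Hz. assert (K := exp_ineq1_le (ln z)). rewrite exp_ln in K; lra.
Qed.

(** From [ln z <= z - 1] at [z = t / (2y)]. *)
Lemma Rpower_exp_le y : exists K, (0 < K)%R /\ forall t, (1 <= t)%R ->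
  (Rpower t y * exp (- t) <= K * exp (- (t / 2)))%R.
Proof.
  destruct (Rle_dec y 0) as [Hy|Hy].
  - exists 1%R. split; [lra|]. intros t Ht. rewrite Rmult_1_l. unfold Rpower.
    rewrite <- exp_plus. apply exp_le.
    assert (0 <= ln t)%R by (rewrite <- ln_1; apply ln_le; lra). nra.
  - exists (exp (y * ln (2 * y))). split; [apply exp_pos|]. intros t Ht. unfold Rpower.
    rewrite <- !exp_plus. apply exp_le.
    assert (K := ln_le_m1 (t / (2 * y)) ltac:(apply Rdiv_lt_0_compat; lra)).
    rewrite ln_div in K by lra.
    assert (K2 : (y * (ln t - ln (2 * y)) <= y * (t / (2 * y) - 1))%R) by (apply Rmult_le_compat_l; lra).
    replace (y * (t / (2 * y) - 1))%R with (t / 2 - y)%R in K2 by (field; lra). lra.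
Qed.

Lemma exp_le_1 x : (x <= 0)%R -> (exp x <= 1)%R.
Proof. intros H. rewrite <- exp_0. now apply exp_le. Qed.

Lemma gamma_integral_bounded x : (0 < x)%R -> exists B, forall u v,
  (0 < u <= 1)%R -> (1 <= v)%R -> (RInt (gamma_integrand x) u v <= B)%R.
Proof.
  intros Hx. destruct (Rpower_exp_le (x - 1)) as (K & HK & HKt).
  exists (/ x + 2 * K)%R. intros u v Hu Hv.
  assert (Hc := gamma_integrand_continuous x).
  assert (E := RInt_Chasles (gamma_integrand x) u 1 v
    (ex_RInt_pos _ u 1 Hc ltac:(lra) ltac:(lra)) (ex_RInt_pos _ 1 v Hc ltac:(lra) ltac:(lra))).
  change (RInt (gamma_integrand x) u 1 + RInt (gamma_integrand x) 1 v = RInt (gamma_integrand x) u v)%R in E.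
  assert (B1 : (RInt (gamma_integrand x) u 1 <= / x)%R).
  { assert (I : is_RInt (fun t => Rpower t (x - 1)) u 1 (Rpower 1 x / x - Rpower u x / x)%R).
    { apply (is_RInt_derive (fun t => Rpower t x / x)%R (fun t => Rpower t (x - 1))).
      - intros t [Ht _]. rewrite Rmin_left in Ht by lra. unfold Rpower.
        auto_derive; [lra|].
        replace ((x - 1) * ln t)%R with (x * ln t + - ln t)%R by ring.
        rewrite exp_plus, exp_Ropp, exp_ln by lra. field. lra.
      - intros t [Ht _]. rewrite Rmin_left in Ht by lra.
        apply (ex_derive_continuous (K := R_AbsRing) (V := R_NormedModule)).
        unfold Rpower. auto_derive. lra. }
    apply Rle_trans with (RInt (fun t => Rpower t (x - 1)) u 1).
    - apply RInt_le; [lra | apply ex_RInt_pos; auto; lra | eexists; exact I |].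
      intros t Ht. unfold gamma_integrand. rewrite <- (Rmult_1_r (Rpower t (x - 1))) at 2.
      apply Rmult_le_compat_l; [left; apply exp_pos|]. rewrite <- exp_0. apply exp_le. lra.
    - rewrite (is_RInt_unique _ _ _ _ I).
      assert (0 < Rpower u x / x)%R by (apply Rdiv_lt_0_compat; auto; apply exp_pos).
      replace (Rpower 1 x) with 1%R by (unfold Rpower; rewrite ln_1, Rmult_0_r, exp_0; reflexivity).
      unfold Rdiv at 1. rewrite Rmult_1_l. lra. }
  assert (B2 : (RInt (gamma_integrand x) 1 v <= 2 * K)%R).
  { assert (I : is_RInt (fun t => K * exp (- (t / 2)))%R 1 v (- (2 * K) * exp (- (v / 2)) - - (2 * K) * exp (- (1 / 2)))%R).
    { apply (is_RInt_derive (fun t => - (2 * K) * exp (- (t / 2)))%R (fun t => K * exp (- (t / 2)))%R).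
      - intros t _. auto_derive; auto. unfold Rdiv. field.
      - intros t _. apply (ex_derive_continuous (K := R_AbsRing) (V := R_NormedModule)). auto_derive. auto. }
    apply Rle_trans with (RInt (fun t => K * exp (- (t / 2)))%R 1 v).
    - apply RInt_le; [lra | apply ex_RInt_pos; auto; lra | eexists; exact I |].
      intros t Ht. apply HKt. lra.
    - rewrite (is_RInt_unique _ _ _ _ I).
      assert (0 < exp (- (v / 2)))%R by apply exp_pos.
      assert (exp (- (1 / 2)) <= 1)%R by (apply exp_le_1; lra).
      assert (0 < K * exp (- (v / 2)))%R by (now apply Rmult_lt_0_compat).
      assert (K * exp (- (1 / 2)) <= K * 1)%R by (apply Rmult_le_compat_l; lra). lra. }
  lra.
Qed.

Definition gamma_seq (x : R) (n : nat) : R := RInt (gamma_integrand x) (/ INR (n + 2)) (INR (n + 2)).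

Lemma gamma_seq_lim x : (0 < x)%R -> is_lim_seq (gamma_seq x) (Gamma x).
Proof.
  intros Hx. destruct (gamma_integral_bounded x Hx) as [B HB].
  destruct (improper_integral_pos (gamma_integrand x) B) as (l & H1 & H2); auto.
  - apply gamma_integrand_continuous.
  - intros; apply gamma_integrand_pos.
  - assert (E : Gamma x = l).
    { unfold Gamma. apply (is_RInt_gen_unique (gamma_integrand x) l H1). }
    rewrite E. exact H2.
Qed.

Lemma INR2_range n : (2 <= INR (n + 2))%R.
Proof. apply (le_INR 2). lia. Qed.

Lemma ex_RInt_gamma x n : ex_RInt (gamma_integrand x) (/ INR (n + 2)) (INR (n + 2)).
Proof.
  assert (H := INR2_range n). apply ex_RInt_pos; [apply gamma_integrand_continuous | | lra].
  apply Rinv_0_lt_compat. lra.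
Qed.

Lemma Gamma_nonneg x : (0 < x)%R -> (0 <= Gamma x)%R.
Proof.
  intros Hx. apply (is_lim_seq_le (fun _ => 0%R) (gamma_seq x) 0%R (Gamma x)).
  - intros n. assert (H := INR2_range n). assert (H1 := inv_INR2_range n).
    apply RInt_ge_0; [lra | apply ex_RInt_gamma | intros; apply gamma_integrand_pos].
  - apply is_lim_seq_const.
  - now apply gamma_seq_lim.
Qed.

Lemma is_lim_seq_exp_neg_half : is_lim_seq (fun n => exp (- (INR (n + 2) / 2))) 0%R.
Proof.
  apply is_lim_seq_0_le with (fun n => 2 * / INR (n + 1))%R.
  - intros n. split; [left; apply exp_pos|]. rewrite exp_Ropp.
    assert (H := INR_S_ge_1 n). assert (K := exp_ineq1_le (INR (n + 2) / 2)).
    replace (INR (n + 2)) with (INR (n + 1) + 1)%R in * by (rewrite !plus_INR; simpl; ring).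
    replace (2 * / INR (n + 1))%R with (/ (INR (n + 1) / 2))%R by (field; lra).
    apply Rinv_le_contravar; lra.
  - apply is_lim_seq_scal_0, is_lim_seq_inv_INR.
Qed.

Lemma is_lim_seq_Rpower_inv x : (0 < x)%R -> is_lim_seq (fun n => Rpower (/ INR (n + 2)) x) 0%R.
Proof.
  intros Hx.
  assert (L : is_lim_seq (fun n => x * ln (INR (n + 2)))%R p_infty).
  { replace p_infty with (Rbar_mult x p_infty).
    - apply is_lim_seq_scal_l. apply (is_lim_comp_seq ln (fun n => INR (n + 2)) p_infty p_infty).
      + apply is_lim_ln_p.
      + exists 0%nat. intros; discriminate.
      + apply (is_lim_seq_incr_n INR 2), is_lim_seq_INR.
    - unfold Rbar_mult. simpl. destruct (Rle_dec 0 x); [|lra].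
      destruct (Rle_lt_or_eq_dec 0 x _); [reflexivity | lra]. }
  assert (L2 : is_lim_seq (fun n => - (x * ln (INR (n + 2))))%R m_infty).
  { apply (is_lim_seq_opp _ p_infty). exact L. }
  apply is_lim_seq_ext with (fun n => exp (- (x * ln (INR (n + 2))))).
  - intros n. unfold Rpower. f_equal. assert (H := INR2_range n). rewrite ln_Rinv by lra. ring.
  - apply (is_lim_comp_seq exp _ m_infty 0%R); [apply is_lim_exp_m | exists 0%nat; intros; discriminate | exact L2].
Qed.

(** Integration by parts on the exhausting intervals; the boundary terms tend to 0. *)
Lemma Gamma_succ x : (0 < x)%R -> Gamma (x + 1) = (x * Gamma x)%R.
Proof.
  intros Hx.
  set (h := fun t => (- (Rpower t x * exp (- t)))%R).
  assert (E : forall n, (x * gamma_seq x n + (h (INR (n + 2)) - h (/ INR (n + 2))))%R = gamma_seq (x + 1) n).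
  { intros n. assert (H2 := INR2_range n). assert (H1 := inv_INR2_range n).
    symmetry. apply is_RInt_unique.
    apply (is_RInt_ext (fun t => plus (scal x (gamma_integrand x t)) (gamma_integrand (x + 1) t - x * gamma_integrand x t)%R)).
    { intros t _. unfold plus, scal, mult. simpl. unfold mult. simpl. ring. }
    apply (is_RInt_plus (V := R_NormedModule)).
    - apply (is_RInt_scal (V := R_NormedModule)). apply (RInt_correct (gamma_integrand x)), ex_RInt_gamma.
    - apply (is_RInt_derive h (fun t => gamma_integrand (x + 1) t - x * gamma_integrand x t)%R).
      + intros t [Ht _]. rewrite Rmin_left in Ht by lra. unfold h, gamma_integrand, Rpower.
        auto_derive; [lra|].
        replace ((x + 1 - 1) * ln t)%R with (x * ln t)%R by ring.
        replace ((x - 1) * ln t)%R with (x * ln t + - ln t)%R by ring.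
        rewrite exp_plus, (exp_Ropp (ln t)), exp_ln by lra. field. lra.
      + intros t [Ht _]. rewrite Rmin_left in Ht by lra.
        apply (ex_derive_continuous (K := R_AbsRing) (V := R_NormedModule)).
        unfold gamma_integrand, Rpower. auto_derive. split; [lra | split; [lra | auto]]. }
  assert (L : is_lim_seq (fun n => x * gamma_seq x n + (h (INR (n + 2)) - h (/ INR (n + 2))))%R
      (x * Gamma x + (0 - 0))%R).
  { apply is_lim_seq_plus'.
    - apply is_lim_seq_mult'; [apply is_lim_seq_const | now apply gamma_seq_lim].
    - apply is_lim_seq_minus'; unfold h.
      + replace (Finite 0) with (Rbar_opp 0%R) by (simpl; f_equal; ring).
        destruct (Rpower_exp_le x) as (K & HK & HKt).
        apply (is_lim_seq_opp _ 0%R).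
        apply is_lim_seq_0_le with (fun n => K * exp (- (INR (n + 2) / 2)))%R.
        * intros n. split; [left; apply Rmult_lt_0_compat; apply exp_pos|].
          apply HKt. assert (Z := INR2_range n). lra.
        * apply is_lim_seq_scal_0, is_lim_seq_exp_neg_half.
      + replace (Finite 0) with (Rbar_opp 0%R) by (simpl; f_equal; ring).
        apply (is_lim_seq_opp _ 0%R).
        apply is_lim_seq_0_le with (fun n => Rpower (/ INR (n + 2)) x); [|now apply is_lim_seq_Rpower_inv].
        intros n. split; [left; apply Rmult_lt_0_compat; apply exp_pos|].
        rewrite <- (Rmult_1_r (Rpower _ x)) at 2. apply Rmult_le_compat_l; [left; apply exp_pos|].
        rewrite <- exp_0. apply exp_le. assert (Z := inv_INR2_range n). lra. }
  assert (L2 := gamma_seq_lim (x + 1) ltac:(lra)).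
  apply is_lim_seq_ext with (v := gamma_seq (x + 1)) in L; [|exact E].
  apply is_lim_seq_unique in L. apply is_lim_seq_unique in L2. rewrite L in L2.
  injection L2. intros <-. ring.
Qed.

Lemma Gamma_1 : Gamma 1 = 1%R.
Proof.
  assert (L := gamma_seq_lim 1 ltac:(lra)).
  assert (E : forall n, (exp (- / INR (n + 2)) - exp (- INR (n + 2)))%R = gamma_seq 1 n).
  { intros n. symmetry. apply is_RInt_unique.
    replace (exp (- / INR (n + 2)) - exp (- INR (n + 2)))%R
      with (- exp (- INR (n + 2)) - - exp (- / INR (n + 2)))%R by ring.
    apply (is_RInt_ext (fun t => exp (- t))).
    { intros t _. unfold gamma_integrand, Rpower. rewrite Rminus_diag, Rmult_0_l, exp_0.
      symmetry. apply Rmult_1_l. }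
    apply (is_RInt_derive (fun t => - exp (- t))%R (fun t => exp (- t))).
    - intros t _. auto_derive; auto. ring.
    - intros t _. apply (ex_derive_continuous (K := R_AbsRing) (V := R_NormedModule)). auto_derive. auto. }
  assert (L2 : is_lim_seq (fun n => exp (- / INR (n + 2)) - exp (- INR (n + 2)))%R (exp (- 0) - 0)%R).
  { apply is_lim_seq_minus'.
    - apply (is_lim_seq_continuous exp (fun n => - / INR (n + 2))%R (- 0)%R).
      + apply derivable_continuous_pt, derivable_pt_exp.
      + apply (is_lim_seq_opp _ 0%R), is_lim_seq_inv_INR2.
    - apply is_lim_seq_0_le with (2 := is_lim_seq_exp_neg_half).
      intros n. split; [left; apply exp_pos | apply exp_le]. assert (Z := INR2_range n). lra. }
  apply is_lim_seq_ext with (v := gamma_seq 1) in L2; [|exact E].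
  apply is_lim_seq_unique in L. apply is_lim_seq_unique in L2. rewrite L2 in L.
  injection L. intros <-. rewrite Ropp_0, exp_0. ring.
Qed.

(** Weighted arithmetic-geometric inequality for the numbers 1 and [r]. *)
Lemma Rpower_le_affine r s : (0 < r)%R -> (0 < s < 1)%R -> (Rpower r s <= 1 - s + s * r)%R.
Proof.
  intros Hr Hs. set (m := (1 - s + s * r)%R).
  assert (Hm : (0 < m)%R) by (unfold m; nra).
  unfold Rpower. rewrite <- (exp_ln m) by auto. apply exp_le.
  assert (K1 := ln_le_m1 (/ m) ltac:(now apply Rinv_0_lt_compat)). rewrite ln_Rinv in K1 by auto.
  assert (K2 := ln_le_m1 (r / m) ltac:(now apply Rdiv_lt_0_compat)). rewrite ln_div in K2 by auto.
  assert (K3 : ((1 - s) * (- ln m) <= (1 - s) * (/ m - 1))%R) by (apply Rmult_le_compat_l; lra).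
  assert (K4 : (s * (ln r - ln m) <= s * (r / m - 1))%R) by (apply Rmult_le_compat_l; lra).
  assert (E : ((1 - s) * (/ m - 1) + s * (r / m - 1) = 0)%R).
  { replace ((1 - s) * (/ m - 1) + s * (r / m - 1))%R with ((1 - s + s * r) / m - 1)%R by (field; lra).
    fold m. field. lra. }
  lra.
Qed.

(** Wendel's inequality, a substitute for the log-convexity of Gamma and for
    Stirling's formula: integrate [Rpower_le_affine] at [r = t / y]. *)
Lemma Gamma_add_le y s : (0 < y)%R -> (0 < s < 1)%R -> (Gamma (y + s) <= Rpower y s * Gamma y)%R.
Proof.
  intros Hy Hs.
  assert (L : is_lim_seq (fun n => Rpower y s * ((1 - s) * gamma_seq y n + s / y * gamma_seq (y + 1) n))%R
     (Rpower y s * ((1 - s) * Gamma y + s / y * Gamma (y + 1)))%R).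
  { apply is_lim_seq_mult'; [apply is_lim_seq_const|].
    apply is_lim_seq_plus'; apply is_lim_seq_mult'; try apply is_lim_seq_const; apply gamma_seq_lim; lra. }
  rewrite Gamma_succ in L by auto.
  replace ((1 - s) * Gamma y + s / y * (y * Gamma y))%R with (Gamma y) in L by (field; lra).
  apply (is_lim_seq_le (gamma_seq (y + s)) _ (Gamma (y + s)) (Rpower y s * Gamma y)%R) with (3 := L);
    [|apply gamma_seq_lim; lra].
  intros n. assert (H2 := INR2_range n). assert (H1 := inv_INR2_range n).
  assert (I : is_RInt (fun t => Rpower y s * ((1 - s) * gamma_integrand y t + s / y * gamma_integrand (y + 1) t))%R
     (/ INR (n + 2)) (INR (n + 2)) (Rpower y s * ((1 - s) * gamma_seq y n + s / y * gamma_seq (y + 1) n))%R).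
  { apply (is_RInt_scal (V := R_NormedModule)). apply (is_RInt_plus (V := R_NormedModule));
      apply (is_RInt_scal (V := R_NormedModule)); apply (RInt_correct (gamma_integrand _)), ex_RInt_gamma. }
  rewrite <- (is_RInt_unique _ _ _ _ I).
  apply RInt_le; [lra | apply ex_RInt_gamma | eexists; exact I |].
  intros t Ht. assert (Ht0 : (0 < t)%R) by lra. unfold gamma_integrand.
  assert (E1 : Rpower t (y + s - 1) = (Rpower t (y - 1) * (Rpower y s * Rpower (t / y) s))%R).
  { unfold Rpower. rewrite <- !exp_plus. f_equal. rewrite ln_div by auto. ring. }
  assert (E2 : Rpower t (y + 1 - 1) = (Rpower t (y - 1) * t)%R).
  { replace (y + 1 - 1)%R with (y - 1 + 1)%R by ring. rewrite Rpower_plus, Rpower_1; auto. }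
  rewrite E1, E2.
  assert (K := Rpower_le_affine (t / y) s ltac:(now apply Rdiv_lt_0_compat) Hs).
  assert (P1 : (0 < Rpower t (y - 1) * Rpower y s * exp (- t))%R)
    by (repeat apply Rmult_lt_0_compat; apply exp_pos).
  replace (Rpower t (y - 1) * (Rpower y s * Rpower (t / y) s) * exp (- t))%R
    with (Rpower t (y - 1) * Rpower y s * exp (- t) * Rpower (t / y) s)%R by ring.
  replace (Rpower y s * ((1 - s) * (Rpower t (y - 1) * exp (- t)) + s / y * (Rpower t (y - 1) * t * exp (- t))))%R
    with (Rpower t (y - 1) * Rpower y s * exp (- t) * (1 - s + s * (t / y)))%R by (field; lra).
  apply Rmult_le_compat_l; lra.
Qed.

Lemma Gamma_S n : Gamma (INR (n + 1)) = INR (fact n).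
Proof.
  induction n as [|n IH].
  - simpl. apply Gamma_1.
  - replace (S n + 1)%nat with (S (n + 1)) by lia. rewrite S_INR, Gamma_succ, IH.
    + rewrite fact_simpl, mult_INR, Nat.add_1_r. reflexivity.
    + assert (K := INR_S_ge_1 n). lra.
Qed.

(** Iterating the functional equation turns the product of the two Gamma values into a
    partial sine product. *)
Lemma Gamma_sine_log n x : (0 < x < 1)%R ->
  (Gamma (INR (n + 1) + x) * Gamma (INR (n + 1) + 1 - x) =
   Gamma x * Gamma (1 - x) * x * (INR (n + 1) - x) * INR (fact n) ^ 2 * exp (sine_log n x))%R.
Proof.
  intros Hx. induction n as [|n IH].
  - simpl INR. simpl sine_log. rewrite exp_0. simpl fact. simpl INR.
    replace (1 + x)%R with (x + 1)%R by ring.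
    replace (1 + 1 - x)%R with ((1 - x) + 1)%R by ring.
    rewrite !Gamma_succ by lra. ring.
  - rewrite sine_log_S, exp_plus, exp_ln by now apply one_m_sq_pos.
    assert (K := INR_S_ge_1 n).
    replace (INR (S n + 1)) with (INR (n + 1) + 1)%R by (replace (S n + 1)%nat with (S (n + 1)) by lia; now rewrite S_INR).
    replace (INR (n + 1) + 1 + x)%R with (INR (n + 1) + x + 1)%R by ring.
    replace (INR (n + 1) + 1 + 1 - x)%R with (INR (n + 1) + 1 - x + 1)%R by ring.
    rewrite !(Gamma_succ (_ + _)) by lra. rewrite (Gamma_succ (INR (n + 1) + 1 - x)) by lra.
    replace ((INR (n + 1) + x) * Gamma (INR (n + 1) + x) * ((INR (n + 1) + 1 - x) * Gamma (INR (n + 1) + 1 - x)))%R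
      with ((INR (n + 1) + x) * (INR (n + 1) + 1 - x) * (Gamma (INR (n + 1) + x) * Gamma (INR (n + 1) + 1 - x)))%R by ring.
    rewrite IH, fact_simpl, mult_INR. replace (INR (S n)) with (INR (n + 1)) by (f_equal; lia).
    field. lra.
Qed.

(** By Wendel's inequality the left side of [Gamma_sine_log] is asymptotic to [n
    n!^2], so the sine product can be compared with [Gamma x * Gamma (1 - x)] in the
    limit. *)
Theorem Gamma_reflection x : (0 < x < 1)%R -> (Gamma x * Gamma (1 - x) = PI / sin (PI * x))%R.
Proof.
  intros Hx. assert (HPI := PI_RGT_0). assert (Hs := sin_PI_pos x Hx).
  set (g := (Gamma x * Gamma (1 - x))%R).
  set (u := fun n => (g * x * (1 - x * / INR (n + 2)) * exp (sine_log (S n) x))%R).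
  assert (HL : is_lim_seq u (g * x * (1 - x * 0) * (sin (PI * x) / (PI * x)))%R).
  { apply is_lim_seq_mult'; [|now apply sine_product].
    apply is_lim_seq_mult'; [apply is_lim_seq_const|].
    apply is_lim_seq_minus'; [apply is_lim_seq_const|].
    apply is_lim_seq_mult'; [apply is_lim_seq_const | apply is_lim_seq_inv_INR2]. }
  assert (Hb : forall n, (1 - / INR (n + 3) <= u n <= 1)%R).
  { intros n. assert (E := Gamma_sine_log (S n) x Hx).
    replace (S n + 1)%nat with (n + 2)%nat in E by lia.
    assert (HN := INR2_range n).
    assert (EN : INR (n + 3) = (INR (n + 2) + 1)%R) by (rewrite !plus_INR; simpl; ring).
    set (N := INR (n + 2)) in *. set (F := INR (fact (S n))) in *.
    assert (HF : (0 < F)%R) by apply INR_fact_lt_0.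
    assert (HF2 : (0 < F ^ 2)%R) by now apply pow_lt.
    assert (EF : Gamma N = F).
    { unfold N, F. rewrite <- Gamma_S. f_equal. f_equal. lia. }
    assert (EF1 : Gamma (N + 1) = (N * F)%R) by (rewrite Gamma_succ, EF; lra).
    assert (Eu : (Gamma (N + x) * Gamma (N + 1 - x) = u n * (N * F ^ 2))%R).
    { rewrite E. unfold u. fold g N. field. lra. }
    assert (G1 := Gamma_add_le N x ltac:(lra) Hx).
    assert (G2 := Gamma_add_le N (1 - x) ltac:(lra) ltac:(lra)).
    assert (G3 := Gamma_add_le (N + x) (1 - x) ltac:(lra) ltac:(lra)).
    assert (G4 := Gamma_add_le (N + 1 - x) x ltac:(lra) ltac:(lra)).
    replace (N + (1 - x))%R with (N + 1 - x)%R in G2 by ring.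
    replace (N + x + (1 - x))%R with (N + 1)%R in G3 by ring.
    replace (N + 1 - x + x)%R with (N + 1)%R in G4 by ring.
    rewrite EF in G1, G2. rewrite EF1 in G3, G4.
    assert (P1 := Gamma_nonneg (N + x) ltac:(lra)). assert (P2 := Gamma_nonneg (N + 1 - x) ltac:(lra)).
    (* With [N = n + 2] and [F = (n + 1)!], the two inequalities from [N] give the upper
       bound, and those ending at [N + 1] the lower bound. *)
    assert (R1 : (Rpower N x * Rpower N (1 - x) = N)%R).
    { rewrite <- Rpower_plus. replace (x + (1 - x))%R with 1%R by ring. apply Rpower_1. lra. }
    assert (R2 : (Rpower (N + x) (1 - x) * Rpower (N + 1 - x) x <= N + 1)%R).
    { rewrite <- (Rpower_1 (N + 1)) at 2 by lra. replace 1%R with ((1 - x) + x)%R at 4 by ring.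
      rewrite Rpower_plus. apply Rmult_le_compat; try (left; apply exp_pos); apply Rle_Rpower_l; lra. }
    split.
    - assert (M : (N * F * (N * F) <= Rpower (N + x) (1 - x) * Gamma (N + x) * (Rpower (N + 1 - x) x * Gamma (N + 1 - x)))%R).
      { apply Rmult_le_compat; auto; apply Rmult_le_pos; lra. }
      replace (Rpower (N + x) (1 - x) * Gamma (N + x) * (Rpower (N + 1 - x) x * Gamma (N + 1 - x)))%R
        with (Rpower (N + x) (1 - x) * Rpower (N + 1 - x) x * (Gamma (N + x) * Gamma (N + 1 - x)))%R in M by ring.
      assert (M2 : (N * F * (N * F) <= (N + 1) * (Gamma (N + x) * Gamma (N + 1 - x)))%R).
      { eapply Rle_trans; [exact M|]. apply Rmult_le_compat_r; auto. now apply Rmult_le_pos. }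
      rewrite Eu in M2.
      assert (M3 : (N * F ^ 2 * N <= N * F ^ 2 * ((N + 1) * u n))%R) by lra.
      apply Rmult_le_reg_l in M3; [|apply Rmult_lt_0_compat; lra].
      rewrite EN. apply Rmult_le_reg_l with (N + 1)%R; [lra|].
      replace ((N + 1) * (1 - / (N + 1)))%R with N by (field; lra). exact M3.
    - assert (M : (Gamma (N + x) * Gamma (N + 1 - x) <= Rpower N x * F * (Rpower N (1 - x) * F))%R).
      { apply Rmult_le_compat; auto. }
      replace (Rpower N x * F * (Rpower N (1 - x) * F))%R with (Rpower N x * Rpower N (1 - x) * F ^ 2)%R in M by ring.
      rewrite R1, Eu in M.
      apply Rmult_le_reg_r with (N * F ^ 2)%R; [apply Rmult_lt_0_compat; lra | lra]. }
  assert (HL1 : is_lim_seq u 1%R).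
  { apply is_lim_seq_le_le with (u := fun n => (1 - / INR (n + 3))%R) (w := fun _ => 1%R); auto.
    - replace (Finite 1) with (Finite (1 - 0)) by (f_equal; ring).
      apply is_lim_seq_minus'; [apply is_lim_seq_const|].
      apply is_lim_seq_ext with (fun n => / INR (n + 2 + 1))%R; [intros n; do 2 f_equal; lia|].
      apply (is_lim_seq_incr_n (fun n => / INR (n + 1))%R 2), is_lim_seq_inv_INR.
    - apply is_lim_seq_const. }
  apply is_lim_seq_unique in HL. apply is_lim_seq_unique in HL1. rewrite HL1 in HL.
  injection HL. intros E.
  replace g with (g * x * (1 - x * 0) * (sin (PI * x) / (PI * x)) * (PI / sin (PI * x)))%R by (field; lra).
  rewrite <- E. ring.
Qed.

(** * Sums over the pairs 1 <= h < j < m *)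

Definition pairsum (f : nat -> C) (m : nat) : C :=
  Csum (map (fun hj => f (fst hj + snd hj)%nat) (index_pairs m)).

Lemma Csum_seq (f : nat -> C) a n : Csum (map f (seq a n)) = psum (fun k => f (a + k)%nat) n.
Proof.
  unfold psum. f_equal. rewrite <- (map_map (fun k => (a + k)%nat) f). f_equal.
  revert a. induction n as [|n IH]; intros a; simpl; [reflexivity|].
  f_equal; [lia|]. rewrite IH, <- seq_shift, map_map. apply map_ext. intros; lia.
Qed.

Lemma pairsum_1 f : pairsum f 1 = 0.
Proof. reflexivity. Qed.

Lemma pairsum_S f n :
  pairsum f (S (S n)) = pairsum f (S n) + psum (fun h => f (h + n + 2)%nat) n.
Proof.
  unfold pairsum, index_pairs.
  replace (S (S n) - 1)%nat with (S n) by lia. replace (S n - 1)%nat with n by lia.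
  rewrite seq_S, flat_map_app, map_app, Csum_app. f_equal. simpl flat_map.
  rewrite app_nil_r, map_map. simpl fst. simpl snd.
  replace (n - 0)%nat with n by lia. rewrite Csum_seq. apply psum_ext. intros k _. f_equal. lia.
Qed.

Lemma pairsum_ext f g m :
  (forall s, (0 < s < 2 * m)%nat -> f s = g s) -> pairsum f m = pairsum g m.
Proof.
  intros H. unfold pairsum. f_equal. apply map_ext_in. intros hj Hin.
  apply in_index_pairs in Hin. apply H. lia.
Qed.

Lemma pairsum_plus f g m : pairsum (fun s => f s + g s) m = pairsum f m + pairsum g m.
Proof.
  unfold pairsum. induction (index_pairs m) as [|a l IH]; simpl; [ring|]. rewrite IH. ring.
Qed.

Lemma pairsum_scal c f m : pairsum (fun s => c * f s) m = c * pairsum f m.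
Proof.
  unfold pairsum. induction (index_pairs m) as [|a l IH]; simpl; [ring|]. rewrite IH. ring.
Qed.

Lemma Cser_pairsum (u : nat -> nat -> C) (v : nat -> C) m :
  (forall s, (0 < s < 2 * m)%nat -> Cser (u s) (v s)) ->
  Cser (fun k => pairsum (fun s => u s k) m) (pairsum v m).
Proof.
  intros H. unfold pairsum.
  apply (Cser_Csum (index_pairs m) (fun hj => u (fst hj + snd hj)%nat) (fun hj => v (fst hj + snd hj)%nat)).
  intros hj Hin. apply in_index_pairs in Hin. apply H. lia.
Qed.

(** Completing the triangle [h < j] to a square reduces the sum to products of
    geometric sums. *)
Lemma pairsum_square f n :
  2 * pairsum f (S n) = psum (fun h => psum (fun j => f (h + j + 2)%nat) n) n
                        - psum (fun h => f (2 * h + 2)%nat) n.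
Proof.
  induction n as [|n IH].
  - rewrite pairsum_1, !psum_0. ring.
  - rewrite pairsum_S, Cmult_plus_distr_l, IH, !(psum_S _ n).
    replace (psum (fun h => psum (fun j => f (h + j + 2)%nat) (S n)) n)
      with (psum (fun h => psum (fun j => f (h + j + 2)%nat) n + f (h + n + 2)%nat) n)
      by (apply psum_ext; intros; rewrite psum_S; reflexivity).
    rewrite psum_plus.
    replace (psum (fun j => f (n + j + 2)%nat) n) with (psum (fun h => f (h + n + 2)%nat) n)
      by (apply psum_ext; intros; f_equal; lia).
    replace (n + n + 2)%nat with (2 * n + 2)%nat by lia. ring.
Qed.

Lemma psum_shift u n : psum u (S n) = u 0%nat + psum (fun k => u (S k)) n.
Proof.
  induction n as [|n IH]; [rewrite psum_S, !psum_0; ring|].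
  rewrite psum_S, IH, psum_S. ring.
Qed.

Lemma psum_rev u n : psum u n = psum (fun k => u (n - 1 - k)%nat) n.
Proof.
  induction n as [|n IH]; [reflexivity|].
  rewrite (psum_shift (fun k => u (S n - 1 - k)%nat)), psum_S, IH.
  replace (S n - 1 - 0)%nat with n by lia.
  rewrite (psum_ext (fun k => u (S n - 1 - S k)%nat) (fun k => u (n - 1 - k)%nat))
    by (intros; f_equal; lia). ring.
Qed.

Lemma C2_inj (a b : C) : 2 * a = 2 * b -> a = b.
Proof.
  intros H. replace a with (2 * a / 2) by field. rewrite H. field.
Qed.

(** The reflection [(h, j) -> (m - j, m - h)] permutes the pairs. It is what lets
    residues [s] and [2m - s] be grouped into generalized eta products. *)
Lemma pairsum_sym f m : (0 < m)%nat -> pairsum f m = pairsum (fun s => f (2 * m - s)%nat) m.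
Proof.
  intros Hm. destruct m as [|n]; [lia|]. apply C2_inj. rewrite !pairsum_square. f_equal.
  - rewrite (psum_rev _ n). apply psum_ext. intros h Hh.
    cbv beta. rewrite (psum_rev _ n). apply psum_ext. intros j Hj. f_equal. lia.
  - rewrite (psum_rev _ n). apply psum_ext. intros h Hh. f_equal. lia.
Qed.

Lemma psum_RtoC_shift_sq p n :
  psum (fun h => RtoC ((INR h + p) ^ 2)) n =
  RtoC (INR n * p ^ 2 + p * INR n * (INR n - 1) + (INR n - 1) * INR n * (2 * INR n - 1) / 6).
Proof.
  induction n as [|n IH].
  - rewrite psum_0. f_equal. simpl. field.
  - rewrite psum_S, IH, <- RtoC_plus, S_INR. f_equal. field.
Qed.

Lemma psum_RtoC_shift p n :
  psum (fun h => RtoC (INR h + p)) n = RtoC (INR n * p + INR n * (INR n - 1) / 2).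
Proof.
  induction n as [|n IH].
  - rewrite psum_0. f_equal. simpl. field.
  - rewrite psum_S, IH, <- RtoC_plus, S_INR. f_equal. field.
Qed.

Lemma psum_const c n : psum (fun _ => c) n = RtoC (INR n) * c.
Proof.
  induction n as [|n IH].
  - rewrite psum_0. simpl. ring.
  - rewrite psum_S, IH, S_INR, RtoC_plus. ring.
Qed.

(** The case of a constant counts the pairs; the Bernoulli polynomial of [s / (2m)]
    gives the coefficient of [tau] in the exponent. *)
Lemma pairsum_quadratic al be ga n :
  pairsum (fun s => RtoC (al * INR s ^ 2 + be * INR s + ga)) (S n) =
  RtoC (al * (INR n * (INR n + 1) * (INR n - 1) * (7 * INR n + 4) / 12)
        + be * (INR n * (INR n + 1) * (INR n - 1) / 2) + ga * (INR n * (INR n - 1) / 2)).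
Proof.
  induction n as [|n IH].
  - rewrite pairsum_1. f_equal. simpl. field.
  - rewrite pairsum_S, IH.
    rewrite (psum_ext _ (fun h => (RtoC al * RtoC ((INR h + (INR n + 2)) ^ 2)
        + RtoC be * RtoC (INR h + (INR n + 2))) + RtoC ga)).
    2:{ intros k _. rewrite !plus_INR. simpl (INR 2). replace (1 + 1)%R with 2%R by ring.
        replace (INR k + INR n + 2)%R with (INR k + (INR n + 2))%R by ring.
        rewrite !RtoC_plus, !RtoC_mult, !RtoC_plus. ring. }
    rewrite psum_plus, psum_plus, !psum_scal, psum_const, psum_RtoC_shift_sq, psum_RtoC_shift.
    rewrite <- !RtoC_mult, <- !RtoC_plus, S_INR. f_equal. field.
Qed.

Lemma pairsum_const c n : pairsum (fun _ => c) (S n) = RtoC (INR n * (INR n - 1) / 2) * c.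
Proof.
  assert (H := pairsum_quadratic 0 0 1 n).
  rewrite (pairsum_ext _ (fun s => c * RtoC (0 * INR s ^ 2 + 0 * INR s + 1))).
  - rewrite pairsum_scal, H, Cmult_comm. f_equal. f_equal. field.
  - intros s _. replace (0 * INR s ^ 2 + 0 * INR s + 1)%R with 1%R by ring. ring.
Qed.

(** * The trigonometric sum over pairs *)

Lemma psum_geom_from_1 (e : C) n : (1 - e) * psum (fun h => e ^ (h + 1)) n = e - e ^ (n + 1).
Proof.
  rewrite (psum_ext _ (fun h => e * e ^ h)) by (intros; rewrite Cpow_add_r, Cpow_1_r; ring).
  rewrite psum_scal, Cpow_add_r, Cpow_1_r.
  assert (G := psum_geom e n). change (fun j => e ^ j) with (Cpow e) in G.
  replace ((1 - e) * (e * psum (Cpow e) n)) with (e * (psum (Cpow e) n * (1 - e))) by ring.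
  rewrite G. ring.
Qed.

Lemma pairsum_pow (e : C) n :
  2 * pairsum (fun s => e ^ s) (S n) =
  psum (fun h => e ^ (h + 1)) n * psum (fun h => e ^ (h + 1)) n - psum (fun h => (e ^ 2) ^ (h + 1)) n.
Proof.
  rewrite pairsum_square. f_equal.
  - rewrite <- psum_scal. apply psum_ext. intros h _.
    rewrite (Cmult_comm (psum _ n)), <- psum_scal. apply psum_ext. intros j _.
    rewrite <- Cpow_add_r. f_equal. lia.
  - apply psum_ext. intros h _. rewrite <- Cpow_mult_r. f_equal. lia.
Qed.

Definition root_angle (m r : nat) : R := (PI * INR r / INR m)%R.
Definition croot (m r : nat) : C := Cexp (Ci * RtoC (root_angle m r)).

Lemma Cexp_Ci x : Cexp (Ci * RtoC x) = (cos x, sin x).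
Proof.
  unfold Cexp, Ci, Re, Im. simpl.
  replace (0 * x - 1 * 0)%R with 0%R by ring. replace (0 * 0 + 1 * x)%R with x by ring.
  rewrite exp_0, !Rmult_1_l. reflexivity.
Qed.

Lemma croot_pow m r s : croot m r ^ s = (cos (INR s * root_angle m r), sin (INR s * root_angle m r)).
Proof.
  unfold croot. rewrite Cexp_pow, <- Cexp_Ci. f_equal. rewrite RtoC_mult. ring.
Qed.

Lemma sin_PI_INR n : sin (INR n * PI) = 0%R.
Proof.
  apply sin_eq_0_1. exists (Z.of_nat n). now rewrite <- INR_IZR_INZ.
Qed.

Lemma croot_pow_m m r : (0 < m)%nat -> croot m r ^ m = RtoC ((-1) ^ r).
Proof.
  intros Hm. rewrite croot_pow. unfold root_angle.
  replace (INR m * (PI * INR r / INR m))%R with (INR r * PI)%R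
    by (field; apply not_0_INR; lia).
  rewrite cos_PI_INR, sin_PI_INR. reflexivity.
Qed.

(** Only the residues [m] and [2m] give the roots of unity [- 1] and 1, where the
    geometric sums degenerate. *)
Lemma croot_sq_neq_1 m r : (0 < r < 2 * m)%nat -> r <> m -> croot m r ^ 2 <> 1.
Proof.
  intros Hr Hrm E. assert (HPI := PI_RGT_0).
  assert (Hm : (0 < INR m)%R) by (apply lt_0_INR; lia).
  unfold croot in E. rewrite Cexp_pow in E. simpl (INR 2) in E.
  set (q := (INR r / INR m)%R).
  assert (Hq : (0 < q)%R) by (apply Rdiv_lt_0_compat; auto; apply lt_0_INR; lia).
  replace ((1 + 1)%R * (Ci * RtoC (root_angle m r))) with (Ci * RtoC (2 * PI * q)) in E.
  2:{ unfold root_angle, q. replace (2 * PI * (INR r / INR m))%R with ((1 + 1) * (PI * INR r / INR m))%R by (field; lra).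
      rewrite RtoC_mult. ring. }
  assert (G : forall x, Im (Ci * RtoC x) = x) by (intros; unfold Im; simpl; ring).
  destruct (Nat.lt_total r m) as [L|[L|L]]; [|lia|].
  - assert (q < 1)%R by (apply Rlt_div_l; auto; rewrite Rmult_1_l; now apply lt_INR).
    assert (K : Ci * RtoC (2 * PI * q) = Ci * RtoC 0).
    { apply Cexp_inj.
      - rewrite E. replace (Ci * RtoC 0) with (RtoC 0) by ring. now rewrite Cexp_0.
      - rewrite !G. apply Rabs_def1; nra. }
    apply (f_equal Im) in K. rewrite !G in K. nra.
  - assert (1 < q)%R by (apply Rlt_div_r; auto; rewrite Rmult_1_l; now apply lt_INR).
    assert (q < 2)%R.
    { apply Rlt_div_l; auto. replace 2%R with (INR 2) by (simpl; ring). rewrite <- mult_INR. apply lt_INR. lia. }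
    assert (K : Ci * RtoC (2 * PI * q) = Ci * RtoC (2 * PI)).
    { apply Cexp_inj.
      - rewrite E, Cexp_Ci, cos_2PI, sin_2PI. reflexivity.
      - rewrite !G. apply Rabs_def1; nra. }
    apply (f_equal Im) in K. rewrite !G in K. nra.
Qed.

Definition cot_coef (m r : nat) : R := (cos (root_angle m r) / (1 - cos (root_angle m r)))%R.

(** The value of the sum over pairs of [cos (pi (h + j) r / m)] for [1 <= r <= 2m].
    The last two terms are the corrections at the residues where the root of unity is
    [- 1] or 1; they are the source of the factors [P(z^{1/2})] and of the extra
    powers of [P(z)]. *)
Definition pair_char (m r : nat) : R :=
  ((if Nat.even r then 1 else - cot_coef m r)
   + (if Nat.eqb r m then - (INR m / 2) else 0)
   + (if Nat.eqb r (2 * m) then (INR m ^ 2 - 3 * INR m) / 2 else 0))%R.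

Lemma croot_1m_conj m r : (1 - croot m r) * (1 - croot m r) = RtoC (2 * (cos (root_angle m r) - 1)) * croot m r.
Proof.
  unfold croot. rewrite Cexp_Ci. set (x := root_angle m r). assert (E := sin2_cos2 x). unfold Rsqr in E.
  apply injective_projections; simpl; [nra | ring].
Qed.

Lemma croot_1_sq m r : 1 + croot m r ^ 2 = RtoC (2 * cos (root_angle m r)) * croot m r.
Proof.
  unfold croot. rewrite Cexp_Ci. set (x := root_angle m r). assert (E := sin2_cos2 x). unfold Rsqr in E.
  apply injective_projections; simpl; [nra | ring].
Qed.

(** By [pairsum_pow] the sum is [(S1^2 - S2) / 2] with geometric sums of [e] and
    [e^2], where [e^m = (-1)^r]. For odd [r] one finds [S1 = (e + 1)/(1 - e)], and [(1
    + e^2) / (1 - e)^2 = - cos / (1 - cos)]. *)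
Lemma pairsum_root m r : (0 < m)%nat -> (0 < r <= 2 * m)%nat ->
  pairsum (fun s => croot m r ^ s) m = RtoC (pair_char m r).
Proof.
  intros Hm Hr. destruct m as [|n]; [lia|]. set (m := S n) in *.
  assert (Hmn : INR m = (INR n + 1)%R) by (unfold m; apply S_INR).
  assert (Hm0 : (0 < INR m)%R) by (apply lt_0_INR; lia).
  apply C2_inj. unfold m at 2. rewrite pairsum_pow. fold m. set (e := croot m r).
  set (S1 := psum (fun h => e ^ (h + 1)) n). set (S2 := psum (fun h => (e ^ 2) ^ (h + 1)) n).
  assert (H1 : (1 - e) * S1 = e - RtoC ((-1) ^ r)).
  { unfold S1. rewrite psum_geom_from_1. replace (n + 1)%nat with m by (unfold m; lia).
    unfold e. now rewrite croot_pow_m. }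
  assert (H2 : (1 - e ^ 2) * S2 = e ^ 2 - 1).
  { unfold S2. rewrite psum_geom_from_1. replace (n + 1)%nat with m by (unfold m; lia).
    rewrite <- Cpow_mult_r, (Nat.mul_comm 2), Cpow_mult_r. unfold e. rewrite croot_pow_m by auto.
    rewrite <- RtoC_pow, <- pow_mult, Nat.mul_comm, pow_1_even. reflexivity. }
  assert (Hone : forall x : C, x = 1 -> psum (fun h => x ^ (h + 1)) n = RtoC (INR n)).
  { intros x ->. rewrite (psum_ext _ (fun _ => RtoC 1)) by (intros; apply Cpow_1_l).
    rewrite psum_const. ring. }
  unfold pair_char.
  destruct (Nat.eqb_spec r (2 * m)) as [E2|N2].
  - assert (Ee : e = 1).
    { unfold e, croot. rewrite Cexp_Ci. unfold root_angle. rewrite E2, mult_INR. simpl (INR 2).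
      replace (PI * ((1 + 1) * INR m) / INR m)%R with (2 * PI)%R by (field; lra).
      now rewrite cos_2PI, sin_2PI. }
    assert (ES1 : S1 = RtoC (INR n)) by (apply Hone; auto).
    assert (ES2 : S2 = RtoC (INR n)) by (apply Hone; rewrite Ee; ring).
    destruct (Nat.eqb_spec r m); [lia|]. rewrite E2, Nat.even_mul. simpl orb.
    rewrite ES1, ES2, <- !RtoC_mult, <- RtoC_minus. f_equal. rewrite Hmn. field.
  - destruct (Nat.eqb_spec r m) as [E1|N1].
    + assert (Ee : e = - (1)).
      { unfold e, croot. rewrite Cexp_Ci. unfold root_angle. rewrite E1.
        replace (PI * INR m / INR m)%R with PI by (field; lra).
        rewrite cos_PI, sin_PI. apply injective_projections; simpl; ring. }
      assert (ES2 : S2 = RtoC (INR n)) by (apply Hone; rewrite Ee; ring).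
      assert (ES1 : 2 * S1 = - (1) - RtoC ((-1) ^ r)).
      { rewrite <- Ee at 1. rewrite <- H1, Ee. ring. }
      assert (ES1' : S1 = RtoC ((-1 - (-1) ^ r) / 2)).
      { apply C2_inj. rewrite ES1, <- RtoC_opp, <- RtoC_minus, <- RtoC_mult. f_equal. field. }
      rewrite ES1', ES2, <- !RtoC_mult, <- RtoC_minus. f_equal.
      destruct (Nat.even r) eqn:Er.
      * apply Nat.even_spec in Er. destruct Er as [k ->]. rewrite pow_1_even, Hmn. field.
      * assert (Od : Nat.odd r = true) by (rewrite <- Nat.negb_even, Er; reflexivity).
        apply Nat.odd_spec in Od. destruct Od as [k Ek].
        assert (Ec : cot_coef m r = (- (1) / 2)%R).
        { unfold cot_coef, root_angle. rewrite E1.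
          replace (PI * INR m / INR m)%R with PI by (field; lra). rewrite cos_PI. field. }
        rewrite Ec, Ek. replace (2 * k + 1)%nat with (S (2 * k)) by lia.
        rewrite pow_1_odd, Hmn. field.
    + assert (Ne2 : e ^ 2 <> 1) by (apply croot_sq_neq_1; lia).
      assert (Ne : 1 - e <> 0).
      { intros K. apply Ne2. replace e with (1 - (1 - e)) by ring. rewrite K. ring. }
      assert (Ne2' : 1 - e ^ 2 <> 0).
      { intros K. apply Ne2. replace (e ^ 2) with (1 - (1 - e ^ 2)) by ring. rewrite K. ring. }
      assert (ES2 : S2 = - (1)).
      { replace S2 with ((1 - e ^ 2) * S2 / (1 - e ^ 2)) by (field; auto). rewrite H2. field. auto. }
      assert (ES1 : S1 = (e - RtoC ((-1) ^ r)) / (1 - e)) by (rewrite <- H1; field; auto).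
      rewrite ES1, ES2.
      destruct (Nat.even r) eqn:Er.
      * apply Nat.even_spec in Er. destruct Er as [k ->]. rewrite pow_1_even.
        replace (1 + 0 + 0)%R with 1%R by ring. field. auto.
      * assert (Od : Nat.odd r = true) by (rewrite <- Nat.negb_even, Er; reflexivity).
        apply Nat.odd_spec in Od. destruct Od as [k Ek].
        replace ((-1) ^ r)%R with (-1)%R.
        2:{ rewrite Ek. replace (2 * k + 1)%nat with (S (2 * k)) by lia. now rewrite pow_1_odd. }
        assert (A1 := croot_1m_conj m r). assert (A2 := croot_1_sq m r). fold e in A1, A2.
        assert (Nz : e <> 0) by apply Cexp_neq_0.
        assert (Nc : (cos (root_angle m r) - 1 <> 0)%R).
        { intros K. rewrite K in A1. replace (2 * 0)%R with 0%R in A1 by ring.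
          rewrite Cmult_0_l in A1. now apply (Cmult_neq_0 _ _ Ne Ne). }
        replace ((e - RtoC (-1)) / (1 - e) * ((e - RtoC (-1)) / (1 - e)) - - (1))
          with (2 * ((1 + e ^ 2) / ((1 - e) * (1 - e)))) by (field; auto).
        f_equal. rewrite A1, A2. unfold cot_coef.
        replace (RtoC (2 * cos (root_angle m r)) * e / (RtoC (2 * (cos (root_angle m r) - 1)) * e))
          with (RtoC (2 * cos (root_angle m r)) / RtoC (2 * (cos (root_angle m r) - 1))).
        2:{ field. split; auto. apply RtoC_neq_0. lra. }
        rewrite <- RtoC_div by lra. f_equal. field. lra.
Qed.

(** * Regrouping the dual series by residues modulo 2m *)

Lemma psum_block u M J : psum (fun j => psum (fun i => u (M * j + i)%nat) M) J = psum u (M * J).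
Proof.
  induction J as [|J IH]; [now rewrite Nat.mul_0_r|].
  rewrite psum_S, IH. replace (M * S J)%nat with (M * J + M)%nat by lia.
  now rewrite psum_add.
Qed.

Lemma Cser_block u s M : (0 < M)%nat -> Cser u s ->
  Cser (fun j => psum (fun i => u (M * j + i)%nat) M) s.
Proof.
  intros HM H. apply Ccv_ext with (fun J => psum u (M * J)).
  - intros J. symmetry. apply psum_block.
  - apply (Ccv_subseq (psum u) s (fun J => M * J)%nat); auto. intros; nia.
Qed.

Lemma psum_delta (p n : nat) (c : R) (g : nat -> C) : (0 < p <= n)%nat ->
  psum (fun i => RtoC (if Nat.eqb (i + 1) p then c else 0) * g (i + 1)%nat) n = RtoC c * g p.
Proof.
  intros [Hp Hn].
  assert (Z : forall k, (k < p)%nat ->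
    psum (fun i => RtoC (if Nat.eqb (i + 1) p then c else 0) * g (i + 1)%nat) k = 0).
  { induction k as [|k IH]; intros Hk; [reflexivity|]. rewrite psum_S, IH by lia.
    destruct (Nat.eqb_spec (k + 1) p); [lia|]. ring. }
  induction Hn as [|n Hn IH].
  - destruct p as [|p]; [lia|]. rewrite psum_S, Z by lia.
    rewrite Nat.add_1_r, Nat.eqb_refl. ring.
  - rewrite psum_S, IH. destruct (Nat.eqb_spec (n + 1) p); [lia|]. ring.
Qed.

Lemma psum_parity (a : nat -> R) (g : nat -> C) n :
  psum (fun i => RtoC (if Nat.even (i + 1) then 1 else - a (i + 1)%nat) * g (i + 1)%nat) (2 * n) =
  psum (fun l => g (2 * l + 2)%nat) n - psum (fun l => RtoC (a (2 * l + 1)%nat) * g (2 * l + 1)%nat) n.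
Proof.
  induction n as [|n IH]; [rewrite !psum_0; ring|].
  replace (2 * S n)%nat with (S (S (2 * n))) by lia. rewrite !psum_S, IH.
  replace (S (2 * n) + 1)%nat with (2 * n + 2)%nat by lia.
  replace (Nat.even (2 * n + 2)) with true
    by (symmetry; apply Nat.even_spec; exists (n + 1)%nat; lia).
  replace (Nat.even (2 * n + 1)) with false.
  - rewrite RtoC_opp. ring.
  - symmetry. rewrite <- Nat.negb_odd. replace (Nat.odd (2 * n + 1)) with true; auto.
    symmetry. apply Nat.odd_spec. now exists n.
Qed.

(** Splitting one period into even residues, odd residues and the two corrections. *)
Lemma psum_pair_char m (g : nat -> C) : (0 < m)%nat ->
  psum (fun i => RtoC (pair_char m (i + 1)) * g (i + 1)%nat) (2 * m) =
  psum (fun l => g (2 * l + 2)%nat) m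
  - psum (fun l => RtoC (cot_coef m (2 * l + 1)) * g (2 * l + 1)%nat) m
  + RtoC (- (INR m / 2)) * g m + RtoC ((INR m ^ 2 - 3 * INR m) / 2) * g (2 * m)%nat.
Proof.
  intros Hm. rewrite <- (psum_parity (cot_coef m)).
  rewrite <- (psum_delta m (2 * m)), <- (psum_delta (2 * m) (2 * m)) by lia.
  rewrite <- !psum_plus. apply psum_ext. intros i _. unfold pair_char. rewrite !RtoC_plus. ring.
Qed.

Lemma lambert_term_scale d b w : d <> 0%R -> b <> 0%R -> 1 - Cexp (RtoC b * (RtoC d * w)) <> 0 ->
  lambert_term (d * b) w = / RtoC d * lambert_term b (RtoC d * w).
Proof.
  intros Hd Hb N. unfold lambert_term.
  replace (RtoC (d * b) * w) with (RtoC b * (RtoC d * w)) by (rewrite RtoC_mult; ring).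
  rewrite RtoC_mult. field. repeat split; auto; now apply RtoC_neq_0.
Qed.

Lemma C1m_Cexp_scal_neq_0 b w : (0 < b)%R -> (Re w < 0)%R -> 1 - Cexp (RtoC b * w) <> 0.
Proof.
  intros Hb Hw. apply C1m_neq_0. rewrite Cmod_Cexp_scal. apply exp_lt_1. nra.
Qed.

Lemma Re_scal_neg x w : (0 < x)%R -> (Re w < 0)%R -> (Re (RtoC x * w) < 0)%R.
Proof. intros Hx Hw. unfold Re in *. simpl. nra. Qed.

(** Terms of a Lambert series along an arithmetic progression of difference [d] form a
    Lambert series in the variable [d w]. *)
Lemma lambert_scale_ser d al w : (0 < d)%R -> (0 < al)%R -> (Re w < 0)%R ->
  Cser (fun j => lambert_term (d * (INR j + al)) w) (/ RtoC d * lambert al (RtoC d * w)).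
Proof.
  intros Hd Hal Hw. assert (Hw' := Re_scal_neg d w Hd Hw).
  apply Cser_ext with (fun j => / RtoC d * lambert_term (INR j + al) (RtoC d * w)).
  - intros j. assert (Hj := pos_INR j). symmetry. apply lambert_term_scale; try lra.
    apply C1m_Cexp_scal_neq_0; lra.
  - now apply Cser_scal, lambert_ser.
Qed.

(** The dual series runs over all powers of [e^{w/(2m)}]. Even exponents give [logP]
    at [e^{w/m}], exponents congruent to [m] modulo [2m] give [logP] at [e^{w/2}]
    minus its even part, multiples of [2m] give [logP] at [e^w], and the odd residues
    give the series of [L]. *)
Lemma dual_series_by_residues m w cc T : (0 < m)%nat -> (Re w < 0)%R ->
  (forall j i, (i < 2 * m)%nat -> cc (2 * m * j + i)%nat = pair_char m (i + 1)) ->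
  Cser (fun k => RtoC (cc k) * lambert_term (INR k + 1) (RtoC (/ (2 * INR m)) * w)) T ->
  T = RtoC (1 / 2) * lambert 1 (RtoC (1 / INR m) * w)
      - RtoC (/ (2 * INR m)) * psum (fun l => RtoC (cot_coef m (2 * l + 1))
            * lambert ((2 * INR l + 1) / (2 * INR m)) w) m
      - RtoC (1 / 2) * (lambert 1 (RtoC (1 / 2) * w) - RtoC (1 / 2) * lambert 1 w)
      + RtoC ((INR m - 3) / 4) * lambert 1 w.
Proof.
  intros Hm Hw Hcc HT. assert (Hm0 : (0 < INR m)%R) by now apply lt_0_INR.
  assert (Nm : RtoC (INR m) <> 0) by (apply RtoC_neq_0; lra).
  set (v := RtoC (/ (2 * INR m)) * w) in *.
  assert (Hv : (Re v < 0)%R) by (apply Re_scal_neg; auto; apply Rinv_0_lt_compat; lra).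
  set (f := fun n : nat => lambert_term (INR n) v).
  assert (HB := Cser_block _ _ (2 * m) ltac:(lia) HT).
  (* [E1]: even exponents; [E2]: one odd residue; [E4]: multiples of [2m]; [E3]: exponents
     congruent to [m], as all multiples of [m] minus those of [2m]. *)
  assert (E1 : Cser (fun J => psum (fun l => f (2 * m * J + (2 * l + 2))%nat) m)
      (/ RtoC 2 * lambert 1 (RtoC 2 * v))).
  { assert (H := Cser_block _ _ m Hm (lambert_scale_ser 2 1 v ltac:(lra) ltac:(lra) Hv)).
    revert H. apply Cser_ext. intros J. apply psum_ext. intros l _. unfold f. f_equal.
    rewrite !plus_INR, !mult_INR. simpl (INR 2). ring. }
  assert (E2 : forall l, Cser (fun J => f (2 * m * J + (2 * l + 1))%nat)
      (/ RtoC (2 * INR m) * lambert ((2 * INR l + 1) / (2 * INR m)) (RtoC (2 * INR m) * v))).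
  { intros l. assert (Hl := pos_INR l).
    assert (H := lambert_scale_ser (2 * INR m) ((2 * INR l + 1) / (2 * INR m)) v ltac:(lra)
       ltac:(apply Rdiv_lt_0_compat; lra) Hv).
    revert H. apply Cser_ext. intros J. unfold f. f_equal.
    rewrite !plus_INR, !mult_INR. simpl (INR 2). simpl (INR 1). field. lra. }
  assert (E4 : Cser (fun J => f (2 * m * J + 2 * m)%nat) (/ RtoC (2 * INR m) * lambert 1 (RtoC (2 * INR m) * v))).
  { assert (H := lambert_scale_ser (2 * INR m) 1 v ltac:(lra) ltac:(lra) Hv).
    revert H. apply Cser_ext. intros J. unfold f. f_equal.
    rewrite !plus_INR, !mult_INR. simpl (INR 2). ring. }
  assert (E3 : Cser (fun J => f (2 * m * J + m)%nat)
     (/ RtoC (INR m) * lambert 1 (RtoC (INR m) * v) - / RtoC (2 * INR m) * lambert 1 (RtoC (2 * INR m) * v))).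
  { assert (H := Cser_minus _ _ _ _ (Cser_block _ _ 2 ltac:(lia)
       (lambert_scale_ser (INR m) 1 v Hm0 ltac:(lra) Hv)) E4).
    revert H. apply Cser_ext. intros J. rewrite !psum_S, psum_0. unfold f.
    replace (INR m * (INR (2 * J + 0) + 1))%R with (INR (2 * m * J + m))
      by (rewrite !plus_INR, !mult_INR; simpl; ring).
    replace (INR m * (INR (2 * J + 1) + 1))%R with (INR (2 * m * J + 2 * m))
      by (rewrite !plus_INR, !mult_INR; simpl; ring).
    ring. }
  assert (E : Cser (fun J => psum (fun i => RtoC (cc (2 * m * J + i)%nat)
      * lambert_term (INR (2 * m * J + i) + 1) v) (2 * m))
    (/ RtoC 2 * lambert 1 (RtoC 2 * v)
     - psum (fun l => RtoC (cot_coef m (2 * l + 1)) * (/ RtoC (2 * INR m) * lambert ((2 * INR l + 1) / (2 * INR m)) (RtoC (2 * INR m) * v))) m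
     + RtoC (- (INR m / 2)) * (/ RtoC (INR m) * lambert 1 (RtoC (INR m) * v) - / RtoC (2 * INR m) * lambert 1 (RtoC (2 * INR m) * v))
     + RtoC ((INR m ^ 2 - 3 * INR m) / 2) * (/ RtoC (2 * INR m) * lambert 1 (RtoC (2 * INR m) * v)))).
  { assert (H := Cser_plus _ _ _ _ (Cser_plus _ _ _ _ (Cser_minus _ _ _ _ E1
        (Cser_psum (fun l J => RtoC (cot_coef m (2 * l + 1)) * f (2 * m * J + (2 * l + 1))%nat) _ m
           (fun l _ => Cser_scal (RtoC (cot_coef m (2 * l + 1))) _ _ (E2 l))))
        (Cser_scal (RtoC (- (INR m / 2))) _ _ E3))
        (Cser_scal (RtoC ((INR m ^ 2 - 3 * INR m) / 2)) _ _ E4)).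
    revert H. apply Cser_ext. intros J. cbv beta.
    rewrite <- (psum_pair_char m (fun i => f (2 * m * J + i)%nat) Hm).
    apply psum_ext. intros i Hi. rewrite Hcc by auto. f_equal. unfold f. f_equal.
    rewrite !plus_INR. simpl (INR 1). ring. }
  rewrite (Cser_unique _ _ _ HB E).
  replace (RtoC (2 * INR m) * v) with w.
  2:{ unfold v. rewrite RtoC_inv by lra. field. apply RtoC_neq_0. lra. }
  replace (RtoC 2 * v) with (RtoC (1 / INR m) * w).
  2:{ unfold v. rewrite RtoC_inv, RtoC_div, RtoC_mult by lra. field. auto. }
  replace (RtoC (INR m) * v) with (RtoC (1 / 2) * w).
  2:{ unfold v. rewrite RtoC_inv, RtoC_mult, RtoC_div by lra. field. auto. }
  rewrite (psum_ext (fun l => RtoC (cot_coef m (2 * l + 1)) * (/ RtoC (2 * INR m) * lambert ((2 * INR l + 1) / (2 * INR m)) w))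
    (fun l => RtoC (/ (2 * INR m)) * (RtoC (cot_coef m (2 * l + 1)) * lambert ((2 * INR l + 1) / (2 * INR m)) w))).
  2:{ intros l _. rewrite RtoC_inv by lra. ring. }
  rewrite psum_scal, RtoC_inv by lra.
  set (A := psum _ m). set (l1 := lambert 1 (RtoC (1 / INR m) * w)).
  set (l2 := lambert 1 (RtoC (1 / 2) * w)). set (l3 := lambert 1 w).
  replace (INR m ^ 2 - 3 * INR m)%R with (INR m * (INR m - 3))%R by ring.
  rewrite RtoC_opp, !RtoC_div, !RtoC_mult, !RtoC_minus by lra. field. auto.
Qed.

(** * The formula for Q_m *)

Lemma INR_double m : INR (2 * m) = (2 * INR m)%R.
Proof. rewrite mult_INR. reflexivity. Qed.

Lemma pair_ratio_range m s : (0 < s < 2 * m)%nat -> (0 < INR s / (2 * INR m) < 1)%R.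
Proof.
  intros Hs. assert (Hm0 : (0 < INR m)%R) by (apply lt_0_INR; lia).
  split; [apply Rdiv_lt_0_compat; [apply lt_0_INR; lia | lra]|].
  apply Rlt_div_l; [lra|]. rewrite Rmult_1_l, <- INR_double.
  apply lt_INR. lia.
Qed.

(** The residues [s] and [2m - s] together form the generalized eta product with [a =
    s / (2m)] and [t = 2 m tau]. *)
Lemma residue_plus_reflected m s tau : (0 < s < 2 * m)%nat -> (0 < Re tau)%R ->
  Cser (theta_term (INR s / (2 * INR m)) (RtoC (2 * INR m) * tau))
    (lambert_residue m s (Cexp (- tau)) + lambert_residue m (2 * m - s) (Cexp (- tau))).
Proof.
  intros Hs Ht. assert (Hm0 : (0 < INR m)%R) by (apply lt_0_INR; lia).
  assert (Hz : (Cmod (Cexp (- tau)) < 1)%R).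
  { rewrite Cmod_Cexp. apply exp_lt_1. change (- Re tau < 0)%R. lra. }
  assert (H := Cser_plus _ _ _ _ (lambert_residue_ser m s _ ltac:(lia) ltac:(lia) Hz)
                 (lambert_residue_ser m (2 * m - s) _ ltac:(lia) ltac:(lia) Hz)).
  revert H. apply Cser_ext. intros j. unfold theta_term.
  rewrite !Cexp_pow.
  assert (Hj := INR_S_ge_1 j).
  replace (RtoC (INR (j + 1)) * (RtoC (INR (2 * m)) * - tau)) with (- (RtoC (INR (j + 1)) * (RtoC (2 * INR m) * tau)))
    by (rewrite INR_double, !RtoC_mult; ring).
  replace (RtoC (INR (j + 1)) * (RtoC (INR s) * - tau))
    with (- (RtoC (INR (j + 1) * (INR s / (2 * INR m))) * (RtoC (2 * INR m) * tau))).
  2:{ replace (INR (j + 1) * (INR s / (2 * INR m)))%R with (INR (j + 1) * INR s * / (2 * INR m))%R by (field; lra).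
      rewrite !(RtoC_mult (_ * _)), RtoC_inv, (RtoC_mult (INR (j + 1))) by lra. field. apply RtoC_neq_0. lra. }
  replace (RtoC (INR (j + 1)) * (RtoC (INR (2 * m - s)) * - tau))
    with (- (RtoC (INR (j + 1) * (1 - INR s / (2 * INR m))) * (RtoC (2 * INR m) * tau))).
  2:{ rewrite minus_INR, INR_double by lia.
      replace (INR (j + 1) * (1 - INR s / (2 * INR m)))%R with (INR (j + 1) * (2 * INR m - INR s) * / (2 * INR m))%R by (field; lra).
      rewrite !(RtoC_mult (_ * _)), RtoC_inv, (RtoC_mult (INR (j + 1))) by lra.
      field. apply RtoC_neq_0. lra. }
  assert (N := C1m_Cexp_opp_neq_0 (RtoC (INR (j + 1)) * (RtoC (2 * INR m) * tau))
    (Re_scal_pos (INR (j + 1)) _ ltac:(lra) (Re_scal_pos (2 * INR m) tau ltac:(lra) Ht))).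
  field. split; auto. apply INR_S_neq_0.
Qed.

Lemma pairsum_cos m n : pairsum (fun s => RtoC (cos (INR s * root_angle m n))) m
  = RtoC (Re (pairsum (fun s => croot m n ^ s) m)).
Proof.
  unfold pairsum. induction (index_pairs m) as [|a l IH]; [reflexivity|].
  simpl map. simpl Csum. rewrite IH, croot_pow, <- RtoC_plus. reflexivity.
Qed.

Lemma pair_cos_periodic m J i : (0 < m)%nat -> (i < 2 * m)%nat ->
  Re (pairsum (fun s => croot m (2 * m * J + i + 1) ^ s) m) = pair_char m (i + 1).
Proof.
  intros Hm Hi. assert (Hm0 : (0 < INR m)%R) by now apply lt_0_INR.
  assert (E : croot m (2 * m * J + i + 1) = croot m (i + 1)).
  { unfold croot. rewrite !Cexp_Ci.
    replace (root_angle m (2 * m * J + i + 1)) with (root_angle m (i + 1) + 2 * INR J * PI)%R.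
    - now rewrite cos_period, sin_period.
    - unfold root_angle. rewrite !plus_INR, !mult_INR. simpl (INR 2). field. lra. }
  rewrite E, pairsum_root by lia. apply re_RtoC.
Qed.

(** The contribution of the dual series of [Q_m]: together with one [lambert 1 w] from
    [P] it is the logarithm of [K] times [L]. *)
Definition dual_exponent (m : nat) (w : C) : C :=
  RtoC (1 / 2) * lambert 1 (RtoC (1 / INR m) * w)
  - RtoC (/ (2 * INR m)) * psum (fun l => RtoC (cot_coef m (2 * l + 1))
        * lambert ((2 * INR l + 1) / (2 * INR m)) w) m
  - RtoC (1 / 2) * (lambert 1 (RtoC (1 / 2) * w) - RtoC (1 / 2) * lambert 1 w)
  + RtoC ((INR m - 3) / 4) * lambert 1 w.

(** Half the sum over pairs of [theta_log], using the symmetry of the pairs. *)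
Lemma residue_sum_transformation m tau : (0 < m)%nat -> (0 < Re tau)%R ->
  let w := - (RtoC (4 * PI ^ 2) / tau) in
  pairsum (fun s => lambert_residue m s (Cexp (- tau))) m =
  RtoC (1 / 2) * pairsum (fun s => RtoC (PI ^ 2 / 3) / (RtoC (2 * INR m) * tau)) m
  - RtoC (1 / 2) * pairsum (fun s => RtoC (ln (2 * sin (PI * (INR s / (2 * INR m)))))) m
  - RtoC (1 / 2) * (RtoC (2 * INR m) * tau) *
      pairsum (fun s => RtoC (1 / 2 * ((INR s / (2 * INR m)) ^ 2 - INR s / (2 * INR m) + 1 / 6))) m
  + dual_exponent m w.
Proof.
  intros Hm Ht w. assert (Hm0 : (0 < INR m)%R) by now apply lt_0_INR.
  assert (Ht0 := Re_pos_neq_0 tau Ht). assert (HPI := PI_RGT_0).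
  set (t := RtoC (2 * INR m) * tau).
  assert (Htt : (0 < Re t)%R) by (apply Re_scal_pos; lra).
  assert (Hw : (Re w < 0)%R).
  { unfold w. assert (K := Re_inv_pos tau Ht). change (- Re (RtoC (4 * PI ^ 2) / tau) < 0)%R. lra. }
  set (v := RtoC (/ (2 * INR m)) * w).
  assert (Hv : (Re v < 0)%R) by (apply Re_scal_neg; auto; apply Rinv_0_lt_compat; lra).
  assert (Ev : - (RtoC (4 * PI ^ 2) / t) = v).
  { unfold v, w, t. rewrite RtoC_inv by lra. field. split; auto. apply RtoC_neq_0. lra. }
  set (bt := fun s k => RtoC (cos (freq k * (INR s / (2 * INR m)))) * lambert_term (INR k + 1) v).
  set (B := fun s => CSeries (bt s)).
  assert (HB : forall s, Cser (bt s) (B s)).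
  { intros s. apply Cser_abs_CSeries with
      (fun k => / (1 * (1 - exp (- (1 * (- Re v))))) * exp (- (- Re v)) ^ k)%R.
    - intros k. unfold bt. rewrite Cmod_mult, Cmod_R, <- Rmult_1_l.
      apply Rmult_le_compat; [apply Rabs_pos | apply Cmod_ge_0 | apply Rabs_le, COS_bound |].
      apply lambert_term_le; lra.
    - eexists. apply is_series_geom_scal, exp_geom_range. lra. }
  assert (HS : pairsum B m = dual_exponent m w).
  { apply (dual_series_by_residues m w (fun k => Re (pairsum (fun s => croot m (k + 1) ^ s) m))); auto.
    - intros j i Hi. now apply pair_cos_periodic.
    - assert (H := Cser_pairsum bt B m (fun s _ => HB s)). revert H. apply Cser_ext. intros k.
      rewrite <- pairsum_cos, Cmult_comm, <- pairsum_scal. apply pairsum_ext. intros s _. unfold bt. fold v.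
      rewrite Cmult_comm. f_equal. f_equal. f_equal. unfold freq, root_angle. field. lra. }
  apply C2_inj.
  assert (E2 : 2 * pairsum (fun s => lambert_residue m s (Cexp (- tau))) m =
     pairsum (fun s => lambert_residue m s (Cexp (- tau)) + lambert_residue m (2 * m - s) (Cexp (- tau))) m).
  { rewrite pairsum_plus, <- (pairsum_sym (fun s => lambert_residue m s (Cexp (- tau)))) by auto. ring. }
  rewrite E2.
  rewrite (pairsum_ext _ (fun s => (RtoC (PI ^ 2 / 3) / t + (- (1)) * RtoC (ln (2 * sin (PI * (INR s / (2 * INR m))))))
     + ((- t) * RtoC (1 / 2 * ((INR s / (2 * INR m)) ^ 2 - INR s / (2 * INR m) + 1 / 6)) + 2 * B s))).
  - rewrite !pairsum_plus, !pairsum_scal, HS.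
    set (p1 := pairsum (fun _ => _ / t) m). set (p2 := pairsum _ m). set (p3 := pairsum _ m).
    replace (RtoC (1 / 2)) with (/ RtoC 2).
    + field.
    + rewrite <- RtoC_inv by lra. f_equal. field.
  - intros s Hs.
    assert (Ha := pair_ratio_range m s Hs).
    apply (Cser_unique _ _ _ (residue_plus_reflected m s tau Hs Ht)).
    assert (H := theta_log (INR s / (2 * INR m)) t (B s) Ha Htt).
    rewrite Ev in H. specialize (H (HB s)). fold t.
    eapply (fun E => eq_rect _ (Cser _) H _ E). ring.
Qed.

(** * The constant factor *)

(** Positivity follows from the reflection formula, since both factors are
    non-negative and their product is positive. *)
Lemma Gamma_pos x : (0 < x < 1)%R -> (0 < Gamma x)%R.
Proof.
  intros Hx. assert (E := Gamma_reflection x Hx). assert (Hs := sin_PI_pos x Hx).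
  assert (HPI := PI_RGT_0). assert (P1 := Gamma_nonneg x ltac:(lra)).
  assert (K : (0 < PI / sin (PI * x))%R) by now apply Rdiv_lt_0_compat.
  destruct P1 as [P1|P1]; auto. rewrite <- P1 in E. lra.
Qed.

Lemma RtoC_Rprod (A : Type) (l : list A) (f : A -> R) :
  (forall a, In a l -> (0 < f a)%R) ->
  RtoC (Rprod (map f l)) = Cexp (Csum (map (fun a => RtoC (ln (f a))) l)).
Proof.
  induction l as [|a l IH]; intros H; simpl.
  - now rewrite Cexp_0.
  - rewrite Cexp_plus, <- IH, Cexp_RtoC, exp_ln, RtoC_mult; auto; intros; apply H; simpl; auto.
Qed.

(** The logarithm of the reflection formula, summed over all pairs and symmetrized. *)
Lemma pairsum_ln_Gamma m : (0 < m)%nat ->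
  2 * pairsum (fun s => RtoC (ln (Gamma (INR s / (2 * INR m))))) m =
  pairsum (fun _ => RtoC (ln (2 * PI))) m
  - pairsum (fun s => RtoC (ln (2 * sin (PI * (INR s / (2 * INR m)))))) m.
Proof.
  intros Hm. assert (Hm0 : (0 < INR m)%R) by now apply lt_0_INR. assert (HPI := PI_RGT_0).
  replace (2 * pairsum (fun s => RtoC (ln (Gamma (INR s / (2 * INR m))))) m)
    with (pairsum (fun s => RtoC (ln (Gamma (INR s / (2 * INR m))))) m
          + pairsum (fun s => RtoC (ln (Gamma (INR s / (2 * INR m))))) m) by ring.
  rewrite (pairsum_sym (fun s => RtoC (ln (Gamma (INR s / (2 * INR m))))) m Hm) at 2.
  rewrite <- pairsum_plus.
  replace (pairsum (fun _ => RtoC (ln (2 * PI))) m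
   - pairsum (fun s => RtoC (ln (2 * sin (PI * (INR s / (2 * INR m)))))) m)
  with (pairsum (fun s => RtoC (ln (2 * PI)) + (- (1)) * RtoC (ln (2 * sin (PI * (INR s / (2 * INR m)))))) m)
    by (rewrite pairsum_plus, pairsum_scal; ring).
  apply pairsum_ext. intros s Hs. assert (Ha := pair_ratio_range m s Hs).
  assert (Hsin := sin_PI_pos _ Ha).
  replace (INR (2 * m - s) / (2 * INR m))%R with (1 - INR s / (2 * INR m))%R.
  2:{ rewrite minus_INR, mult_INR by lia. simpl (INR 2). field. lra. }
  set (a := (INR s / (2 * INR m))%R) in *.
  replace (RtoC (ln (2 * PI)) + - (1) * RtoC (ln (2 * sin (PI * a))))
    with (RtoC (ln (2 * PI) - ln (2 * sin (PI * a)))) by (rewrite RtoC_minus; ring).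
  rewrite <- RtoC_plus. f_equal.
  rewrite <- ln_mult by (apply Gamma_pos; lra). rewrite Gamma_reflection by auto.
  rewrite <- ln_div by lra. f_equal. field. lra.
Qed.

(** The power of [2 pi] in [g_const] collects the factor [(2 pi)^{-1/2}] from [P] and
    one [(2 pi)^{-1/2}] per pair from the reflection formula. *)
Lemma g_const_exp m : (0 < m)%nat ->
  RtoC (g_const m) = Cexp (RtoC (- (1 / 2 * ln (2 * PI)))
     - RtoC (1 / 2) * pairsum (fun s => RtoC (ln (2 * sin (PI * (INR s / (2 * INR m)))))) m).
Proof.
  intros Hm. unfold g_const. rewrite RtoC_mult, RtoC_Rprod.
  2:{ intros a Hin. apply in_index_pairs in Hin. apply Gamma_pos, pair_ratio_range. lia. }
  unfold Rpower. rewrite <- Cexp_RtoC, <- Cexp_plus. f_equal.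
  change (Csum (map (fun a => RtoC (ln (Gamma (INR (fst a + snd a) / (2 * INR m))))) (index_pairs m)))
    with (pairsum (fun s => RtoC (ln (Gamma (INR s / (2 * INR m))))) m).
  assert (E := pairsum_ln_Gamma m Hm).
  set (X := pairsum (fun s => RtoC (ln (Gamma (INR s / (2 * INR m))))) m) in *.
  set (Y := pairsum (fun s => RtoC (ln (2 * sin (PI * (INR s / (2 * INR m)))))) m) in *.
  replace Y with (pairsum (fun _ => RtoC (ln (2 * PI))) m - 2 * X) by (rewrite E; ring).
  destruct m as [|n]; [lia|]. rewrite pairsum_const, S_INR.
  set (lp := ln (2 * PI)).
  replace (- (((INR n + 1) ^ 2 - 3 * (INR n + 1) + 4) / 4) * lp)%R
    with (- (1 / 2 * lp) - 1 / 2 * (INR n * (INR n - 1) / 2 * lp))%R by field.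
  rewrite RtoC_minus, (RtoC_mult (1 / 2)), (RtoC_mult (INR n * (INR n - 1) / 2)).
  replace (RtoC (1 / 2)) with (/ RtoC 2) by (rewrite <- RtoC_inv by lra; f_equal; field).
  field.
Qed.

Lemma pairsum_bernoulli m : (0 < m)%nat ->
  pairsum (fun s => RtoC (1 / 2 * ((INR s / (2 * INR m)) ^ 2 - INR s / (2 * INR m) + 1 / 6))) m
  = RtoC (- ((INR m - 1) * (INR m - 2) * (INR m + 3) / (96 * INR m))).
Proof.
  intros Hm. assert (Hm0 : (0 < INR m)%R) by now apply lt_0_INR.
  rewrite (pairsum_ext _ (fun s => RtoC (/ (8 * INR m ^ 2) * INR s ^ 2 + - / (4 * INR m) * INR s + / 12))).
  - destruct m as [|n]; [lia|]. rewrite pairsum_quadratic. f_equal.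
    rewrite S_INR in *. field. lra.
  - intros s _. f_equal. field. lra.
Qed.

(** * The transformation formula for G_m *)

Lemma L_exp m w : (0 < m)%nat ->
  L m (fun a => Cexp (RtoC a * w)) =
  Cexp (- (RtoC (/ (2 * INR m)) * psum (fun l => RtoC (cot_coef m (2 * l + 1))
        * lambert ((2 * INR l + 1) / (2 * INR m)) w) m)).
Proof.
  intros Hm. unfold L. f_equal.
  replace (1 / (2 * INR m))%R with (/ (2 * INR m))%R by (unfold Rdiv; ring).
  rewrite Csum_seq.
  match goal with |- - ?x * ?A = - (?x * ?B) => assert (E : A = B); [|rewrite E; ring] end.
  apply psum_ext. intros l _.
  assert (El : (2 * INR (1 + l) - 1 = 2 * INR l + 1)%R).
  { rewrite plus_INR. simpl (INR 1). ring. }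
  f_equal.
  - unfold L_coef, cot_coef, root_angle. rewrite El.
    replace (INR (2 * l + 1)) with (2 * INR l + 1)%R
      by (rewrite plus_INR, mult_INR; simpl; ring).
    now rewrite (Rmult_comm PI).
  - unfold L_expo. rewrite El. reflexivity.
Qed.

Theorem theorem1p2 (m : nat) (hm : (3 <= m)%nat) :
  (forall tau : C, (0 < Re tau)%R ->
     let w := - (RtoC (4 * PI ^ 2) / tau) in
     let pw := fun a : R => Cexp (RtoC a * w) in
     G m (Cexp (- tau)) =
       RtoC (g_const m) * Csqrt tau
       * Cexp (RtoC (varpi_const m) / tau + RtoC (phi_const m) * tau)
       * K m pw (Cexp w) * L m pw)
  /\ analytic_on slit_disc (fun z => K m (Cppow z) z)
  /\ analytic_on slit_disc (fun z => L m (Cppow z)).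
Proof.
  split; [|split; [apply K_analytic; lia | apply L_analytic; lia]].
  intros tau Ht w pw. assert (Hm : (0 < m)%nat) by lia.
  assert (Hm0 : (0 < INR m)%R) by now apply lt_0_INR.
  assert (Ht0 := Re_pos_neq_0 tau Ht). assert (HPI := PI_RGT_0).
  assert (Hz : (Cmod (Cexp (- tau)) < 1)%R).
  { rewrite Cmod_Cexp. apply exp_lt_1. change (- Re tau < 0)%R. lra. }
  unfold G. rewrite P_exp, Q_exp, logP_Cexp by auto.
  change (Csum (map (fun hj => lambert_residue m (fst hj + snd hj) (Cexp (- tau))) (index_pairs m)))
    with (pairsum (fun s => lambert_residue m s (Cexp (- tau))) m).
  rewrite residue_sum_transformation, eta_transformation by auto.
  unfold pw. rewrite L_exp by auto. unfold K, sqrt_Pquot, Ppow. rewrite !logP_Cexp.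
  rewrite g_const_exp by auto. fold w.
  rewrite pairsum_bernoulli by auto. unfold dual_exponent.
  set (Sn := pairsum (fun s => RtoC (ln (2 * sin (PI * (INR s / (2 * INR m)))))) m).
  rewrite (Cexp_minus (RtoC (- (1 / 2 * ln (2 * PI))))), Cexp_RtoC.
  set (Al := psum (fun l => RtoC (cot_coef m (2 * l + 1)) * lambert ((2 * INR l + 1) / (2 * INR m)) w) m).
  set (l1 := lambert 1 (RtoC (1 / INR m) * w)). set (l2 := lambert 1 (RtoC (1 / 2) * w)).
  set (l3 := lambert 1 w). set (c0 := RtoC (exp (- (1 / 2 * ln (2 * PI))))). set (sq := Csqrt tau).
  assert (EN : pairsum (fun _ => RtoC (PI ^ 2 / 3) / (RtoC (2 * INR m) * tau)) m
    = RtoC ((INR m - 1) * (INR m - 2) / 2) * (RtoC (PI ^ 2 / 3) / (RtoC (2 * INR m) * tau))).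
  { destruct m as [|n]; [lia|]. rewrite pairsum_const. f_equal. f_equal. rewrite S_INR. field. }
  rewrite EN. unfold Cdiv at 3. rewrite <- Cexp_opp.
  match goal with |- c0 * sq * Cexp ?a * Cexp ?b = c0 * Cexp ?c * sq * Cexp ?d * (Cexp ?e * Cexp ?f) * Cexp ?g =>
    assert (E : a + b = c + d + e + f + g);
    [| replace (c0 * sq * Cexp a * Cexp b) with (c0 * sq * (Cexp a * Cexp b)) by ring;
       rewrite <- Cexp_plus, E, !Cexp_plus; ring] end.
  (* All factors are exponentials; the identity of exponents is linear in the Lambert
     series, and the constants match by rational arithmetic in [m]. *)
  unfold varpi_const, phi_const.
  replace (RtoC (PI ^ 2 / 24 * (INR m + 1 + 2 / INR m)) / tau)
    with (RtoC (PI ^ 2 / 6) / tau + RtoC (1 / 2) * (RtoC ((INR m - 1) * (INR m - 2) / 2) * (RtoC (PI ^ 2 / 3) / (RtoC (2 * INR m) * tau)))).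
  2:{ replace (PI ^ 2 / 24 * (INR m + 1 + 2 / INR m))%R
        with (PI ^ 2 / 6 + 1 / 2 * ((INR m - 1) * (INR m - 2) / 2 * (PI ^ 2 / 3 * / (2 * INR m))))%R by (field; lra).
      rewrite RtoC_plus, (RtoC_mult (1 / 2)), (RtoC_mult ((INR m - 1) * (INR m - 2) / 2)), (RtoC_mult (PI ^ 2 / 3)), RtoC_inv by lra.
      field. split; auto. apply RtoC_neq_0. lra. }
  replace (RtoC ((INR m ^ 3 - 7 * INR m + 2) / 96))
    with (- RtoC (1 / 24) - RtoC (1 / 2) * RtoC (2 * INR m) * RtoC (- ((INR m - 1) * (INR m - 2) * (INR m + 3) / (96 * INR m)))).
  2:{ rewrite <- !RtoC_mult, <- RtoC_opp, <- RtoC_minus. f_equal. field. lra. }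
  replace (RtoC ((INR m + 2) / 4)) with (1 + RtoC (1 / 2) * RtoC (1 / 2) + RtoC ((INR m - 3) / 4)).
  2:{ rewrite <- !RtoC_mult, <- !RtoC_plus. f_equal. field. }
  ring.
Qed.
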